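(* Let $X,X_1,X_2,\dots$ be i.i.d. real random variables with distribution function $F$ and $E(X^2)<\infty$, let $X_{1n}\le\dots\le X_{nn}$ be the order statistics of $X_1,\dots,X_n$, let $J$ be a fixed score function on $(0,1)$ and $$L_n=\sum_{i=1}^nX_{in}\int_{(i-1)/n}^{i/n}J(u)\,du=\int_0^1F_n^{-1}(s)J(s)\,ds,$$ where $F_n$ is the empirical distribution function of $X_1,\dots,X_n$. Let $$m(J,F)=\int_{-\infty}^{\infty}xJ(F(x))\,dF(x),\qquad \sigma^2(J,F)=\int_{\mathbb R^2}J(F(x))J(F(y))\bigl(F(x\wedge y)-F(x)F(y)\bigr)\,dx\,dy,$$ and assume $\sigma^2(J,F)>0$. Suppose that the score function $J$ is trimmed near $0$ and $1$, that is, $J(u)=0$ for $u\in[0,t_1)\cup(t_2,1]$, where $0<t_1<t_2<1$. If $J$ is bounded and continuous a.e. Lebesgue measure and a.e. $F^{-1}$, then $\left\{\frac{\sqrt n}{a(n)}(L_n-m(J,F)),n\ge1\right\}$ satisfies the large deviation principle in $\mathbb R$ with speed $a^2(n)$ and rate function $$I^L(x)=\frac{x^2}{2\sigma^2(J,F)}.$$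
   Context: $a(n)$ is a sequence of positive reals with $a(n)\to\infty$ and $a(n)/\sqrt n\to0$. For a distribution function $H$, $H^{-1}(s)=\inf\{x;H(x)\ge s\}$. ''Continuous a.e. $F^{-1}$'' means that the set of discontinuity points of $J$ is null for the Lebesgue–Stieltjes measure on $(0,1)$ induced by the nondecreasing function $F^{-1}$. $x\wedge y=\min\{x,y\}$. Large deviation principle (LDP). For random variables $W_n$ with values in a metric space $\mathcal X$, positive $\lambda(n)\to\infty$, and $I:\mathcal X\to[0,\infty]$ with $\{I\le L\}$ compact for all $L\in\mathbb R$ (rate function), $\{W_n\}$ satisfies the LDP with speed $\lambda(n)$ and rate function $I$ if $\liminf_n\frac1{\lambda(n)}\log P(W_n\in U)\ge-\inf_UI$ for every open $U$ and $\limsup_n\frac1{\lambda(n)}\log P(W_n\in K)\le-\inf_KI$ for every closed $K$ ($\inf\emptyset=+\infty$, $\log 0=-\infty$).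
   Formalization: The printed centring m(J,F) makes the claim false when F has atoms (e.g. X Bernoulli). For general F the LDP is proved with m(J,F) replaced by the integral of F^{-1}(s)J(s) over (0,1); with the printed m(J,F) it is proved for continuous F. *)

(* Defs.v *)
From HB Require Import structures.
From mathcomp Require Import all_boot all_order all_algebra.
From mathcomp Require Import all_classical all_reals all_analysis.
Set Implicit Arguments.
Unset Strict Implicit.
Unset Printing Implicit Defensive.
Import Order.TTheory GRing.Theory Num.Theory.
Import numFieldNormedType.Exports.
Local Open Scope classical_set_scope.
Local Open Scope ring_scope.

Definition rate_function (R : realType) (E : topologicalType)
    (I : E -> \bar R) : Prop :=
  (forall x, (0 <= I x)%E) /\ (forall L : R, compact [set x | (I x <= L%:E)%E]).

(* Only the topology of E enters; the metric is irrelevant.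
   [lne] satisfies [lne 0 = -oo], and [ereal_inf set0 = +oo].  Only the indices
   n >= 1 matter; the value of a sequence at 0 is junk. *)
Definition LDP (R : realType) (d : measure_display) (T : measurableType d)
    (P : probability T R) (E : topologicalType) (W : nat -> T -> E)
    (lambda : nat -> R) (I : E -> \bar R) : Prop :=
  [/\ (forall n, (0 < n)%N -> 0 < lambda n) /\ lambda n @[n --> \oo] --> +oo,
      rate_function I,
      (forall U : set E, open U ->
        (- ereal_inf [set I x | x in U] <=
         limn_einf (fun n => ((lambda n)^-1)%:E * lne (P (W n @^-1` U))))%E) &
      (forall K : set E, closed K ->
        (limn_esup (fun n => ((lambda n)^-1)%:E * lne (P (W n @^-1` K))) <=
         - ereal_inf [set I x | x in K])%E)].

Definition mutually_independent (R : realType) (d : measure_display)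
    (T : measurableType d) (P : probability T R)
    (X : nat -> {RV P >-> R}) : Prop :=
  forall (s : seq nat) (A : nat -> set R),
    uniq s -> (forall i, measurable (A i)) ->
    P (\bigcap_(i in [set` s]) (X i @^-1` A i)) =
    (\prod_(i <- s) P (X i @^-1` A i))%E.

(* [Xs i] stands for X_{i+1}. *)
Definition iid_copies (R : realType) (d : measure_display)
    (T : measurableType d) (P : probability T R)
    (X : {RV P >-> R}) (Xs : nat -> {RV P >-> R}) : Prop :=
  mutually_independent Xs /\
  (forall i (A : set R), measurable A ->
    distribution P (Xs i) A = distribution P X A).

Definition distr_fun (R : realType) (d : measure_display)
    (T : measurableType d) (P : probability T R) (X : {RV P >-> R}) : R -> R :=
  fun x => fine (cdf X x).

Definition quantile (R : realType) (H : R -> R) (s : R) : R :=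
  inf [set x | s <= H x].

(* A is null for the Lebesgue-Stieltjes measure on ]0, 1[ induced by the
   nondecreasing left-continuous function g : ]0, 1[ -> R.  That measure is the
   one with mass g b - g a on [a, b[ for 0 < a <= b < 1; since g need not be
   bounded, nor right-continuous, the library's [lebesgue_stieltjes_measure]
   does not apply to it.  The values of nu outside ]0, 1[ play no role when A
   is included in ]0, 1[. *)
Definition stieltjes01_null (R : realType) (g : R -> R) (A : set R) : Prop :=
  exists2 nu : {measure set (measurableTypeR R) -> \bar R},
    (forall a b : R, 0 < a -> a <= b -> b < 1 ->
      nu `[a, b[%classic = (g b - g a)%:E) &
    nu.-negligible A.

Definition discontinuities01 (R : realType) (J : R -> R) : set R :=
  [set u | 0 < u < 1 /\ ~ {for u, continuous J}].

(* Indices are shifted: [order_stat Xs n i] is the (i+1)-th smallest value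
   among the first n variables. *)
Definition order_stat (R : realType) (T : Type) (Xs : nat -> T -> R)
    (n i : nat) (w : T) : R :=
  (sort <=%R (mkseq (fun k => Xs k w) n))`_i.

Definition Lstat (R : realType) (T : Type) (Xs : nat -> T -> R) (J : R -> R)
    (n : nat) (w : T) : R :=
  \sum_(i < n) order_stat Xs n i w *
    \int[@lebesgue_measure R]_(u in `[i%:R / n%:R, i.+1%:R / n%:R]) J u.

Definition sigma2 (R : realType) (J F : R -> R) : R :=
  \int[(@lebesgue_measure R \x @lebesgue_measure R)%E]_z
    (J (F z.1) * J (F z.2) * (F (Num.min z.1 z.2) - F z.1 * F z.2)).

(* The integral of x J(F(x)) against the law of X, i.e. against dF. *)
Definition mcenter (R : realType) (d : measure_display)
    (T : measurableType d) (P : probability T R) (X : {RV P >-> R})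
    (J : R -> R) : R :=
  \int[distribution P X]_x (x * J (distr_fun X x)).

(* The quantile form of the same centring, which agrees with [mcenter] when F
   is continuous.  It is the almost sure limit of L_n for every F.  When F has
   jumps [mcenter] can differ from it: if X is Bernoulli(p) then
   [mcenter X J = p * J 1 = 0] for a trimmed J, whereas L_n tends to the
   integral of J over [1 - p, 1]. *)
Definition qcenter (R : realType) (J F : R -> R) : R :=
  \int[@lebesgue_measure R]_(s in `]0, 1[) (quantile F s * J s).

(* Main.v *)
Require Import Defs.
From HB Require Import structures.
From mathcomp Require Import all_boot all_order all_algebra.
From mathcomp Require Import all_classical all_reals all_analysis.
From mathcomp Require Import measurable_realfun ring lra.
Set Implicit Arguments.
Unset Strict Implicit.
Unset Printing Implicit Defensive.
Import Order.TTheory GRing.Theory Num.Theory.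
Import numFieldNormedType.Exports.
Local Open Scope classical_set_scope.
Local Open Scope ring_scope.

(** The idea is to replace the L-statistic by an average of bounded independent
variables, with an error that is superexponentially small at the speed
[a(n)^2].

Let [F] be the distribution function, [F_n] the empirical one, [g] a Borel
function that agrees with the score at its continuity points ([reg_score]) and
[G] its primitive ([prim]).  Fix [A < B] with [F A < t1] and [t2 < F B].  When
[F_n A < t1] and [t2 < F_n B], summation by parts over the order statistics
gives
  [L_n = B * G 1 - \int_A^B G (F_n x) dx]
([Lstat_representation]), and Fubini gives the same formula, with [F] in place
of [F_n], for the centring in quantile form ([quantile_representation]).
Therefore [L_n] minus the centring is
  [- \int_A^B (F_n x - F x) * g (F x) dx]
plus a remainder.  The main term is the average of the variables
[influence (X_i)], which are bounded, centred and of variance [sigma2]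
([influence_mean], [influence_variance]); trimming is what makes them bounded.

Since [a(n) / sqrt n] tends to 0, the generating functions of the normalized
average are asymptotically Gaussian at the scale [a(n)^2]
([mgf_normalized_sum]), and Chernoff's bound together with an exponential
change of measure yields the large deviation principle.  The principle passes
to any sequence at superexponentially small distance ([LDP_quadratic_of_mgf]).

The remainder is the delicate point, because [g] has no modulus of continuity.
Bracketing the score between [k]-Lipschitz envelopes at distance [osc_env]
gives
  [|G v - G u - g u * (v - u)| <= |v - u| * osc_env k u + k * |v - u|^2]
([prim_remainder]).  Continuity of the score almost everywhere for the measure
induced by the quantile function makes [osc_env k (F x)] tend to 0
for almost every [x] ([stieltjes01_null_preimage]), so the mass of this weight
on the interval from [A] to [B] is as small as desired for large [k].  By
Jensen's inequality for this weight and the sub-Gaussian moments of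
[F_n x - F x] at each fixed [x], the first term exceeds a given multiple of
[a(n) / sqrt n] with probability at most [exp (- a(n)^2 L)], where [L] grows
as the mass decreases.  The quadratic term matters only where [|F_n - F|]
exceeds a threshold, an event whose probability is exponentially small in [n]
and hence negligible, as [a(n)^2 = o(n)] ([remainder_superexponential]).

Finally, when [F] is continuous, [F (quantile F s) = s], and the change of
variables [x = quantile F s] identifies the two centrings
([mcenter_qcenter]). *)

(** * Logarithmic limits, Markov bounds and comparisons *)

Section limits.
Context {R : realType}.

Lemma limn_esup_le_near (u : nat -> \bar R) (l : \bar R) :
  (\forall n \near \oo, (u n <= l)%E) -> (limn_esup u <= l)%E.
Proof.
move=> ul; rewrite /limn_esup limf_esupE.
apply: (@le_trans _ _ (ereal_sup (u @` [set n | (u n <= l)%E]))).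
  by apply: ereal_inf_lbound; exists [set n | (u n <= l)%E].
by apply: ge_ereal_sup => _ [n /= unl <-].
Qed.

Lemma limn_einf_ge_near (u : nat -> \bar R) (l : \bar R) :
  (\forall n \near \oo, (l <= u n)%E) -> (l <= limn_einf u)%E.
Proof.
move=> ul; rewrite /limn_einf leeNr; apply: limn_esup_le_near.
by apply: filterS ul => n; rewrite leeN2.
Qed.

Lemma lne_le_expR (p : \bar R) (l c : R) : 0 < l -> (0 <= p)%E ->
  (p <= (expR (- (l * c)))%:E)%E -> (l^-1%:E * lne p <= (- c)%:E)%E.
Proof.
move=> l0 p0 pc; rewrite muleC lee_pdivrMr//.
rewrite (@le_trans _ _ (lne (expR (- (l * c)))%:E))//.
  by rewrite lee_lne// in_itv/= ?p0 ?leey// lee_fin expR_ge0.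
by rewrite lne_EFin ?expR_gt0// expRK -EFinM lee_fin; lra.
Qed.

Lemma expR_le_lne (p : \bar R) (l c : R) : 0 < l -> (0 <= p)%E ->
  ((expR (- (l * c)))%:E <= p)%E -> ((- c)%:E <= l^-1%:E * lne p)%E.
Proof.
move=> l0 p0 pc; rewrite muleC lee_pdivlMr//.
rewrite (@le_trans _ _ (lne (expR (- (l * c)))%:E))//; last first.
  by rewrite lee_lne// in_itv/= ?p0 ?leey// lee_fin expR_ge0.
by rewrite lne_EFin ?expR_gt0// expRK -EFinM lee_fin; lra.
Qed.

End limits.

Section measurable_comparison.
Context d (T : measurableType d) (R : realType) (h1 h2 : T -> R).
Hypothesis mh1 : measurable_fun setT h1.
Hypothesis mh2 : measurable_fun setT h2.

Lemma measurable_set_le : measurable [set z | h1 z <= h2 z].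
Proof. by rewrite -[X in measurable X]setTI; exact: measurable_fun_le. Qed.

Lemma measurable_set_lt : measurable [set z | h1 z < h2 z].
Proof.
rewrite -[X in measurable X]setTI.
by apply: (measurable_fun_ltr mh1 mh2 measurableT (Y := [set true])).
Qed.

Lemma measurable_indic_le : measurable_fun setT (fun z => (h1 z <= h2 z)%R%:R : R).
Proof.
rewrite (_ : (fun z => _) = \1_[set z | h1 z <= h2 z]).
  exact: measurable_indic measurable_set_le.
by apply/funext => z; rewrite indicE mem_setE.
Qed.

End measurable_comparison.

Section markov.
Context d (T : measurableType d) (R : realType) (P : probability T R).

Lemma markov_on (D A : set T) (f : T -> \bar R) (c : \bar R) :
  measurable D -> measurable A -> A `<=` D -> measurable_fun D f ->
  (forall w, D w -> (0 <= f w)%E) ->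
  (0 <= c)%E -> (forall w, A w -> (c <= f w)%E) ->
  (c * P A <= \int[P]_(w in D) f w)%E.
Proof.
move=> mD mA AD mf f0 c0 cf; rewrite -integral_cst//.
apply: (@le_trans _ _ (\int[P]_(w in A) f w)%E).
  apply: ge0_le_integral => //.
  exact: measurable_funS mf.
exact: ge0_subset_integral.
Qed.

Lemma prob_setU_le (A B : set T) : measurable A -> measurable B ->
  (P (A `|` B) <= P A + P B)%E.
Proof. by move=> mA mB; exact: measureU2. Qed.

End markov.

Lemma far_cases (R : realType) (x v e : R) : e <= `|v - x| ->
  e + 1 * x <= 1 * v \/ e + -1 * x <= -1 * v.
Proof. by rewrite ler_normr => /orP[h|h]; [left|right]; lra. Qed.

(** If [g] and [4 c] are both lower bounds of a mass, removing two tails of mass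
    at most [c] leaves at least half of [g]. *)
Lemma half_le_maxB (R : realType) (g c : R) :
  g / 2 <= Num.max g (4 * c) - (c + c).
Proof.
have : g <= Num.max g (4 * c) by rewrite le_max lexx.
have : 4 * c <= Num.max g (4 * c) by rewrite le_max lexx orbT.
lra.
Qed.

(** * Quadratic large deviations from moment generating functions *)

Section gartner_ellis.
Context d (T : measurableType d) (R : realType) (P : probability T R).
Variables (W V : nat -> T -> R) (lam : nat -> R) (s2 : R).
Hypothesis s2_gt0 : 0 < s2.
Hypothesis lam_gt0 : forall n, (0 < n)%N -> 0 < lam n.
Hypothesis lam_y : lam n @[n --> \oo] --> +oo.
Hypothesis mW : forall n, measurable_fun setT (W n).
Hypothesis mV : forall n, measurable_fun setT (V n).
Hypothesis mgfV : forall th e : R, 0 < e -> \forall n \near \oo,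
  ((expR (lam n * (s2 * th ^+ 2 / 2 - e)))%:E <=
     \int[P]_w (expR (th * (lam n * V n w)))%:E <=
   (expR (lam n * (s2 * th ^+ 2 / 2 + e)))%:E)%E.
Hypothesis WV : forall del L : R, 0 < del -> \forall n \near \oo,
  (P [set w | (del < `|W n w - V n w|)%R] <= (expR (- (lam n * L)))%:E)%E.

Let lam_near (c : R) : \forall n \near \oo, c <= lam n.
Proof. by move/cvgryPge : lam_y => /(_ c). Qed.

Let lam_near0 : \forall n \near \oo, 0 < lam n.
Proof. by near=> n; apply: lam_gt0; near: n; exists 1%N. Unshelve. all: by end_near. Qed.

Let near_absorb (e c : R) : 0 < e -> \forall n \near \oo,
  c <= expR (lam n * e).
Proof.
move=> e0; near=> n.
have h : c / e <= lam n by near: n; exact: lam_near.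
rewrite (le_trans _ (expR_ge1Dx _))//.
by rewrite ler_pdivrMr// in h; lra.
Unshelve. all: by end_near. Qed.

Let mexp th n : measurable_fun setT (fun w => (expR (th * (lam n * V n w)))%:E).
Proof.
apply/measurable_EFinP; apply: measurableT_comp => //.
by apply: measurable_funM => //; apply: measurable_funM.
Qed.

Let mVge (s x : R) n : measurable [set w | x <= s * V n w].
Proof. by apply: measurable_set_le => //; exact: measurable_funM. Qed.

Let mWge (x : R) n : measurable [set w | x <= `|W n w| ].
Proof. by apply: measurable_set_le => //; exact: measurableT_comp. Qed.

Let mWVgt (x : R) n : measurable [set w | x < `|W n w - V n w| ].
Proof.
by apply: measurable_set_lt => //; apply: measurableT_comp => //; exact: measurable_funB.
Qed.

Let mball (U : nat -> T -> R) (mU : forall n, measurable_fun setT (U n)) (x e : R) n :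
  measurable [set w | `|U n w - x| < e].
Proof.
by apply: measurable_set_lt => //; apply: measurableT_comp => //; exact: measurable_funB.
Qed.

(** Chernoff's bound at the tilt [x / s2], the optimal one for a Gaussian.
    Multiplying by [x] treats both signs of [x] at once. *)
Let upperV (x e : R) : 0 < e -> \forall n \near \oo,
  (P [set w | (x ^+ 2 <= x * V n w)%R]
    <= (expR (- (lam n * (x ^+ 2 / (2 * s2) - e))))%:E)%E.
Proof.
move=> e0; near=> n.
have l0 : 0 < lam n by near: n; exact: lam_near0.
have : (\int[P]_w (expR (x / s2 * (lam n * V n w)))%:E <=
    (expR (lam n * (s2 * (x / s2) ^+ 2 / 2 + e)))%:E)%E.
  by near: n; apply: filterS (mgfV (x / s2) e0) => n /andP[].
move=> h.
have := @markov_on _ T R P setT [set w | x ^+ 2 <= x * V n w]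
  (fun w => (expR (x / s2 * (lam n * V n w)))%:E)
  (expR (lam n * (x ^+ 2 / s2)))%:E measurableT (mVge _ _ _)
  (@subsetT _ _) (mexp _ _).
move=> /(_ _ _ _)/le_trans => /(_ _ _ _ _ h) k.
have {}k : ((expR (lam n * (x ^+ 2 / s2)))%:E * P [set w | (x ^+ 2 <= x * V n w)%R] <=
     (expR (lam n * (s2 * (x / s2) ^+ 2 / 2 + e)))%:E)%E.
  apply: k.
  - by move=> w _; rewrite lee_fin expR_ge0.
  - by rewrite lee_fin expR_ge0.
  - move=> w /= xV; rewrite lee_fin ler_expR.
    rewrite [leRHS](_ : _ = lam n * ((x * V n w) / s2)); last by ring.
    by rewrite ler_pM2l// ler_pM2r// invr_gt0.
move: k; rewrite -lee_pdivlMl ?expR_gt0//; move/le_trans; apply.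
rewrite -EFinM lee_fin -expRN -expRD ler_expR.
rewrite le_eqVlt; apply/orP; left; apply/eqP.
by field; rewrite gt_eqF.
Unshelve. all: by end_near. Qed.

(** [W n] is at distance at least [rho] from 0 only if [V n] is almost as far or the two
    differ by [del]; the latter is superexponentially rare, and the loss in the
    radius is absorbed by [e]. *)
Let upperW (rho e : R) : 0 <= rho -> 0 < e -> \forall n \near \oo,
  (P [set w | (rho <= `|W n w|)%R]
    <= (expR (- (lam n * (rho ^+ 2 / (2 * s2) - e))))%:E)%E.
Proof.
rewrite le_eqVlt => /orP[/eqP<- e0|rho0 e0].
  near=> n; rewrite (le_trans (probability_le1 P (mWge _ _)))//.
  have l0 : 0 < lam n by near: n; exact: lam_near0.
  rewrite lee_fin -expR0 ler_expR expr0n/= mul0r sub0r mulrN opprK.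
  by rewrite mulr_ge0 // ltW.
(* a radius loss of del costs rho del / s2 <= e / 2 in the exponent *)
pose del := Num.min rho (e * s2 / (2 * rho)).
have del0 : 0 < del.
  by rewrite lt_min rho0/= divr_gt0// mulr_gt0.
have delr : del <= rho by rewrite ge_min lexx.
have dele : rho * del / s2 <= e / 2.
  have : del <= e * s2 / (2 * rho) by rewrite ge_min lexx orbT.
  rewrite ler_pdivlMr ?mulr_gt0// => h.
  by rewrite ler_pdivrMr//; lra.
pose x := rho - del.
have x0 : 0 <= x by rewrite subr_ge0.
have xx : rho ^+ 2 / (2 * s2) - e / 2 <= x ^+ 2 / (2 * s2).
  rewrite (@le_trans _ _ ((rho ^+ 2 - 2 * rho * del) / (2 * s2)))//.
    rewrite mulrBl lerD2l lerN2.
    rewrite [leLHS](_ : _ = rho * del / s2)//.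
    by field; rewrite gt_eqF.
  rewrite ler_pM2r ?invr_gt0 ?mulr_gt0// /x.
  by rewrite sqrrB; nra.
have e40 : 0 < e / 4 by rewrite divr_gt0.
near=> n.
have l0 : 0 < lam n by near: n; exact: lam_near0.
set E0 := expR (- (lam n * (rho ^+ 2 / (2 * s2) - 3 / 4 * e))).
have h1 : (P [set w | (x ^+ 2 <= x * V n w)%R] <= E0%:E)%E.
  have : (P [set w | (x ^+ 2 <= x * V n w)%R]
    <= (expR (- (lam n * (x ^+ 2 / (2 * s2) - e / 4))))%:E)%E.
    by near: n; exact: upperV.
  move=> /le_trans; apply; rewrite lee_fin ler_expR lerN2 ler_pM2l//; lra.
have h2 : (P [set w | ((- x) ^+ 2 <= (- x) * V n w)%R] <= E0%:E)%E.
  have : (P [set w | ((- x) ^+ 2 <= (- x) * V n w)%R]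
    <= (expR (- (lam n * ((-x) ^+ 2 / (2 * s2) - e / 4))))%:E)%E.
    by near: n; exact: upperV.
  move=> /le_trans; apply; rewrite lee_fin ler_expR lerN2 ler_pM2l// sqrrN; lra.
have h3 : (P [set w | (del < `|W n w - V n w|)%R] <= E0%:E)%E.
  by rewrite /E0; near: n; exact: WV.
have sub : [set w | (rho <= `|W n w|)%R] `<=`
   [set w | (x ^+ 2 <= x * V n w)%R] `|` [set w | ((- x) ^+ 2 <= (- x) * V n w)%R]
   `|` [set w | (del < `|W n w - V n w|)%R].
  move=> w /= rW; have [?|nd] := ltP del `|W n w - V n w|; first by right.
  left; have xV : x <= `|V n w|.
    have := ler_normD (W n w - V n w) (V n w); rewrite subrK /x; lra.
  have [v0|v0] := leP 0 (V n w).
    by left; rewrite expr2; apply: ler_wpM2l => //; rewrite ger0_norm in xV.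
  by right; rewrite sqrrN mulNr -mulrN expr2; apply: ler_wpM2l => //;
     rewrite ltr0_norm in xV.
apply: (le_trans (le_measure P _ _ sub)).
- by rewrite inE.
- by rewrite inE; apply: measurableU => //; apply: measurableU.
apply: (@le_trans _ _ (E0%:E + E0%:E + E0%:E)%E).
  apply: (le_trans (prob_setU_le P _ _)) => //; first exact: measurableU.
  apply: leeD => //.
  apply: (le_trans (prob_setU_le P _ _)) => //.
  exact: leeD.
rewrite -!EFinD lee_fin.
have h4 : 3 <= expR (lam n * (e / 4)) by near: n; exact: near_absorb.
rewrite [leRHS](_ : _ = E0 * expR (lam n * (e / 4))); last first.
  by rewrite /E0 -expRD; congr expR; field; rewrite gt_eqF.
have E00 : 0 < E0 by exact: expR_gt0.
by nra.
Unshelve. all: by end_near. Qed.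

(** After the tilt by [x / s2] the variable [V n] concentrates near [x]: one more
    tilt by [ep / s2], in the direction given by the sign [sg], bounds the tilted
    mass of a tail. *)
Let tilt_tail (x ep sg : R) : 0 < ep -> sg ^+ 2 = 1 ->
  \forall n \near \oo,
  (\int[P]_(w in [set w | (ep + sg * x <= sg * V n w)%R])
      (expR (x / s2 * (lam n * V n w)))%:E
   <= (expR (lam n * (x ^+ 2 / (2 * s2) - 3 / 8 * (ep ^+ 2 / s2))))%:E)%E.
Proof.
move=> ep0 sg1.
pose th' := x / s2 + sg * (ep / s2).
have e0 : 0 < ep ^+ 2 / (8 * s2) by rewrite divr_gt0 ?mulr_gt0 ?exprn_gt0.
near=> n.
have l0 : 0 < lam n by near: n; exact: lam_near0.
set D := [set w | _].
have h : (\int[P]_w (expR (th' * (lam n * V n w)))%:E <=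
    (expR (lam n * (s2 * th' ^+ 2 / 2 + ep ^+ 2 / (8 * s2))))%:E)%E.
  by near: n; apply: filterS (mgfV th' e0) => n /andP[].
have mD : measurable D by exact: mVge.
apply: (@le_trans _ _ (\int[P]_(w in D)
   ((expR (- (lam n * (ep / s2 * (ep + sg * x)))))%:E *
    (expR (th' * (lam n * V n w)))%:E))%E).
  apply: ge0_le_integral => //.
  - by apply: measurable_funTS; exact: mexp.
  - by apply: measurable_funTS; apply: measurable_funeM; exact: mexp.
  - move=> w /= Dw; rewrite -EFinM lee_fin -expRD ler_expR /th'.
    have : lam n * (ep / s2) * (ep + sg * x) <= lam n * (ep / s2) * (sg * V n w).
      by apply: ler_wpM2l => //; rewrite mulr_ge0 ?divr_ge0 ?ltW.
    by rewrite mulrDl => k; lra.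
rewrite ge0_integralZl//; last by apply: measurable_funTS; exact: mexp.
apply: (@le_trans _ _ ((expR (- (lam n * (ep / s2 * (ep + sg * x)))))%:E *
    (expR (lam n * (s2 * th' ^+ 2 / 2 + ep ^+ 2 / (8 * s2))))%:E)%E).
  apply: lee_wpmul2l; first by rewrite lee_fin expR_ge0.
  by apply: le_trans h; apply: ge0_subset_integral => //; exact: mexp.
rewrite -EFinM lee_fin -expRD ler_expR.
rewrite le_eqVlt; apply/orP; left; apply/eqP.
rewrite /th' sqrrD !exprMn sg1.
by field; rewrite gt_eqF.
Unshelve. all: by end_near. Qed.

(** Cramer's change of measure.  The tilted mass of the ball is the total mass
    minus that of two tails, hence at least half of the total; on the ball the
    tilt is nearly the constant [exp (lam n * th * x)], which converts tilted
    mass into probability. *)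
Let lowerV (x ep e : R) : 0 < ep -> 0 < e -> \forall n \near \oo,
  ((expR (- (lam n * (x ^+ 2 / (2 * s2) + e))))%:E <=
   P [set w | (`|V n w - x| < ep)%R])%E.
Proof.
move=> ep0 e0.
(* on the ball of radius ep' the exponent of the tilt varies by at most lam n * e / 4 *)
pose ep' := Num.min ep (e / (4 * (`|x| / s2 + 1))).
have xs0 : 0 < `|x| / s2 + 1 by rewrite ltr_wpDl// divr_ge0// ltW.
have ep'0 : 0 < ep' by rewrite lt_min ep0 divr_gt0// mulr_gt0.
have epe : ep' <= ep by rewrite ge_min lexx.
have epx : `|x| / s2 * ep' <= e / 4.
  have : ep' <= e / (4 * (`|x| / s2 + 1)) by rewrite ge_min lexx orbT.
  rewrite ler_pdivlMr ?mulr_gt0//; nra.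
pose th := x / s2.
pose q := x ^+ 2 / (2 * s2).
pose r := ep' ^+ 2 / s2.
have r0 : 0 < r by rewrite divr_gt0 ?exprn_gt0.
have qth : s2 * th ^+ 2 / 2 = q by rewrite /q /th; field; rewrite gt_eqF.
have r80 : 0 < r / 8 by rewrite divr_gt0.
have r40 : 0 < r / 4 by rewrite divr_gt0.
have e40 : 0 < e / 4 by rewrite divr_gt0.
have e20 : 0 < e / 2 by rewrite divr_gt0.
have sg1 : (1 : R) ^+ 2 = 1 by rewrite expr1n.
have sgN1 : (- 1 : R) ^+ 2 = 1 by rewrite sqrrN expr1n.
near=> n.
have l0 : 0 < lam n by near: n; exact: lam_near0.
pose f w := (expR (th * (lam n * V n w)))%:E.
have f0 w : (0 <= f w)%E by rewrite lee_fin expR_ge0.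
have mf : measurable_fun setT f by exact: mexp.
pose A := [set w | `|V n w - x| < ep'].
have mA : measurable A by exact: mball.
pose A1 := [set w | (ep' + 1 * x <= 1 * V n w)%R].
pose A2 := [set w | (ep' + (-1) * x <= (-1) * V n w)%R].
have mA1 : measurable A1 by exact: mVge.
have mA2 : measurable A2 by exact: mVge.
pose c := expR (lam n * (q - 3 / 8 * r)).
pose g := expR (lam n * (q - e / 4)).
have t1 : (\int[P]_(w in A1) f w <= c%:E)%E.
  rewrite /A1 /f /c; near: n; exact: (tilt_tail _ ep'0 sg1).
have t2 : (\int[P]_(w in A2) f w <= c%:E)%E.
  rewrite /A2 /f /c; near: n; exact: (tilt_tail _ ep'0 sgN1).
have M1 : ((expR (lam n * (q - r / 8)))%:E <= \int[P]_w f w)%E.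
  rewrite -qth /f; near: n.
  by apply: filterS (mgfV th r80) => n /andP[].
have M2 : (g%:E <= \int[P]_w f w)%E.
  rewrite /g -qth /f; near: n.
  by apply: filterS (mgfV th e40) => n /andP[].
have k4 : 4 <= expR (lam n * (r / 4)) by near: n; exact: near_absorb.
have k2 : 2 <= expR (lam n * (e / 2)) by near: n; exact: near_absorb.
have M1' : ((4 * c)%:E <= \int[P]_w f w)%E.
  apply: le_trans M1; rewrite lee_fin.
  have -> : expR (lam n * (q - r / 8)) = expR (lam n * (r / 4)) * c.
    by rewrite /c -expRD; congr expR; field.
  by rewrite ler_wpM2r// expR_ge0.
have gS (B C : set T) : measurable B -> measurable C ->
     (\int[P]_(w in B `|` C) f w <= \int[P]_(w in B) f w + \int[P]_(w in C) f w)%E.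
  move=> mB mC; have -> : B `|` C = B `|` (C `\` B).
    apply/seteqP; split => w /=; last by case=> [|[]]; [left|right].
    by case=> [Bw|Cw]; [left|have [Bw|nBw] := pselect (B w); [left|right]].
  rewrite ge0_integral_setU//; last 3 first.
  - exact: measurableD.
  - exact: measurable_funTS.
  - by apply/disj_setPS => w /= [Bw [Cw]].
  rewrite leeD2l// ge0_subset_integral//; first exact: measurableD.
  exact: measurable_funTS.
have split : (\int[P]_w f w <=
   \int[P]_(w in A) f w + (c%:E + c%:E))%E.
  have -> : [set: T] = A `|` (A1 `|` A2).
    apply/seteqP; split => // w _; rewrite /A /A1 /A2 /=.
    have [?|] := ltP `|V n w - x| ep'; first by left.
    by move=> /far_cases h; right.
  apply: (le_trans (gS _ _ _ _)) => //; first exact: measurableU.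
  rewrite leeD2l//; apply: (le_trans (gS _ _ _ _)) => //.
  exact: leeD.
have half : ((g / 2)%:E <= \int[P]_(w in A) f w)%E.
  have : ((Num.max g (4 * c))%:E <= \int[P]_(w in A) f w + (c%:E + c%:E))%E.
    by apply: le_trans split; have [] := leP g (4 * c).
  rewrite -EFinD -leeBlDr// => /(le_trans _); apply.
  rewrite -EFinB lee_fin.
  exact: half_le_maxB.
have up : (\int[P]_(w in A) f w <= (expR (lam n * (th * x + e / 4)))%:E * P A)%E.
  rewrite -(@integral_cst _ _ _ P _ mA); apply: ge0_le_integral.
  - exact: mA.
  - by move=> w _; exact: f0.
  - exact: measurable_funTS.
  - exact: measurable_cst.
  move=> w Aw; rewrite lee_fin ler_expR mulrCA ler_pM2l//.
  rewrite -lerBlDl -mulrBr (le_trans (ler_norm _))// normrM.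
  rewrite (le_trans _ epx)// /th normrM normfV (gtr0_norm s2_gt0).
  by rewrite ler_wpM2l ?(ltW Aw)// divr_ge0// ltW.
have := le_trans half up; rewrite -lee_pdivrMl ?expR_gt0// => pA.
apply: (@le_trans _ _ (P A)); last first.
  apply: le_measure; rewrite ?inE//; first exact: mball.
  by move=> w /= /lt_le_trans; apply.
apply: le_trans pA; rewrite -EFinM lee_fin -expRN.
have -> : g / 2 = expR (lam n * (q - 3 / 4 * e)) * (expR (lam n * (e / 2)) / 2).
  by rewrite mulrA -expRD /g; congr (expR _ / _); field.
have -> : - (lam n * (x ^+ 2 / (2 * s2) + e)) =
  - (lam n * (th * x + e / 4)) + lam n * (q - 3 / 4 * e).
  by rewrite /q /th; field; rewrite gt_eqF.
rewrite expRD ler_pM2l ?expR_gt0// ler_peMr ?expR_ge0//.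
by rewrite ler_pdivlMr// mul1r.
Unshelve. all: by end_near. Qed.

(** Up to a superexponentially small event, a ball around [x] for [V n] lies in
    the ball of twice the radius for [W n]. *)
Let lowerW (x ep e : R) : 0 < ep -> 0 < e -> \forall n \near \oo,
  ((expR (- (lam n * (x ^+ 2 / (2 * s2) + e))))%:E <=
   P [set w | (`|W n w - x| < ep)%R])%E.
Proof.
move=> ep0 e0.
have ep20 : 0 < ep / 2 by rewrite divr_gt0.
have e20 : 0 < e / 2 by rewrite divr_gt0.
near=> n.
have l0 : 0 < lam n by near: n; exact: lam_near0.
pose p := expR (- (lam n * (x ^+ 2 / (2 * s2) + e))).
have h1 : ((expR (- (lam n * (x ^+ 2 / (2 * s2) + e / 2))))%:E <=
   P [set w | (`|V n w - x| < ep / 2)%R])%E.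
  by near: n; exact: lowerV.
have h2 : (P [set w | (ep / 2 < `|W n w - V n w|)%R] <= p%:E)%E.
  by rewrite /p; near: n; exact: WV.
have k2 : 2 <= expR (lam n * (e / 2)) by near: n; exact: near_absorb.
have h3 : ((2 * p)%:E <= P [set w | (`|V n w - x| < ep / 2)%R])%E.
  apply: le_trans h1; rewrite lee_fin.
  have -> : expR (- (lam n * (x ^+ 2 / (2 * s2) + e / 2))) =
    expR (lam n * (e / 2)) * p by rewrite /p -expRD; congr expR; field; rewrite gt_eqF.
  by rewrite ler_wpM2r// expR_ge0.
have h4 : (P [set w | (`|V n w - x| < ep / 2)%R] <=
   P [set w | (`|W n w - x| < ep)%R] + P [set w | (ep / 2 < `|W n w - V n w|)%R])%E.
  apply: le_trans (prob_setU_le P _ _) => //; last exact: mball.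
  apply: le_measure; rewrite ?inE//; [exact: mball| |].
    by apply: measurableU => //; exact: mball.
  move=> w /= Vw; have [?|nd] := ltP (ep / 2) `|W n w - V n w|; first by right.
  by left; have := ler_normD (W n w - V n w) (V n w - x); rewrite addrA subrK; lra.
have : ((2 * p)%:E <= P [set w | (`|W n w - x| < ep)%R] + p%:E)%E.
  by apply: (le_trans h3); apply: (le_trans h4); rewrite leeD2l.
by rewrite -leeBlDr// -EFinB (_ : 2 * p - p = p)//; ring.
Unshelve. all: by end_near. Qed.

Lemma rate_function_quadratic :
  rate_function (fun x : R => (x ^+ 2 / (2 * s2))%:E).
Proof.
split => [x|L]; first by rewrite lee_fin divr_ge0 ?sqr_ge0// mulr_ge0// ltW.
apply: (subclosed_compact _
  (@segment_compact R (- (2 * s2 * L + 1)) (2 * s2 * L + 1))); last first.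
  move=> x /=; rewrite lee_fin ler_pdivrMr ?mulr_gt0// => xL.
  rewrite in_itv/= -ler_norml leNgt; apply/negP => Mx.
  have xx : x ^+ 2 = `|x| ^+ 2 by rewrite real_normK ?num_real.
  have sq0 := sqr_ge0 (`|x| - 1).
  have : 0 <= 2 * s2 * L by rewrite mulrC (le_trans _ xL)// sqr_ge0.
  by rewrite xx in xL; nra.
have -> : [set x : R | ((x ^+ 2 / (2 * s2))%:E <= L%:E)%E] =
   (fun x => x ^+ 2 / (2 * s2)) @^-1` [set y | y <= L].
  by apply/seteqP; split => x /=; rewrite lee_fin.
apply: closed_comp; last exact: closed_le.
move=> x _; apply: cvgM; last exact: cvg_cst.
exact: exprn_continuous.
Qed.

(** The Gartner-Ellis theorem for a Gaussian limit on the line, for any [W] that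
    is exponentially equivalent to the [V] whose generating functions are known.
    Since the rate depends only on the distance to 0, the upper bound for a
    closed set follows from the bound for the complement of a ball. *)
Lemma LDP_quadratic_of_mgf :
  LDP P W lam (fun x : R => (x ^+ 2 / (2 * s2))%:E).
Proof.
split.
- by [].
- exact: rate_function_quadratic.
- move=> U oU; rewrite leeNl; apply: le_ereal_inf_tmp => _ [x Ux <-].
  rewrite leeNl.
  have [ep /= ep0 epU] : nbhs_ball (x : R) U.
    by apply/nbhs_ballP; exact: open_nbhs_nbhs.
  apply/lee_addgt0Pr => e e0.
  rewrite -leeBlDr//; apply: limn_einf_ge_near.
  near=> n.
  have l0 : 0 < lam n by near: n; exact: lam_near0.
  rewrite -EFinN -EFinB -opprD; apply: expR_le_lne => //.
  apply: (@le_trans _ _ (P [set w | (`|W n w - x| < ep)%R])).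
    by near: n; exact: lowerW.
  apply: le_measure; rewrite ?inE; first exact: mball.
    rewrite -[X in measurable X]setTI; apply: mW => //; exact: open_measurable.
  by move=> w /= wx; apply: epU; rewrite /ball/= distrC.
- move=> K cK.
  have mK n : measurable (W n @^-1` K).
    by rewrite -[X in measurable X]setTI; apply: mW => //; exact: closed_measurable.
  have [K0|/set0P[k Kk]] := eqVneq K set0.
    rewrite K0 image_set0 ereal_inf0 /=; apply: limn_esup_le_near.
    near=> n.
    have l0 : 0 < lam n by near: n; exact: lam_near0.
    by rewrite preimage_set0 measure0 le0_lneNy// gt0_muleNy// lte_fin invr_gt0.
  set S := [set _ | x in K].
  have S0 : (0 <= ereal_inf S)%E.
    apply: le_ereal_inf_tmp => _ [x _ <-].
    by rewrite lee_fin divr_ge0 ?sqr_ge0// mulr_ge0// ltW.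
  have Sk : (ereal_inf S <= (k ^+ 2 / (2 * s2))%:E)%E.
    by apply: ereal_inf_lbound; exists k.
  have Sfin : ereal_inf S \is a fin_num.
    by rewrite ge0_fin_numE// (le_lt_trans Sk)// ltry.
  have Se := fineK Sfin; set r := fine (ereal_inf S) in Se.
  rewrite -Se in S0 *; rewrite lee_fin in S0.
  apply/lee_addgt0Pr => e e0; apply: limn_esup_le_near.
  (* the distance from K to 0, when r is the infimum of the rate over K *)
  pose rho := Num.sqrt (2 * s2 * r).
  have rho0 : 0 <= rho by rewrite sqrtr_ge0.
  have rr : rho ^+ 2 / (2 * s2) = r.
    rewrite sqr_sqrtr; first by field; rewrite gt_eqF.
    by rewrite mulr_ge0// mulr_ge0// ltW.
  near=> n.
  have l0 : 0 < lam n by near: n; exact: lam_near0.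
  rewrite -EFinN -EFinD (_ : - r + e = - (rho ^+ 2 / (2 * s2) - e)); last by rewrite rr; ring.
  apply: lne_le_expR => //.
  apply: (@le_trans _ _ (P [set w | (rho <= `|W n w|)%R])); last first.
    by near: n; exact: upperW.
  apply: le_measure; rewrite ?inE// => w /= Kw.
  have : (r%:E <= ((W n w) ^+ 2 / (2 * s2))%:E)%E.
    by rewrite Se; apply: ereal_inf_lbound; exists (W n w).
  rewrite lee_fin -rr ler_pM2r ?invr_gt0 ?mulr_gt0// => h.
  by rewrite -(ler_pXn2r (n := 2))// ?nnegrE// real_normK ?num_real.
Unshelve. all: by end_near. Qed.

End gartner_ellis.

(** * Moment generating function of a normalized sum *)

Section bounded_integrals.
Context d (T : measurableType d) (R : realType) (mu : {measure set T -> \bar R}).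

Lemma integrable_le_cst (D : set T) (f : T -> R) (M : R) :
  measurable D -> (mu D < +oo)%E -> measurable_fun D f ->
  (forall x, D x -> `|f x| <= M) -> mu.-integrable D (EFin \o f).
Proof.
move=> mD Doo mf fM; apply: measurable_bounded_integrable => //.
exists M; split; first exact: num_real.
by move=> K MK x Dx /=; rewrite (le_trans (fM x Dx))// ltW.
Qed.

Lemma EFin_Rintegral (D : set T) (f : T -> R) :
  measurable D -> mu.-integrable D (EFin \o f) ->
  ((\int[mu]_(x in D) f x)%R%:E = \int[mu]_(x in D) (f x)%:E)%E.
Proof. by move=> mD fi; rewrite /Rintegral fineK// integrable_fin_num. Qed.

End bounded_integrals.

Section taylor.
Context {R : realType}.

(** The tail of the exponential series at [y] is at most [|y|^3] times the
    series at 1. *)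
Lemma expR_taylor2 (y : R) : `|y| <= 1 ->
  `|expR y - (1 + y + y ^+ 2 / 2)| <= expR 1 * `|y| ^+ 3.
Proof.
move=> y1.
have ser N : (3 <= N)%N ->
    `|series (exp_coeff y) N - (1 + y + y ^+ 2 / 2)| <= expR 1 * `|y| ^+ 3.
  move=> N3; rewrite /series/= (@big_cat_nat _ _ _ 3)//=.
  have -> : \sum_(0 <= i < 3) exp_coeff y i = 1 + y + y ^+ 2 / 2.
    by rewrite big_ltn// big_ltn// big_nat1 /exp_coeff/= expr0 expr1 !divr1 addrA.
  rewrite [X in `|X|]addrC addKr.
  apply: (le_trans (ler_norm_sum _ _ _)).
  apply: (@le_trans _ _ (\sum_(3 <= k < N) `|y| ^+ 3 * exp_coeff 1 k)).
    rewrite !big_nat; apply: ler_sum => k /andP[k3 _].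
    rewrite /exp_coeff/= expr1n normrM normrX normfV mul1r.
    rewrite (ger0_norm (ler0n _ _)) ler_wpM2r ?invr_ge0//.
    by rewrite -(subnKC k3) exprD ler_piMr ?exprn_ge0// exprn_ile1.
  rewrite -big_distrr/= mulrC ler_wpM2r ?exprn_ge0//.
  apply: (@le_trans _ _ (series (exp_coeff 1) N)).
    rewrite /series/= [leRHS](@big_cat_nat _ _ _ 3)//= lerDr sumr_ge0// => k _.
    exact: exp_coeff_ge0.
  apply: nondecreasing_cvgn_le; last exact: is_cvg_series_exp_coeff.
  by apply: nondecreasing_series => k _ _; exact: exp_coeff_ge0.
have cy := @is_cvg_series_exp_coeff R y.
rewrite ler_distl; apply/andP; split.
  rewrite {2}/expR; apply: limr_ge => //; near=> N.
  have /ser : (3 <= N)%N by near: N; exists 3%N.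
  by rewrite ler_distl => /andP[].
rewrite {1}/expR; apply: limr_le => //; near=> N.
have /ser : (3 <= N)%N by near: N; exists 3%N.
by rewrite ler_distl => /andP[].
Unshelve. all: by end_near. Qed.

End taylor.

Section product_expectation.
Context d (T : measurableType d) (R : realType) (P : probability T R).

Import HBNNSimple.

(** A product formula for indicators of [Y] extends to nonnegative functions of
    [Y] along approximations by simple functions; [h] stands for the factors
    that are independent of [Y]. *)
Lemma integral_indic_comp_ext (h : T -> R) (Y : T -> R) (c : R) :
  measurable_fun setT h -> (forall w, 0 <= h w) ->
  measurable_fun setT Y -> 0 <= c ->
  (forall A : set R, measurable A ->
    (\int[P]_w (h w * \1_A (Y w))%:E = c%:E * P (Y @^-1` A))%E) ->
  forall f : R -> R, measurable_fun setT f -> (forall y, 0 <= f y) ->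
  (\int[P]_w (h w * f (Y w))%:E = c%:E * \int[P]_w (f (Y w))%:E)%E.
Proof.
move=> mh h0 mY c0 H f mf f0.
have mfE : measurable_fun setT (EFin \o f) by exact/measurable_EFinP.
pose g := nnsfun_approx measurableT mfE.
have gf w : (g n (Y w))%:E @[n --> \oo] --> (f (Y w))%:E.
  by apply: (cvg_nnsfun_approx measurableT mfE) => // y _; rewrite lee_fin.
have gnd w : {homo (fun n => g n (Y w)) : m n / (m <= n)%N >-> m <= n}.
  by move=> m n mn; exact/lefP/nd_nnsfun_approx.
have mgY n : measurable_fun setT (fun w => g n (Y w)) by exact: measurableT_comp.
have mgk n k : measurable (Y @^-1` (g n @^-1` [set k])).
  by rewrite -[X in measurable X]setTI; apply: mY.
have expand (h' : T -> R) n : measurable_fun setT h' -> (forall w, 0 <= h' w) ->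
    (forall A : set R, measurable A ->
      (\int[P]_w (h' w * \1_A (Y w))%:E = c%:E * P (Y @^-1` A))%E) ->
    (\int[P]_w (h' w * g n (Y w))%:E =
     \sum_(k \in range (g n)) (k%:E * (c%:E * P (Y @^-1` (g n @^-1` [set k])))))%E.
  move=> mh' h'0 H'.
  transitivity (\int[P]_w (\sum_(k \in range (g n))
      (k%:E * (h' w * \1_(g n @^-1` [set k]) (Y w))%:E)))%E.
    apply: eq_integral => w _; rewrite fimfunE.
    rewrite fsbig_finite//= fsbig_finite//= big_distrr/= -sumEFin.
    by apply: eq_bigr => k _; rewrite -EFinM mulrCA.
  have m1 k : measurable_fun setT (fun w => h' w * \1_(g n @^-1` [set k]) (Y w)).
    apply: measurable_funM => //.
    by apply: (measurableT_comp (measurable_indic _)).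
  rewrite ge0_integral_fsum//; last 2 first.
  - by move=> k; apply: measurable_funeM; apply/measurable_EFinP.
  - move=> k w _; rewrite -EFinM mulrCA lee_fin mulr_ge0//.
    by rewrite -lee_fin EFinM; exact: nnfun_muleindic_ge0.
  apply: eq_fsbigr => k kr.
  have k0 : 0 <= k by move: kr; rewrite inE/= => -[y _ <-].
  rewrite ge0_integralZl//.
  - by rewrite H'.
  - by apply/measurable_EFinP.
  - by move=> w _; rewrite lee_fin mulr_ge0.
have step n : (\int[P]_w (h w * g n (Y w))%:E =
    c%:E * \int[P]_w (g n (Y w))%:E)%E.
  rewrite (expand h)// -ge0_integralZl//; last 2 first.
  - by apply/measurable_EFinP.
  - by move=> w _; rewrite lee_fin.
  rewrite -(expand (cst c))// => A mA.
  have mYA : measurable (Y @^-1` A) by rewrite -[X in measurable X]setTI; apply: mY.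
  transitivity (\int[P]_w (c%:E * (\1_(Y @^-1` A) w)%:E))%E; first by [].
  rewrite ge0_integralZl//; last by apply/measurable_EFinP; exact: measurable_indic.
  by rewrite integral_indic// setIT.
have L : (\int[P]_w (h w * g n (Y w))%:E @[n --> \oo] --> \int[P]_w (h w * f (Y w))%:E)%E.
  rewrite [X in _ --> X](_ : _ = \int[P]_w limn (fun n => (h w * g n (Y w))%:E))%E.
    apply: cvg_monotone_convergence => //.
    - by move=> n; apply/measurable_EFinP; apply: measurable_funM.
    - by move=> n w _; rewrite lee_fin mulr_ge0.
    - by move=> w _ m n mn; rewrite lee_fin ler_wpM2l// gnd.
  apply: eq_integral => w _; apply/esym/cvg_lim => //.
  under eq_fun do rewrite EFinM.
  by rewrite EFinM; apply: cvgeZl.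
have L2 : (\int[P]_w (g n (Y w))%:E @[n --> \oo] --> \int[P]_w (f (Y w))%:E)%E.
  rewrite [X in _ --> X](_ : _ = \int[P]_w limn (fun n => (g n (Y w))%:E))%E.
    apply: cvg_monotone_convergence => //.
    - by move=> n; apply/measurable_EFinP.
    - by move=> n w _; rewrite lee_fin.
    - by move=> w _ m n mn; rewrite lee_fin gnd.
  by apply: eq_integral => w _; apply/esym/cvg_lim.
have L3 : (c%:E * \int[P]_w (g n (Y w))%:E @[n --> \oo] -->
    c%:E * \int[P]_w (f (Y w))%:E)%E by apply: cvgeZl.
rewrite -(cvg_lim _ L)// -(cvg_lim _ L3)//; congr (limn _).
by apply/funext => n; exact: step.
Qed.

Variable Xs : nat -> {RV P >-> R}.
Hypothesis indep : mutually_independent Xs.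
Variable f : nat -> R -> R.
Hypothesis mf : forall i, measurable_fun setT (f i).
Hypothesis f0 : forall i y, 0 <= f i y.
Hypothesis fi : forall i, P.-integrable setT (fun w => (f i (Xs i w))%:E).

(** Independence is a statement on events.  The functions [f i] replace the
    indicators one at a time, so the induction carries a product of [k]
    functions times the indicator of an intersection over larger indices. *)
Lemma expectation_prod (n : nat) :
  (\int[P]_w (\prod_(i < n) f i (Xs i w))%:E =
   \prod_(i < n) \int[P]_w (f i (Xs i w))%:E)%E.
Proof.
pose e i := (\int[P]_w f i (Xs i w))%R.
have eE i : (\int[P]_w (f i (Xs i w))%:E = (e i)%:E)%E by rewrite /e (EFin_Rintegral _ (fi i)).
have e0 i : 0 <= e i by apply: Rintegral_ge0.
have key : forall k (s : seq nat) (A : nat -> set R), uniq s ->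
    all (leq k) s -> (forall i, measurable (A i)) ->
   (\int[P]_w (\prod_(i < k) f i (Xs i w) * \1_(\bigcap_(i in [set` s]) (Xs i @^-1` A i)) w)%:E
    = (\prod_(i < k) e i)%:E * \prod_(i <- s) P (Xs i @^-1` A i))%E.
  elim=> [s A us _ mA|k IH s A us /allP sk mA].
    rewrite big_ord0 mul1e -indep//.
    transitivity (\int[P]_w (\1_(\bigcap_(i in [set` s]) (Xs i @^-1` A i)) w)%:E)%E.
      by apply: eq_integral => w _; rewrite big_ord0 mul1r.
    rewrite integral_indic// ?setIT//.
    apply: fin_bigcap_measurable => // i _.
    by rewrite -[X in measurable X]setTI; exact: measurable_funPT.
  have ks : k \notin s by apply/negP => /sk; rewrite ltnn.
  set B := \bigcap_(i in _) _.
  have mB : measurable B.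
    apply: fin_bigcap_measurable => // i _.
    by rewrite -[X in measurable X]setTI; exact: measurable_funPT.
  pose h w := \prod_(i < k) f i (Xs i w) * \1_B w.
  have mp : measurable_fun setT (fun w => \prod_(i < k) f i (Xs i w)).
    apply: measurable_prod => i _; exact: measurableT_comp.
  have mh : measurable_fun setT h by apply: measurable_funM.
  have h0 w : 0 <= h w by rewrite mulr_ge0// prodr_ge0.
  pose pr := fine (\prod_(i <- s) P (Xs i @^-1` A i))%E.
  have prE : (\prod_(i <- s) P (Xs i @^-1` A i) = pr%:E)%E.
    rewrite /pr fineK// prode_fin_num// => i _; apply: fin_num_measure.
    by rewrite -[X in measurable X]setTI; exact: measurable_funPT.
  have pr0 : 0 <= pr by rewrite fine_ge0// prode_ge0.
  transitivity (\int[P]_w (h w * f k (Xs k w))%:E)%E.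
    by apply: eq_integral => w _; rewrite big_ord_recr/= /h mulrAC.
  rewrite (@integral_indic_comp_ext h (Xs k) ((\prod_(i < k) e i) * pr))//.
  - by rewrite eE big_ord_recr/= prE -!EFinM mulrAC.
  - by rewrite mulr_ge0// prodr_ge0.
  move=> C mC.
  pose A' i := if i == k then C else A i.
  have := IH (k :: s) A' _ _ _.
  rewrite big_cons {3}/A' eqxx => IH'.
  transitivity (\int[P]_w (\prod_(i < k) f i (Xs i w) *
     \1_(\bigcap_(i in [set` k :: s]) (Xs i @^-1` A' i)) w)%:E)%E.
    apply: eq_integral => w _; rewrite /h -mulrA; congr (_ * _)%:E.
    rewrite -[\1_C (Xs k w)]/(\1_(Xs k @^-1` C) w) -[LHS]/((\1_B \* \1_(Xs k @^-1` C)) w).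
    rewrite -indicI; congr (\1__ w).
    apply/seteqP; split => [v [Bv Cv] i /=|v bv].
      rewrite inE => /orP[/eqP->|si]; rewrite /A'; first by rewrite eqxx.
      by case: eqP => [ik|_]; [move: ks; rewrite -ik si|exact: Bv].
    split; last by have := bv k; rewrite /= inE eqxx /A' eqxx; apply.
    move=> i /= si; have := bv i; rewrite /= inE si orbT /A'.
    by case: eqP => [ik|_]; [move: ks; rewrite -ik si|apply].
  rewrite IH'//=.
  - rewrite EFinM -muleA; congr (_ * _)%E.
    rewrite muleC -prE; congr (_ * _)%E.
    rewrite big_seq [RHS]big_seq; apply: eq_bigr => i si; rewrite /A'.
    by case: eqP => [ik|//]; move: ks; rewrite -ik si.
  - by rewrite ks.
  - by rewrite leqnn/=; apply/allP => i /sk /ltnW.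
  - by move=> i; rewrite /A'; case: ifP.
have := key n [::] (fun=> setT) isT isT (fun=> measurableT).
rewrite big_nil mule1 set_nil bigcap_set0 => k.
under [RHS]eq_bigr do rewrite eE.
rewrite prodEFin -k; apply: eq_integral => w _.
by rewrite indicE in_setT mulr1.
Qed.

End product_expectation.

Section mgf.
Context d (T : measurableType d) (R : realType) (P : probability T R).

Lemma prob_integrable_le (f : T -> R) (M : R) : measurable_fun setT f ->
  (forall w, `|f w| <= M) -> P.-integrable setT (EFin \o f).
Proof.
move=> mf fM; apply: (@integrable_le_cst _ _ _ _ _ _ M) => //.
exact: (le_lt_trans (probability_le1 P measurableT) (ltry 1)).
Qed.

Variables (Y : T -> R) (M s2 : R).
Hypothesis mY : measurable_fun setT Y.
Hypothesis YM : forall w, `|Y w| <= M.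
Hypothesis s2_gt0 : 0 < s2.
Hypothesis EY : \int[P]_w Y w = 0.
Hypothesis EY2 : \int[P]_w (Y w ^+ 2) = s2.

Lemma Rintegral_quadratic (k t : R) :
  \int[P]_w (k + (t * Y w + t ^+ 2 / 2 * Y w ^+ 2)) = k + t ^+ 2 / 2 * s2.
Proof.
have M0 : 0 <= M by rewrite (le_trans (normr_ge0 (Y point))).
have iY : P.-integrable setT (EFin \o Y) by exact: (prob_integrable_le _ YM).
have mY2 : measurable_fun setT (fun w => Y w ^+ 2) by exact: measurable_funX.
have iY2 : P.-integrable setT (EFin \o (fun w => Y w ^+ 2)).
  apply: (@prob_integrable_le _ (M ^+ 2)) => // w.
  by rewrite normrX ler_pXn2r// nnegrE.
have itY : P.-integrable setT (EFin \o (fun w => t * Y w)).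
  by exact: (integrableZl measurableT t iY).
have itY2 : P.-integrable setT (EFin \o (fun w => t ^+ 2 / 2 * Y w ^+ 2)).
  by exact: (integrableZl measurableT (t ^+ 2 / 2) iY2).
have ik : P.-integrable setT (EFin \o (fun _ : T => k)).
  exact: (@prob_integrable_le _ `|k|).
have iS : P.-integrable setT (EFin \o (fun w => t * Y w + t ^+ 2 / 2 * Y w ^+ 2)).
  by exact: (integrableD measurableT itY itY2).
have PT : (P : {measure set T -> \bar R}) setT = 1%E by exact: probability_setT.
have -> : k + t ^+ 2 / 2 * s2 = \int[P]_(w in setT) k + t ^+ 2 / 2 * s2.
  by rewrite Rintegral_cst// PT mulr1.
rewrite RintegralD//; congr (_ + _).
by rewrite RintegralD// RintegralZl// RintegralZl// EY EY2 mulr0 add0r.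
Qed.

(** The cumulant expansion [ln E exp (t Y) = t^2 s2 / 2 + o(t^2)] of a bounded
    centred variable, in the exponential form that multiplies over independent
    copies. *)
Lemma mgf_expansion (e : R) : 0 < e -> exists2 del : R, 0 < del &
  forall t : R, `|t| <= del ->
    expR (t ^+ 2 * (s2 / 2 - e)) <= \int[P]_w expR (t * Y w)
      <= expR (t ^+ 2 * (s2 / 2 + e)).
Proof.
move=> e0.
have M0 : 0 <= M by rewrite (le_trans (normr_ge0 (Y point))).
wlog es : e e0 / e <= s2 / 2.
  move=> H; have [/H|/ltW es] := leP e (s2 / 2); first exact.
  have s20 : 0 < s2 / 2 by rewrite divr_gt0.
  have [del del0 h] := H (s2 / 2) s20 (lexx _).
  exists del => // t /h /andP[h1 h2]; apply/andP; split.
    by apply: le_trans h1; rewrite ler_expR ler_wpM2l ?sqr_ge0// lerD2l lerN2.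
  by apply: (le_trans h2); rewrite ler_expR ler_wpM2l ?sqr_ge0// lerD2l.
pose C := expR 1 * M ^+ 3 + 1.
have C0 : 0 < C by rewrite ltr_wpDl// mulr_ge0 ?expR_ge0// exprn_ge0.
(* the four terms give |t| M <= 1, then a cubic remainder of at most t^2 e / 2,
   then t^2 <= |t|, then t^2 s2^2 <= e *)
pose del := Num.min (M + 1)^-1 (Num.min (e / (2 * C)) (Num.min 1 (e / s2 ^+ 2))).
have M10 : 0 < M + 1 by rewrite ltr_wpDl.
exists del.
  have h1 : 0 < e / (2 * C) by rewrite divr_gt0// mulr_gt0.
  have h2 : 0 < e / s2 ^+ 2 by rewrite divr_gt0// exprn_gt0.
  by rewrite !lt_min invr_gt0 M10 h1 h2 ltr01.
move=> t; rewrite !le_min => /and4P[t1 t2 t3 t4].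
have tC : `|t| * C <= e / 2.
  by move: t2; rewrite ler_pdivlMr ?mulr_gt0//; lra.
have tYM w : `|t * Y w| <= `|t| * M by rewrite normrM ler_wpM2l.
have tM1 : `|t| * M <= 1.
  rewrite (@le_trans _ _ (`|t| * (M + 1)))// ?ler_wpM2l ?lerDl//.
  by rewrite -ler_pdivlMr// mul1r.
have tt : t ^+ 2 = `|t| ^+ 2 by rewrite real_normK ?num_real.
have ptw w : `|expR (t * Y w) - (1 + t * Y w + (t * Y w) ^+ 2 / 2)| <= t ^+ 2 * (e / 2).
  rewrite (le_trans (expR_taylor2 _))// ?(le_trans (tYM w))//.
  rewrite (@le_trans _ _ (expR 1 * (`|t| * M) ^+ 3))//.
    by rewrite ler_wpM2l ?expR_ge0// ler_pXn2r// nnegrE// mulr_ge0.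
  rewrite exprMn (_ : expR 1 * _ = `|t| ^+ 2 * (`|t| * (C - 1))); last by rewrite /C; ring.
  rewrite tt ler_wpM2l ?sqr_ge0// (le_trans _ tC)// ler_wpM2l//.
  by rewrite lerBlDr lerDl.
have mE : measurable_fun setT (fun w => expR (t * Y w)).
  by apply: measurableT_comp => //; apply: measurable_funM.
have iE : P.-integrable setT (EFin \o (fun w => expR (t * Y w))).
  apply: (@prob_integrable_le _ (expR 1)) => // w.
  rewrite ger0_norm ?expR_ge0// ler_expR.
  by rewrite (le_trans (ler_norm _))// (le_trans (tYM w)).
have iQ k : P.-integrable setT (EFin \o (fun w => k + (t * Y w + t ^+ 2 / 2 * Y w ^+ 2))).
  apply: (@prob_integrable_le _ (`|k| + (`|t| * M + t ^+ 2 / 2 * M ^+ 2))).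
    apply: measurable_funD => //; apply: measurable_funD; first exact: measurable_funM.
    by apply: measurable_funM => //; apply: measurable_funX.
  move=> w; rewrite (le_trans (ler_normD _ _))// lerD2l.
  rewrite (le_trans (ler_normD _ _))// lerD// normrM.
  rewrite ger0_norm ?divr_ge0 ?sqr_ge0// ler_wpM2l ?divr_ge0 ?sqr_ge0//.
  by rewrite normrX ler_pXn2r// nnegrE.
have lo : 1 - t ^+ 2 * (e / 2) + t ^+ 2 / 2 * s2 <= \int[P]_w expR (t * Y w).
  rewrite -(Rintegral_quadratic (1 - t ^+ 2 * (e / 2)) t).
  apply: le_Rintegral => // w _; have := ptw w.
  by rewrite ler_distl exprMn => /andP[h _]; lra.
have hi : \int[P]_w expR (t * Y w) <= 1 + t ^+ 2 * (e / 2) + t ^+ 2 / 2 * s2.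
  rewrite -(Rintegral_quadratic (1 + t ^+ 2 * (e / 2)) t).
  apply: le_Rintegral => // w _; have := ptw w.
  by rewrite ler_distl exprMn => /andP[_ h]; lra.
apply/andP; split; last first.
  apply: (le_trans hi); apply: le_trans (expR_ge1Dx _).
  have := sqr_ge0 t; nra.
apply: le_trans lo.
pose u := t ^+ 2 * (s2 / 2 - e).
have u0 : 0 <= u by rewrite mulr_ge0 ?sqr_ge0// subr_ge0.
have t2le : t ^+ 2 <= `|t| by rewrite tt expr2 ler_piMr.
have ts : t ^+ 2 * s2 ^+ 2 <= e.
  rewrite (@le_trans _ _ (`|t| * s2 ^+ 2))// ?ler_wpM2r ?sqr_ge0//.
  by rewrite -ler_pdivlMr// exprn_gt0.
have us : u * s2 <= e / 2.
  have : u * s2 <= t ^+ 2 * (s2 / 2) * s2.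
    by apply: ler_wpM2r; [exact: ltW|apply: ler_wpM2l; [exact: sqr_ge0|rewrite gerBl ltW]].
  nra.
have u1 : u <= 1 / 2 by nra.
have -> : 1 - t ^+ 2 * (e / 2) + t ^+ 2 / 2 * s2 = 1 + u + t ^+ 2 * (e / 2).
  by rewrite /u; field.
have p0 : 0 < 1 + u + t ^+ 2 * (e / 2).
  have e20 : 0 <= e / 2 by rewrite divr_ge0// ltW.
  by have := mulr_ge0 (sqr_ge0 t) e20; lra.
(* exp u is the inverse of exp (- u), which is at least 1 - u *)
rewrite -/u -[X in expR X]opprK expRN -[leRHS]invrK lef_pV2 ?posrE ?expR_gt0//; last first.
  by rewrite invr_gt0.
apply: le_trans (expR_ge1Dx _).
rewrite -[leLHS]mul1r ler_pdivrMr//.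
have uu : u ^+ 2 <= t ^+ 2 / 2 * (u * s2).
  have : u <= t ^+ 2 * (s2 / 2) by rewrite ler_wpM2l ?sqr_ge0// gerBl ltW.
  by nra.
have h1 : t ^+ 2 / 2 * (u * s2) <= t ^+ 2 / 2 * (e / 2).
  by rewrite ler_wpM2l// divr_ge0// sqr_ge0.
have h2 : u * (t ^+ 2 * (e / 2)) <= 1 / 2 * (t ^+ 2 * (e / 2)).
  by rewrite ler_wpM2r// mulr_ge0 ?sqr_ge0// divr_ge0// ltW.
lra.
Qed.

End mgf.

Section iid.
Context d (T : measurableType d) (R : realType) (P : probability T R).
Variables (X : {RV P >-> R}) (Xs : nat -> {RV P >-> R}).
Hypothesis X_iid : iid_copies X Xs.

Lemma ge0_integral_copy (f : R -> R) (i : nat) :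
  measurable_fun setT f -> (forall y, 0 <= f y) ->
  (\int[P]_w (f (Xs i w))%:E = \int[P]_w (f (X w))%:E)%E.
Proof.
move=> mf f0.
have mfE : measurable_fun setT (EFin \o f) by exact/measurable_EFinP.
have fE0 y : (0 <= (EFin \o f) y)%E by rewrite lee_fin.
rewrite -[LHS](ge0_integral_distribution (Xs i) mfE fE0).
rewrite -[RHS](ge0_integral_distribution X mfE fE0).
by apply: eq_measure_integral => A mA _; exact: X_iid.2.
Qed.

Lemma mgf_sum (y : R -> R) (M t : R) (n : nat) :
  measurable_fun setT y -> (forall x, `|y x| <= M) ->
  (\int[P]_w (expR (t * \sum_(i < n) y (Xs i w)))%:E =
    ((\int[P]_w expR (t * y (X w))) ^+ n)%R%:E)%E.
Proof.
move=> my yM.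
pose f := fun (_ : nat) x => expR (t * y x).
have mf i : measurable_fun setT (f i).
  by apply: measurableT_comp => //; apply: measurable_funM.
have fM x : `|f 0 x| <= expR (`|t| * M).
  rewrite ger0_norm ?expR_ge0// ler_expR (le_trans (ler_norm _))// normrM.
  by rewrite ler_wpM2l.
have fiX (Z : {RV P >-> R}) : P.-integrable setT (fun w => (f 0 (Z w))%:E).
  apply: (@prob_integrable_le _ _ _ P (fun w => f 0 (Z w)) (expR (`|t| * M))) => //.
  by apply: (measurableT_comp (mf 0)).
transitivity (\int[P]_w (\prod_(i < n) f i (Xs i w))%:E)%E.
  by apply: eq_integral => w _; rewrite big_distrr/= expR_sum.
rewrite (expectation_prod X_iid.1 mf)//; first last.
- by move=> i; exact: fiX.
- by move=> i x; exact: expR_ge0.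
have fE : (\int[P]_w (f 0 (X w))%:E = (\int[P]_w expR (t * y (X w)))%:E)%E.
  by rewrite (EFin_Rintegral measurableT (fiX X)).
under eq_bigr => i _.
  rewrite (ge0_integral_copy _ (mf _))//; last by move=> x; exact: expR_ge0.
  rewrite fE; over.
by rewrite prodEFin prodr_const card_ord.
Qed.

Variables (y : R -> R) (M s2 : R).
Hypothesis my : measurable_fun setT y.
Hypothesis yM : forall x, `|y x| <= M.
Hypothesis s2_gt0 : 0 < s2.
Hypothesis Ey : \int[P]_w y (X w) = 0.
Hypothesis Ey2 : \int[P]_w (y (X w) ^+ 2) = s2.
Variable a : nat -> R.
Hypothesis a_gt0 : forall n, (0 < n)%N -> 0 < a n.
Hypothesis a_small : a n / Num.sqrt (n%:R : R) @[n --> \oo] --> (0 : R).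

(** The tilt of a single summand is [t = th a(n) / sqrt n], which tends to 0:
    only the quadratic term of its cumulant survives, and [n t^2] is
    [a(n)^2 th^2]. *)
Lemma mgf_normalized_sum (th e : R) : 0 < e -> \forall n \near \oo,
  ((expR (a n ^+ 2 * (s2 * th ^+ 2 / 2 - e)))%:E <=
     \int[P]_w (expR (th * (a n ^+ 2 *
       (Num.sqrt n%:R / a n * (n%:R^-1 * \sum_(i < n) y (Xs i w))))))%:E <=
   (expR (a n ^+ 2 * (s2 * th ^+ 2 / 2 + e)))%:E)%E.
Proof.
move=> e0.
have th0 : 0 < th ^+ 2 + 1 by rewrite ltr_wpDl// sqr_ge0.
have e'0 : 0 < e / (th ^+ 2 + 1) by rewrite divr_gt0.
have myX : measurable_fun setT (fun w => y (X w)) by exact: measurableT_comp.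
have [del del0 h] := mgf_expansion myX (fun w => yM (X w)) s2_gt0 Ey Ey2 e'0.
have del'0 : 0 < del / (`|th| + 1) by rewrite divr_gt0// ltr_wpDl.
have hth : th ^+ 2 * (e / (th ^+ 2 + 1)) <= e.
  by rewrite mulrA ler_pdivrMr//; nra.
near=> n.
have n0 : (0 < n)%N by near: n; exists 1%N.
have nR : 0 < n%:R :> R by rewrite ltr0n.
have an := a_gt0 n0.
have sn : 0 < Num.sqrt n%:R :> R by rewrite sqrtr_gt0.
have sn2 : Num.sqrt n%:R ^+ 2 = n%:R :> R by rewrite sqr_sqrtr// ltW.
pose t := th * (a n / Num.sqrt n%:R).
have tdel : `|t| <= del.
  have : `|a n / Num.sqrt n%:R| <= del / (`|th| + 1).
    near: n; move/cvgr_dist_le : a_small => /(_ _ del'0).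
    by apply: filterS => n; rewrite sub0r normrN.
  rewrite ler_pdivlMr ?ltr_wpDl// => ha.
  rewrite /t normrM (le_trans _ ha)// mulrC.
  by rewrite ler_wpM2l// lerDl.
have tn : n%:R * t ^+ 2 = a n ^+ 2 * th ^+ 2.
  by rewrite /t exprMn exprMn exprVn sn2; field; rewrite gt_eqF.
have -> : (\int[P]_w (expR (th * (a n ^+ 2 *
       (Num.sqrt n%:R / a n * (n%:R^-1 * \sum_(i < n) y (Xs i w))))))%:E =
     ((\int[P]_w expR (t * y (X w))) ^+ n)%R%:E)%E.
  rewrite -(mgf_sum _ _ my yM); apply: eq_integral => w _; congr (expR _)%:E.
  move: (\sum_(i < n) _) sn sn2; rewrite /t.
  by set r := Num.sqrt _ => S sn <-; field; rewrite !gt_eqF.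
have /andP[h1 h2] := h t tdel.
rewrite !lee_fin; apply/andP; split.
  rewrite (@le_trans _ _ (expR (t ^+ 2 * (s2 / 2 - e / (th ^+ 2 + 1))) ^+ n))//.
    rewrite -expRM_natl ler_expR.
    rewrite [leRHS]mulrA tn -[leRHS]mulrA ler_pM2l ?exprn_gt0//; lra.
  by rewrite ler_pXn2r// nnegrE ?expR_ge0// (le_trans _ h1)// expR_ge0.
rewrite (@le_trans _ _ (expR (t ^+ 2 * (s2 / 2 + e / (th ^+ 2 + 1))) ^+ n))//.
  by rewrite ler_pXn2r// nnegrE ?expR_ge0// (le_trans _ h1)// expR_ge0.
rewrite -expRM_natl ler_expR.
rewrite [leLHS]mulrA tn -[leLHS]mulrA ler_pM2l ?exprn_gt0//; lra.
Unshelve. all: by end_near. Qed.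

End iid.

(** * Tail bounds for averages over the line *)

Section tonelli_real.
Context d1 d2 (T1 : measurableType d1) (T2 : measurableType d2) (R : realType).
Variables (m1 : {sigma_finite_measure set T1 -> \bar R})
          (m2 : {sigma_finite_measure set T2 -> \bar R}).
Variable phi : T1 * T2 -> R.
Hypothesis mphi : measurable_fun setT phi.
Hypothesis phi0 : forall z, 0 <= phi z.

Let mE : measurable_fun setT (EFin \o phi). Proof. exact/measurable_EFinP. Qed.

Lemma measurable_integral_snd :
  measurable_fun setT (fun w => \int[m2]_x (phi (w, x))%:E)%E.
Proof. exact: (@measurable_fun_fubini_tonelli_F _ _ _ _ _ m2 (EFin \o phi)). Qed.

Lemma measurable_integral_fst :
  measurable_fun setT (fun x => \int[m1]_w (phi (w, x))%:E)%E.
Proof. exact: (@measurable_fun_fubini_tonelli_G _ _ _ _ _ m1 (EFin \o phi)). Qed.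

Lemma tonelli_swap :
  (\int[m1]_w \int[m2]_x (phi (w, x))%:E =
   \int[m2]_x \int[m1]_w (phi (w, x))%:E)%E.
Proof. exact: (@fubini_tonelli _ _ _ _ _ m1 m2 (EFin \o phi)). Qed.

End tonelli_real.

Section fubini_markov.
Context d (T : measurableType d) (R : realType) (P : probability T R).
Let leb := @lebesgue_measure R.

(** Tonelli's theorem reduces the expectation in Markov's inequality to
    expectations at fixed abscissas. *)
Lemma fubini_markov (phi : T * R -> R) (g : R) :
  measurable_fun setT phi -> (forall z, 0 <= phi z) -> 0 <= g ->
  (g%:E * P [set w | (g%:E <= \int[leb]_x (phi (w, x))%:E)%E] <=
   \int[leb]_x \int[P]_w (phi (w, x))%:E)%E.
Proof.
move=> mphi phi0 g0.
rewrite -(tonelli_swap P leb mphi phi0).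
apply: markov_on => //.
- rewrite -[X in measurable X]setTI; apply: emeasurable_fun_c_infty => //.
  exact: (measurable_integral_snd leb mphi phi0).
- exact: (measurable_integral_snd leb mphi phi0).
- by move=> w _; apply: integral_ge0 => x _; rewrite lee_fin.
Qed.

(** If the average of [|D|] for the weight [h] exceeds [m] then, by convexity,
    the average of [exp (s (|D| - m))] exceeds 1; Markov's inequality then
    asks only for exponential moments at each fixed [x].  Convexity enters
    through [1 + y <= exp y]. *)
Lemma jensen_tail (D : T * R -> R) (h : R -> R) (s m b G : R) :
  measurable_fun setT D -> measurable_fun setT h -> (forall x, 0 <= h x) ->
  (\int[leb]_x (h x)%:E = G%:E)%E -> 0 < G -> 0 <= s -> 0 <= m -> 0 <= b ->
  (forall x, \int[P]_w (expR (s * `|D (w, x)|))%:E <= b%:E)%E ->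
  (P [set w | ((m * G)%:E <= \int[leb]_x (`|D (w, x)| * h x)%:E)%E] <=
   (expR (- (s * m)) * b)%:E)%E.
Proof.
move=> mD mh h0 hG G0 s0 m0 b0 hb.
pose phi := fun z : T * R => expR (s * (`|D z| - m)) * h z.2.
have mh2 : measurable_fun setT (fun z : T * R => h z.2).
  by apply: measurableT_comp => //; exact: measurable_snd.
have mND : measurable_fun setT (fun z => `|D z|) by exact: measurableT_comp.
have mphi : measurable_fun setT phi.
  apply: measurable_funM => //; apply: measurableT_comp => //.
  by apply: measurable_funM => //; apply: measurable_funB.
have phi0 z : 0 <= phi z by rewrite mulr_ge0// expR_ge0.
have mDh : measurable_fun setT (fun z : T * R => `|D z| * h z.2).
  exact: measurable_funM.
have := fubini_markov mphi phi0 (ltW G0).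
set A := [set w | _] => hA.
set B := [set w | _].
have mB : measurable B.
  rewrite -[X in measurable X]setTI; apply: emeasurable_fun_c_infty => //.
  apply: (measurable_integral_snd leb mDh) => z.
  by rewrite mulr_ge0.
have mA : measurable A.
  rewrite -[X in measurable X]setTI; apply: emeasurable_fun_c_infty => //.
  exact: (measurable_integral_snd leb mphi phi0).
have BA : B `<=` A.
  move=> w; rewrite /B /A /= => Bw.
  have e1 : measurable_fun setT (fun x => (phi (w, x))%:E).
    by apply/measurable_EFinP; apply: (measurableT_comp mphi); exact: measurable_pair1.
  have e2 : measurable_fun setT (fun x => (`|D (w, x)| * h x)%:E).
    apply/measurable_EFinP; apply: (measurableT_comp mDh).
    exact: (measurable_pair1 w).
  have hE : measurable_fun setT (EFin \o h) by exact/measurable_EFinP.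
  have key : (\int[leb]_x (h x)%:E + s%:E * \int[leb]_x (`|D (w, x)| * h x)%:E <=
     \int[leb]_x (phi (w, x))%:E + (s * m)%:E * \int[leb]_x (h x)%:E)%E.
    rewrite -ge0_integralZl//; last by move=> x _; rewrite lee_fin mulr_ge0.
    rewrite -ge0_integralD//; last 3 first.
    - by move=> x _; rewrite lee_fin.
    - by move=> x _; rewrite -EFinM lee_fin !mulr_ge0.
    - exact: measurable_funeM.
    rewrite -ge0_integralZl//; last 2 first.
    - by move=> x _; rewrite lee_fin.
    - by rewrite lee_fin mulr_ge0.
    rewrite -ge0_integralD//; last 3 first.
    - by move=> x _; rewrite lee_fin.
    - by move=> x _; rewrite -EFinM lee_fin !mulr_ge0.
    - exact: measurable_funeM.
    apply: ge0_le_integral => //.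
    - by move=> x _; rewrite -EFinM -EFinD lee_fin addr_ge0// !mulr_ge0.
    - by apply: emeasurable_funD => //; exact: measurable_funeM.
    - by apply: emeasurable_funD => //; exact: measurable_funeM.
    move=> x _; rewrite -!EFinM -!EFinD lee_fin /phi/=.
    have := expR_ge1Dx (s * (`|D (w, x)| - m)) => e.
    have := h0 x; nra.
  have k2 : (G%:E + (s * (m * G))%:E <= \int[leb]_x (phi (w, x))%:E + (s * (m * G))%:E)%E.
    rewrite -[X in (X + _ <= _)%E]hG.
    have kk := key; rewrite [in leRHS]hG -EFinM -mulrA in kk.
    apply: le_trans kk; rewrite leeD2l// EFinM; apply: lee_wpmul2l; last exact: Bw.
    by rewrite lee_fin.
  by rewrite leeD2rE// in k2.
have hB : (G%:E * P B <= \int[leb]_x \int[P]_w (phi (w, x))%:E)%E.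
  apply: le_trans hA; rewrite lee_wpmul2l//; first by rewrite lee_fin ltW.
  by rewrite le_measure ?inE.
rewrite -(@lee_pmul2l _ G%:E)//.
apply: (le_trans hB).
apply: (@le_trans _ _ (\int[leb]_x ((expR (- (s * m)) * b)%:E * (h x)%:E))%E).
  apply: ge0_le_integral => //.
  - by move=> x _; apply: integral_ge0 => w _; rewrite lee_fin.
  - exact: (measurable_integral_fst P mphi phi0).
  - by apply: measurable_funeM; exact/measurable_EFinP.
  move=> x _.
  have mx : measurable_fun setT (fun w => (expR (s * `|D (w, x)|))%:E).
    apply/measurable_EFinP; apply: measurableT_comp => //.
    apply: measurable_funM => //.
    by apply: (measurableT_comp mND); exact: pair2_measurable.
  apply: (@le_trans _ _ (\int[P]_w ((expR (- (s * m)) * h x)%:E * (expR (s * `|D (w, x)|))%:E))%E).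
    rewrite le_eqVlt; apply/orP; left; apply/eqP.
    apply: eq_integral => w _; rewrite -EFinM /phi/= mulrBr expRD.
    by congr EFin; ring.
  rewrite ge0_integralZl//; last by rewrite lee_fin mulr_ge0 ?expR_ge0.
  rewrite [leRHS](_ : _ = (expR (- (s * m)) * h x)%:E * b%:E)%E; last first.
    by rewrite -!EFinM mulrAC.
  apply: lee_wpmul2l; last exact: hb.
  by rewrite lee_fin mulr_ge0 ?expR_ge0.
rewrite ge0_integralZl//.
- by rewrite hG muleC.
- exact/measurable_EFinP.
- by move=> x _; rewrite lee_fin.
- by rewrite lee_fin mulr_ge0 ?expR_ge0.
Qed.

End fubini_markov.

(** A crude constant [C] for the bound [E exp (t y) <= exp (C t^2)], where [y] is
    centred and bounded by 1 and [|t| <= 1]. *)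
Definition subg_cst (R : realType) : R := expR 1 + 1.

(** The exponent given by Chernoff's bound with the tilt [min 1 (eta / (2 C))]. *)
Definition hoeffding_rate (R : realType) (eta : R) : R :=
  Num.min 1 (eta / (2 * subg_cst R)) * eta / 2.

Lemma subg_cst_gt0 (R : realType) : 0 < subg_cst R.
Proof. by rewrite addr_gt0// expR_gt0. Qed.

Lemma hoeffding_rate_gt0 (R : realType) (eta : R) : 0 < eta -> 0 < hoeffding_rate eta.
Proof.
move=> eta0; rewrite /hoeffding_rate divr_gt0// mulr_gt0// lt_min ltr01/=.
by rewrite divr_gt0// mulr_gt0// subg_cst_gt0.
Qed.

Section subgaussian.
Context d (T : measurableType d) (R : realType) (P : probability T R).
Variables (X : {RV P >-> R}) (Xs : nat -> {RV P >-> R}).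
Hypothesis X_iid : iid_copies X Xs.
Variable y : R -> R.
Hypothesis my : measurable_fun setT y.
Hypothesis y1 : forall x, `|y x| <= 1.
Hypothesis Ey : \int[P]_w y (X w) = 0.

Let C := subg_cst R.
Let C0 : 0 < C. Proof. by rewrite addr_gt0// expR_gt0. Qed.

Lemma mgf_centered_le (t : R) : `|t| <= 1 ->
  \int[P]_w expR (t * y (X w)) <= expR (C * t ^+ 2).
Proof.
move=> t1.
have myX : measurable_fun setT (fun w => y (X w)) by exact: measurableT_comp.
have tt : t ^+ 2 = `|t| ^+ 2 by rewrite real_normK ?num_real.
have ty w : `|t * y (X w)| <= `|t|.
  by rewrite normrM ler_piMr.
have iy : P.-integrable setT (EFin \o (fun w => y (X w))).
  exact: (@prob_integrable_le _ _ _ _ _ 1).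
have ity : P.-integrable setT (EFin \o (fun w => t * y (X w))).
  exact: (integrableZl measurableT t iy).
have iC : P.-integrable setT (EFin \o (fun _ : T => 1 + C * t ^+ 2)).
  exact: (@prob_integrable_le _ _ _ _ _ `|1 + C * t ^+ 2|).
have PT : (P : {measure set T -> \bar R}) setT = 1%E by exact: probability_setT.
apply: (@le_trans _ _ (\int[P]_w ((1 + C * t ^+ 2) + t * y (X w)))); last first.
  rewrite RintegralD// Rintegral_cst// PT mulr1 RintegralZl// Ey mulr0 addr0.
  exact: expR_ge1Dx.
apply: le_Rintegral => //.
- apply: (@prob_integrable_le _ _ _ _ _ (expR 1)).
    by apply: measurableT_comp => //; exact: measurable_funM.
  move=> w; rewrite ger0_norm ?expR_ge0// ler_expR.
  by rewrite (le_trans (ler_norm _))// (le_trans (ty w)).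
- exact: (integrableD measurableT iC ity).
move=> w _; set z := t * y (X w).
have z1 : `|z| <= 1 by rewrite (le_trans (ty w)).
have zt : `|z| ^+ 2 <= t ^+ 2 by rewrite tt ler_pXn2r ?nnegrE// ty.
have := expR_taylor2 z1; rewrite ler_distl => /andP[_].
have zz : z ^+ 2 = `|z| ^+ 2 by rewrite real_normK ?num_real.
have z3 : `|z| ^+ 3 <= t ^+ 2.
  by rewrite exprS (le_trans _ zt)// ler_piMl ?exprn_ge0.
have z3' : expR 1 * `|z| ^+ 3 <= expR 1 * t ^+ 2 by rewrite ler_wpM2l// expR_ge0.
rewrite zz /C /subg_cst mulrDl; have := sqr_ge0 t.
lra.
Qed.

Lemma mgf_sum_le (t : R) n : `|t| <= 1 ->
  (\int[P]_w (expR (t * \sum_(i < n) y (Xs i w)))%:E <=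
   (expR (n%:R * (C * t ^+ 2)))%:E)%E.
Proof.
move=> t1; rewrite (mgf_sum X_iid _ _ my y1) lee_fin expRM_natl.
rewrite lerXn2r// ?nnegrE ?expR_ge0//; last exact: mgf_centered_le.
by apply: Rintegral_ge0 => w _; exact: expR_ge0.
Qed.

Lemma mgf_abs_sum_le (t : R) n : 0 <= t <= 1 ->
  (\int[P]_w (expR (t * `|\sum_(i < n) y (Xs i w)|))%:E <=
   (2 * expR (n%:R * (C * t ^+ 2)))%:E)%E.
Proof.
move=> /andP[t0 t1].
have mS : measurable_fun setT (fun w => \sum_(i < n) y (Xs i w)).
  by apply: measurable_sum => i; exact: measurableT_comp.
have me u : measurable_fun setT (fun w => (expR (u * \sum_(i < n) y (Xs i w)))%:E).
  by apply/measurable_EFinP; apply: measurableT_comp => //; exact: measurable_funM.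
apply: (@le_trans _ _ (\int[P]_w ((expR (t * \sum_(i < n) y (Xs i w)))%:E +
   (expR ((- t) * \sum_(i < n) y (Xs i w)))%:E))%E).
  apply: ge0_le_integral => //.
  - apply/measurable_EFinP; apply: measurableT_comp => //.
    by apply: measurable_funM => //; exact: measurableT_comp.
  - exact: emeasurable_funD.
  move=> w _; rewrite -EFinD lee_fin.
  have [s0|s0] := leP 0 (\sum_(i < n) y (Xs i w)).
    by rewrite ger0_norm// lerDl expR_ge0.
  by rewrite ltr0_norm// mulrN -mulNr lerDr expR_ge0.
rewrite ge0_integralD//.
rewrite mulrDl mul1r EFinD; apply: leeD.
  by apply: mgf_sum_le; rewrite ger0_norm.
by rewrite -[X in C * X]sqrrN; apply: mgf_sum_le; rewrite normrN ger0_norm.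
Qed.

Lemma hoeffding_tail (eta : R) (n : nat) : 0 < eta -> (0 < n)%N ->
   (P [set w | (eta <= `|n%:R^-1 * \sum_(i < n) y (Xs i w)|)%R] <=
     (2 * expR (- (n%:R * hoeffding_rate eta)))%:E)%E.
Proof.
move=> eta0 n0; rewrite /hoeffding_rate; set t := Num.min 1 _.
have t0 : 0 < t by rewrite lt_min ltr01 divr_gt0// mulr_gt0.
have t1 : t <= 1 by rewrite ge_min lexx.
have tC : t * C <= eta / 2.
  have : t <= eta / (2 * C) by rewrite ge_min lexx orbT.
  by rewrite ler_pdivlMr ?mulr_gt0//; lra.
have nR : 0 < n%:R :> R by rewrite ltr0n.
have mS : measurable_fun setT (fun w => \sum_(i < n) y (Xs i w)).
  by apply: measurable_sum => i; exact: measurableT_comp.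
set A := [set w | _].
have mA : measurable A.
  apply: measurable_set_le => //; apply: measurableT_comp => //.
  exact: measurable_funM.
have H : ((expR (t * (n%:R * eta)))%:E * P A <= (2 * expR (n%:R * (C * t ^+ 2)))%:E)%E.
  apply: (le_trans _ (mgf_abs_sum_le n _)); last by rewrite ltW.
  apply: markov_on => //.
  - apply/measurable_EFinP; apply: measurableT_comp => //.
    by apply: measurable_funM => //; exact: measurableT_comp.
  move=> w; rewrite /A/= normrM gtr0_norm ?invr_gt0// mulrC ler_pdivlMr// => h.
  by rewrite lee_fin ler_expR ler_pM2l// mulrC.
move: H; rewrite -lee_pdivlMl ?expR_gt0//; move/le_trans; apply.
rewrite -EFinM lee_fin -expRN mulrCA ler_pM2l// -expRD ler_expR.
have : n%:R * (t * (t * C)) <= n%:R * (t * (eta / 2)).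
  by rewrite !ler_pM2l.
nra.
Qed.

End subgaussian.

(** * Integrals of functions known off a null set *)

Section null_modification.
Context d (T : measurableType d) (R : realType) (mu : {measure set T -> \bar R}).

(** The integral of a nonnegative function is a supremum over the simple
    functions below it, hence monotone even for functions built from an arbitrary
    score. *)
Lemma ge0_le_integral_nonmeas (f g : T -> \bar R) :
  (forall x, 0 <= f x)%E -> (forall x, f x <= g x)%E ->
  (\int[mu]_x f x <= \int[mu]_x g x)%E.
Proof.
move=> f0 fg; have g0 x : (0 <= g x)%E by apply: le_trans (fg x).
rewrite !ge0_integralTE//; apply: ereal_sup_le => _ [h /= hf <-].
by exists h => // x; apply: le_trans (fg x).
Qed.

Variables (N : set T) (mN : measurable N) (N0 : mu N = 0%E).

Let ge0_case (f g : T -> \bar R) : measurable_fun setT g ->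
  (forall x, 0 <= f x)%E -> (forall x, 0 <= g x)%E ->
  (forall x, ~ N x -> f x = g x) ->
  (\int[mu]_x f x = \int[mu]_x g x)%E.
Proof.
move=> mg f0 g0 fg; apply/eqP; rewrite eq_le; apply/andP; split.
  apply: (@le_trans _ _ (\int[mu]_x (g x + (cst +oo \_ N) x))%E).
    apply: ge0_le_integral_nonmeas => // x; rewrite patchE.
    have [xN|xN] := boolP (x \in N); first by rewrite addey ?leey// -ltNye (lt_le_trans _ (g0 x)).
    by rewrite adde0 fg// => /mem_set; rewrite (negbTE xN).
  rewrite ge0_integralD//; last 2 first.
  - by move=> x _; rewrite patchE; case: ifP => _ //=; rewrite leey.
  - by apply/(measurable_restrictT _ mN); exact: measurable_cst.
  have -> : (\int[mu]_x ((cst +oo) \_ N) x = 0)%E.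
    by rewrite -integral_mkcond; apply: null_set_integral => //; exact: measurable_cst.
  by rewrite adde0.
rewrite (ge0_negligible_integral mN measurableT)//.
rewrite integral_mkcond; apply: ge0_le_integral_nonmeas => x; rewrite patchE.
  by case: ifP.
by case: ifPn => // /set_mem[_ xN]; rewrite fg.
Qed.

(** For nonnegative functions, [f] lies between [g] set to 0 on the null set and
    [g] raised to infinity there, and these two have the same integral.  The
    lemma gives access to integrals of a score that is known, and Borel, only
    off a null set. *)
Lemma integral_eq_off_null (D : set T) (f g : T -> \bar R) :
  measurable D -> measurable_fun D g ->
  (forall x, D x -> ~ N x -> f x = g x) ->
  (\int[mu]_(x in D) f x = \int[mu]_(x in D) g x)%E.
Proof.
move=> mD mg fg; rewrite integral_mkcond [RHS]integral_mkcond.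
have mgD : measurable_fun setT (g \_ D) by exact/(measurable_restrictT _ mD).
have E x : ~ N x -> (f \_ D) x = (g \_ D) x.
  by move=> xN; rewrite !patchE; case: ifPn => // /set_mem Dx; exact: fg.
rewrite integralE [RHS]integralE; congr (_ - _)%E; apply: ge0_case => //.
- exact: measurable_funepos.
- by move=> x xN; rewrite !funeposE E.
- exact: measurable_funeneg.
- by move=> x xN; rewrite !funenegE E.
Qed.

Lemma Rintegral_eq_off_null (D : set T) (f g : T -> R) :
  measurable D -> measurable_fun D g ->
  (forall x, D x -> ~ N x -> f x = g x) ->
  \int[mu]_(x in D) f x = \int[mu]_(x in D) g x.
Proof.
move=> mD mg fg; congr fine; apply: integral_eq_off_null => //.
  exact/measurable_EFinP.
by move=> x Dx xN; rewrite fg.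
Qed.

End null_modification.

(** * Lipschitz envelopes *)

Section envelope.
Context {R : realType}.
Implicit Types (f : R -> R) (k : nat) (u v w M : R).

(** The upper Pasch-Hausdorff envelope: for a bounded [f] it is the least
    [k]-Lipschitz majorant of [f]. *)
Definition uenv f k u := sup [set f w - k%:R * `|u - w| | w in setT].

Lemma uenv_ub f M k u w : (forall w, `|f w| <= M) ->
  f w - k%:R * `|u - w| <= uenv f k u.
Proof.
move=> fM; apply: ub_le_sup; last by exists w.
exists M => _ [v _ <-]; rewrite lerBlDr (le_trans (ler_norm _))//.
by rewrite (le_trans (fM v))// lerDl mulr_ge0.
Qed.

Lemma uenv_le f k u B : (forall w, f w - k%:R * `|u - w| <= B) -> uenv f k u <= B.
Proof.
move=> fB; apply: ge_sup; first by exists (f u - k%:R * `|u - u|); exists u.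
by move=> _ [w _ <-].
Qed.

Section bounded.
Variables (f : R -> R) (M : R).
Hypothesis fM : forall w, `|f w| <= M.

Lemma le_uenv k u : f u <= uenv f k u.
Proof. by have := uenv_ub k u u fM; rewrite subrr normr0 mulr0 subr0. Qed.

Lemma uenv_le_bound k u : uenv f k u <= M.
Proof.
apply: uenv_le => w; rewrite lerBlDr (le_trans (ler_norm _))//.
by rewrite (le_trans (fM w))// lerDl mulr_ge0.
Qed.

Lemma norm_uenv_le k u : `|uenv f k u| <= M.
Proof.
rewrite ler_norml uenv_le_bound andbT (le_trans _ (le_uenv k u))//.
by have := fM u; rewrite ler_norml => /andP[].
Qed.

Lemma uenv_lipschitz k u v : uenv f k u <= uenv f k v + k%:R * `|u - v|.
Proof.
apply: uenv_le => w; rewrite lerBlDr.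
have := uenv_ub k v w fM; rewrite lerBlDr => /le_trans; apply.
rewrite -addrA lerD2l -mulrDr ler_wpM2l//.
have -> : v - w = (v - u) + (u - w) by ring.
by rewrite [`|u - v|]distrC ler_normD.
Qed.

Lemma uenv_antitone u : {homo (fun k => uenv f k u) : k l / (k <= l)%N >-> l <= k}.
Proof.
move=> k l kl; apply: uenv_le => w; apply: le_trans (uenv_ub k u w fM).
by rewrite lerD2l lerN2 ler_wpM2r// ler_nat.
Qed.

Lemma uenv_continuous k : continuous (uenv f k).
Proof.
move=> u; apply/cvgrPdist_le => e e0.
have k0 : 0 < k%:R + 1 :> R by rewrite ltr_wpDl.
have d0 : 0 < e / (k%:R + 1) by rewrite divr_gt0.
near=> v.
have uv : `|u - v| <= e / (k%:R + 1).
  near: v; apply/nbhs_ballP; exists (e / (k%:R + 1)) => //= v.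
  by rewrite /ball/=; exact: ltW.
rewrite distrC ler_distl; have h1 := uenv_lipschitz k u v; have h2 := uenv_lipschitz k v u.
rewrite distrC in h2.
have : k%:R * `|u - v| <= e.
  by rewrite ler_pdivlMr// in uv; have := normr_ge0 (u - v); lra.
by move=> h3; apply/andP; split; lra.
Unshelve. all: by end_near. Qed.

(** Points at distance at least [del] are penalized by [k del], which eventually
    exceeds the range [2 M]; closer points are controlled by continuity. *)
Lemma uenv_cvg u : {for u, continuous f} -> uenv f k u @[k --> \oo] --> f u.
Proof.
move=> cf; apply/cvgrPdist_le => e e0.
move/cvgrPdist_le : cf => /(_ _ e0) /nbhs_ballP[del /= del0 hdel].
near=> k; rewrite ler_norml; apply/andP; split; last first.
  by have := le_uenv k u; lra.
rewrite lerNl opprB lerBlDr; apply: uenv_le => w.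
have M0 : 0 <= M by apply: le_trans (fM 0).
have [uw|uw] := ltP `|u - w| del.
  have := hdel w uw; rewrite ler_distl => /andP[h _].
  have : 0 <= k%:R * `|u - w| by rewrite mulr_ge0.
  lra.
have kd : 2 * M <= k%:R * del.
  rewrite -ler_pdivrMr//; near: k; exact: nbhs_infty_ger.
have : k%:R * del <= k%:R * `|u - w| by rewrite ler_wpM2l.
have := fM u; have := fM w; rewrite !ler_norml => /andP[_ ?] /andP[? _]; lra.
Unshelve. all: by end_near. Qed.

(** The upper semicontinuous hull of a bounded [f].  It is Borel whatever [f] is,
    and equals [f] at each point of continuity. *)
Definition uhull u : R := limn (fun k => uenv f k u).

Lemma cvg_uhull u : uenv f k u @[k --> \oo] --> uhull u.
Proof.
apply: nonincreasing_is_cvgn; first exact: uenv_antitone.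
exists (- M) => _ [k _ <-].
by have := norm_uenv_le k u; rewrite ler_norml => /andP[].
Qed.

Lemma uhull_le k u : uhull u <= uenv f k u.
Proof. by apply: nonincreasing_cvgn_ge; [exact: uenv_antitone|exact: cvg_uhull]. Qed.

Lemma le_uhull u : f u <= uhull u.
Proof. by apply: limr_ge; [exact: cvg_uhull|apply: nearW => k; exact: le_uenv]. Qed.

Lemma norm_uhull_le u : `|uhull u| <= M.
Proof.
rewrite ler_norml (le_trans (uhull_le 0 u) (uenv_le_bound _ _)) andbT.
rewrite (le_trans _ (le_uhull u))//.
by have := fM u; rewrite ler_norml => /andP[].
Qed.

Lemma uhull_continuity u : {for u, continuous f} -> uhull u = f u.
Proof. by move=> cf; apply: (cvg_lim _ (uenv_cvg cf)). Qed.

Lemma measurable_uhull : measurable_fun setT uhull.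
Proof.
apply: (measurable_fun_cvg (h := fun k => uenv f k)) => //.
  by move=> k; apply: continuous_measurable_fun; exact: uenv_continuous.
by move=> u _; exact: cvg_uhull.
Qed.

End bounded.

(** The upper [k]-Lipschitz envelope minus the lower one, which is the opposite of
    the upper envelope of [- f]. *)
Definition osc_env f k u := uenv f k u + uenv (fun x => - f x) k u.

Section oscillation.
Variables (f : R -> R) (M : R).
Hypothesis fM : forall w, `|f w| <= M.
Let fNM w : `|- f w| <= M. Proof. by rewrite normrN. Qed.

Lemma osc_env_ge0 k u : 0 <= osc_env f k u.
Proof. have := le_uenv fM k u; have := le_uenv fNM k u; rewrite /osc_env; lra. Qed.

Lemma osc_env_le k u : osc_env f k u <= 2 * M.
Proof.
have := uenv_le_bound fM k u; have := uenv_le_bound fNM k u; rewrite /osc_env; lra.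
Qed.

Lemma osc_env_cvg u : {for u, continuous f} -> osc_env f k u @[k --> \oo] --> (0 : R).
Proof.
move=> cf; rewrite -(subrr (f u)); apply: cvgD; first exact: (uenv_cvg fM).
by apply: (uenv_cvg fNM); exact: continuousN.
Qed.

Lemma measurable_osc_env k : measurable_fun setT (osc_env f k).
Proof.
apply: continuous_measurable_fun => u.
by apply: cvgD; [exact: (uenv_continuous fM)|exact: (uenv_continuous fNM)].
Qed.

(** Both envelopes are [k]-Lipschitz and [uhull f] lies between them. *)
Lemma uhull_osc k u w :
  `|uhull f w - uhull f u| <= osc_env f k u + k%:R * `|w - u|.
Proof.
have h1 := uhull_le fM k w; have h2 := uhull_le fM k u.
have h3 := le_uhull fM w; have h4 := le_uhull fM u.
have h5 := le_uenv fNM k u; have h6 := le_uenv fNM k w.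
have h7 := uenv_lipschitz fM k w u; have h8 := uenv_lipschitz fNM k w u.
by rewrite ler_norml /osc_env; apply/andP; split; lra.
Qed.

End oscillation.
End envelope.

(** * Primitives of the upper hull *)

Section norm_bound.
Context d (T : measurableType d) (R : realType) (mu : {measure set T -> \bar R}).

Lemma norm_Rintegral_le (D : set T) (f : T -> R) (M : R) :
  measurable D -> (mu D < +oo)%E -> measurable_fun D f ->
  (forall x, D x -> `|f x| <= M) ->
  `|\int[mu]_(x in D) f x| <= M * fine (mu D).
Proof.
move=> mD Doo mf fM.
have fi := integrable_le_cst mD Doo mf fM.
rewrite -Rintegral_cst// (le_trans (le_normr_Rintegral mD fi))//.
apply: le_Rintegral => //.
  rewrite (_ : EFin \o (fun x => `|f x|) = abse \o (EFin \o f)); last exact/funext.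
  exact: integrable_abse.
by apply: (@integrable_le_cst _ _ _ _ _ _ `|M|).
Qed.

End norm_bound.

Section primitive.
Context {R : realType}.
Let leb := @lebesgue_measure R.

Lemma lebesgue_measure_oc (u v : R) : u <= v -> leb `]u, v]%classic = (v - u)%:E.
Proof.
move=> uv; rewrite /leb lebesgue_measure_itv/= lte_fin.
move: uv; rewrite le_eqVlt => /orP[/eqP->|->]; last by rewrite EFinB.
by rewrite ltxx subrr.
Qed.

Lemma lebesgue_measure_cc (u v : R) : u <= v -> leb `[u, v]%classic = (v - u)%:E.
Proof.
move=> uv; rewrite /leb lebesgue_measure_itv/= lte_fin.
move: uv; rewrite le_eqVlt => /orP[/eqP->|->]; last by rewrite EFinB.
by rewrite ltxx subrr.
Qed.

Lemma integrable_bounded_itv (f : R -> R) (M : R) (i : interval R) :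
  measurable_fun setT f -> (forall w, `|f w| <= M) ->
  (leb [set` i] < +oo)%E -> leb.-integrable [set` i] (EFin \o f).
Proof.
move=> mf fM fin; apply: (@integrable_le_cst _ _ _ _ _ _ M) => //.
exact: measurable_funTS.
Qed.

Lemma leb_cc_lty (u v : R) : (leb `[u, v]%classic < +oo)%E.
Proof. by rewrite /leb lebesgue_measure_itv/=; case: ifP => // _; rewrite -EFinB ltry. Qed.

Lemma leb_oc_lty (u v : R) : (leb `]u, v]%classic < +oo)%E.
Proof. by rewrite /leb lebesgue_measure_itv/=; case: ifP => // _; rewrite -EFinB ltry. Qed.

Lemma Rintegral_near_cst (f : R -> R) (M c B u v : R) :
  measurable_fun setT f -> (forall w, `|f w| <= M) -> u <= v ->
  (forall w, u <= w <= v -> `|f w - c| <= B) ->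
  `|\int[leb]_(w in `]u, v]) f w - c * (v - u)| <= B * (v - u).
Proof.
move=> mf fM uv fB.
have fi : leb.-integrable `]u, v] (EFin \o f).
  by apply: (integrable_bounded_itv mf fM); exact: leb_oc_lty.
have ci r : leb.-integrable `]u, v] (EFin \o (fun=> r)).
  apply: (@integrable_bounded_itv _ `|r|) => //; exact: leb_oc_lty.
have cE r : \int[leb]_(w in `]u, v]) r = r * (v - u).
  by rewrite Rintegral_cst// [X in fine X](_ : _ = (v - u)%:E)//; exact: lebesgue_measure_oc.
rewrite -cE -RintegralB// -cE.
apply: (le_trans (le_normr_Rintegral _ _)) => //.
  exact: (integrableB _ fi (ci c)).
apply: le_Rintegral => //.
  have -> : EFin \o (fun t : R => `|f t - c|) = abse \o (EFin \o (fun t => f t - c)).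
    by apply/funext => t.
  by apply: integrable_abse; exact: (integrableB _ fi (ci c)).
by move=> w; rewrite /= in_itv/= => /andP[uw wv]; apply: fB; rewrite wv ltW.
Qed.

Definition prim (f : R -> R) (u : R) := \int[leb]_(w in `[0, u]) f w.

Lemma prim_sub (f : R -> R) (M u v : R) : measurable_fun setT f ->
  (forall w, `|f w| <= M) -> 0 <= u -> u <= v ->
  prim f v - prim f u = \int[leb]_(w in `]u, v]) f w.
Proof.
move=> mf fM u0 uv; apply: Rintegral_itvB.
- by apply: (integrable_bounded_itv mf fM); exact: leb_cc_lty.
- by rewrite bnd_simp.
- by rewrite bnd_simp.
Qed.

Lemma Rintegral_eq0 (f : R -> R) (D : set R) :
  (forall w, D w -> f w = 0) -> \int[leb]_(w in D) f w = 0.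
Proof. by move=> f0; rewrite /Rintegral integral0_eq// => w /f0 ->. Qed.

Lemma prim_cst0 (f : R -> R) (u : R) : (forall w, 0 <= w <= u -> f w = 0) -> prim f u = 0.
Proof.
by move=> f0; apply: Rintegral_eq0 => w; rewrite /= in_itv/=; exact: f0.
Qed.

Lemma prim_cst1 (f : R -> R) (M u v : R) : measurable_fun setT f ->
  (forall w, `|f w| <= M) -> 0 <= u -> u <= v ->
  (forall w, u < w <= v -> f w = 0) -> prim f v = prim f u.
Proof.
move=> mf fM u0 uv f0; apply/eqP; rewrite -subr_eq0; apply/eqP.
rewrite (prim_sub mf fM)//; apply: Rintegral_eq0 => w.
by rewrite /= in_itv/=; exact: f0.
Qed.

(** Replaces the Taylor bound of a smooth score: the first term is first order,
    but with a coefficient that tends to 0 with [k] where [f] is continuous; the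
    second is quadratic for each fixed [k]. *)
Lemma prim_remainder (f : R -> R) (M : R) (k : nat) (u v : R) :
  (forall w, `|f w| <= M) -> 0 <= u -> 0 <= v ->
  `|prim (uhull f) v - prim (uhull f) u - uhull f u * (v - u)| <=
   `|v - u| * osc_env f k u + k%:R * `|v - u| ^+ 2.
Proof.
move=> fM u0 v0.
have mf := measurable_uhull fM; have hM := norm_uhull_le fM.
have near B w : `|w - u| <= B ->
    `|uhull f w - uhull f u| <= osc_env f k u + k%:R * B.
  by move=> wu; rewrite (le_trans (uhull_osc fM k u w))// lerD2l ler_wpM2l.
have [uv|vu] := leP u v.
  rewrite (prim_sub mf hM)//.
  have H w : u <= w <= v -> `|w - u| <= v - u.
    by move=> /andP[uw wv]; rewrite ger0_norm ?subr_ge0// lerD2r.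
  have := Rintegral_near_cst mf hM uv (fun w uwv => near _ w (H w uwv)).
  move=> /le_trans; rewrite [`|v - u|]ger0_norm ?subr_ge0//; apply.
  by rewrite mulrDl expr2 mulrA [osc_env _ _ _ * _]mulrC.
have vu' := ltW vu.
have -> : prim (uhull f) v - prim (uhull f) u - uhull f u * (v - u) =
   - (prim (uhull f) u - prim (uhull f) v - uhull f u * (u - v)) by ring.
rewrite normrN (prim_sub mf hM)//.
have H w : v <= w <= u -> `|w - u| <= u - v.
  by move=> /andP[vw wu]; rewrite distrC ger0_norm ?subr_ge0// lerD2l lerN2.
have := Rintegral_near_cst mf hM vu' (fun w uwv => near _ w (H w uwv)).
move=> /le_trans; rewrite [`|v - u|]distrC [`|u - v|]ger0_norm ?subr_ge0//; apply.
by rewrite mulrDl expr2 mulrA [osc_env _ _ _ * _]mulrC.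
Qed.

End primitive.

(** * Fubini for bounded integrands *)

Section bounded_fubini.
Context d1 d2 (T1 : measurableType d1) (T2 : measurableType d2) (R : realType).
Variables (m1 : {sigma_finite_measure set T1 -> \bar R})
          (m2 : {sigma_finite_measure set T2 -> \bar R}).
Variables (D1 : set T1) (D2 : set T2) (M : R) (psi : T1 * T2 -> R).
Hypothesis mD1 : measurable D1.
Hypothesis mD2 : measurable D2.
Hypothesis D1oo : (m1 D1 < +oo)%E.
Hypothesis D2oo : (m2 D2 < +oo)%E.
Hypothesis mpsi : measurable_fun setT psi.
Hypothesis psiM : forall z, `|psi z| <= M * (\1_D1 z.1 * \1_D2 z.2).

Let psi_integrable : (m1 \x m2)%E.-integrable setT (EFin \o psi).
Proof.
apply/integrableP; split; first exact/measurable_EFinP.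
apply: (@le_lt_trans _ _ (\int[(m1 \x m2)%E]_z (`|M| * \1_(D1 `*` D2) z)%:E)%E).
  apply: ge0_le_integral => //.
  - by apply/measurable_EFinP; apply: measurableT_comp.
  - apply/measurable_EFinP; apply: measurable_funM => //.
    by apply: measurable_indic; exact: measurableX.
  move=> z _ /=; rewrite lee_fin (le_trans (psiM z))//.
  have -> : \1_D1 z.1 * \1_D2 z.2 = \1_(D1 `*` D2) z :> R.
    rewrite !indicE in_setX; case: (_ \in _); case: (_ \in _); rewrite ?mulr1 ?mulr0//.
  by rewrite ler_wpM2r// ler_norm.
rewrite (eq_integral (fun z => `|M|%:E * (\1_(D1 `*` D2) z)%:E)%E)//.
rewrite ge0_integralZl//; last first.
  by apply/measurable_EFinP; apply: measurable_indic; exact: measurableX.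
rewrite integral_indic// ?setIT; last exact: measurableX.
rewrite [X in (_ * X < _)%E](_ : _ = (m1 D1 * m2 D2)%E); last exact: product_measure1E.
by rewrite !lte_mul_pinfty// ?mule_ge0// ge0_fin_numE.
Qed.

Let section_integrable d (T : measurableType d)
    (m : {sigma_finite_measure set T -> \bar R}) (D : set T) (f : T -> R) :
  measurable D -> (m D < +oo)%E -> measurable_fun setT f ->
  (forall y, `|f y| <= `|M| * \1_D y) -> m.-integrable setT (EFin \o f).
Proof.
move=> mD Doo mf fD.
have fD' y : `|f y| <= `|M|.
  by rewrite (le_trans (fD y))// ler_piMr// indicE; case: (_ \in _).
have h : m.-integrable D (EFin \o f).
  by apply: (@integrable_le_cst _ _ _ _ _ _ `|M|) => //; exact: measurable_funTS.
have -> : EFin \o f = (EFin \o f) \_ D.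
  apply/funext => y; rewrite patchE; case: ifPn => // yD.
  have := fD y; rewrite indicE (negbTE yD) mulr0 normr_le0 => /eqP fy0.
  by rewrite /= fy0.
by apply/(integrable_mkcond _ mD).
Qed.

Let psi1 x y : `|psi (x, y)| <= `|M| * \1_D1 x.
Proof.
rewrite (le_trans (psiM _))//= !indicE.
case: (_ \in _); case: (_ \in _); rewrite ?(mulr1, mulr0, normr_ge0)//.
exact: ler_norm.
Qed.

Let psi2 x y : `|psi (x, y)| <= `|M| * \1_D2 y.
Proof.
rewrite (le_trans (psiM _))//= !indicE.
case: (_ \in _); case: (_ \in _); rewrite ?(mulr1, mulr0, normr_ge0)//.
exact: ler_norm.
Qed.

Lemma Rintegral_prod :
  \int[(m1 \x m2)%E]_z psi z = \int[m1]_x \int[m2]_y psi (x, y).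
Proof.
rewrite /Rintegral -(integral12_prod_meas1 psi_integrable); congr fine.
apply: eq_integral => x _; rewrite /fubini_F fineK//.
apply: integrable_fin_num => //.
apply: (section_integrable mD2 D2oo _ (psi2 x)).
by apply: (measurableT_comp mpsi); exact: pair1_measurable.
Qed.

Lemma Rintegral_prod_swap :
  \int[(m1 \x m2)%E]_z psi z = \int[m2]_y \int[m1]_x psi (x, y).
Proof.
rewrite /Rintegral -(integral21_prod_meas1 psi_integrable); congr fine.
apply: eq_integral => y _; rewrite /fubini_G fineK//.
apply: integrable_fin_num => //.
apply: (section_integrable mD1 D1oo _ (psi1 ^~ y)).
by apply: (measurableT_comp mpsi); exact: pair2_measurable.
Qed.

End bounded_fubini.

(** * Order statistics and summation by parts *)

Section order_statistics.
Context {R : realType}.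

Lemma nth_sorted_le_count (s : seq R) (i : nat) (x : R) :
  sorted <=%R s -> (i < size s)%N ->
  (s`_i <= x) = (i < count (fun z => (z <= x)%R) s)%N.
Proof.
elim: s i => [//|a s IH] i /= pas.
have ss := path_sorted pas.
have [ax|xa] := leP a x.
  case: i => [_|i]; first by rewrite /= ax.
  by rewrite /= ltnS => si; rewrite IH.
have all_gt z : z \in s -> x < z.
  move=> zs; apply: (lt_le_trans xa).
  by have := order_path_min le_trans pas => /allP /(_ z zs).
have -> : count (fun z => (z <= x)%R) s = 0%N.
  apply/eqP; rewrite -leqn0 leqNgt -has_count; apply/hasPn => z /all_gt.
  by rewrite -ltNge.
rewrite addn0 ltn0 => si; apply/negbTE; rewrite -ltNge.
case: i si => [//|i]; rewrite ltnS => si /=; apply: all_gt.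
exact: mem_nth.
Qed.

Variables (T : Type) (Xs : nat -> T -> R).

(** The empirical distribution function at [x], times [n]. *)
Definition edf_count (n : nat) (w : T) (x : R) : nat :=
  count (fun z => (z <= x)%R) (mkseq (fun k => Xs k w) n).

(** The Galois connection between order statistics and the empirical
    distribution function. *)
Lemma order_stat_le (n i : nat) (w : T) (x : R) : (i < n)%N ->
  (order_stat Xs n i w <= x) = (i < edf_count n w x)%N.
Proof.
move=> ni; rewrite /order_stat /edf_count.
rewrite nth_sorted_le_count ?size_sort ?size_mkseq//.
  by rewrite (permP (permEl (perm_sort _ _))).
exact: (sort_sorted (@le_total _ R)).
Qed.

Lemma edf_countE (n : nat) (w : T) (x : R) :
  (edf_count n w x)%:R = \sum_(i < n) (Xs i w <= x)%R%:R :> R.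
Proof.
rewrite /edf_count /mkseq count_map -sum1_count big_mkcond/=.
rewrite -{1}(subn0 n) -/(index_iota 0 n) big_mkord natr_sum.
by apply: eq_bigr => i _; case: ifP.
Qed.

Lemma edf_count_le (n : nat) (w : T) (x : R) : (edf_count n w x <= n)%N.
Proof. by rewrite /edf_count (leq_trans (count_size _ _))// size_mkseq. Qed.

End order_statistics.

Lemma Rintegral_sum d (T : measurableType d) (R : realType)
    (mu : {measure set T -> \bar R}) (D : set T) (I : Type) (s : seq I)
    (f : I -> T -> R) :
  measurable D -> (forall i, mu.-integrable D (EFin \o f i)) ->
  \int[mu]_(x in D) (\sum_(i <- s) f i x) = \sum_(i <- s) \int[mu]_(x in D) f i x.
Proof.
move=> mD fi; elim: s => [|i s IH].
  by rewrite big_nil /Rintegral integral0_eq// => x _; rewrite big_nil.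
have isum : mu.-integrable D (EFin \o (fun x => \sum_(i <- s) f i x)).
  elim: s {IH} => [|j s IH].
    under eq_fun do rewrite big_nil; exact: integrable0.
  rewrite (_ : (fun x => \sum_(i <- j :: s) f i x) =
      (fun x => f j x + \sum_(i <- s) f i x)); last first.
      by apply/funext => x; rewrite big_cons.
    have h := integrableD mD (fi j) IH.
    by apply: eq_integrable h.
rewrite big_cons -IH -RintegralD//.
by apply: eq_Rintegral => x _; rewrite big_cons.
Qed.

Section Lstat_representation.
Context {R : realType}.
Let leb := @lebesgue_measure R.

Lemma Rintegral_step (A B c : R) : A <= c -> c <= B ->
  \int[leb]_(x in `[A, B]) (c <= x)%R%:R = B - c.
Proof.
move=> Ac cB.
rewrite (_ : (fun x => (c <= x)%R%:R) = \1_(`[c, +oo[%classic : set R)); last first.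
  by apply/funext => x; rewrite indicE mem_setE in_itv/= andbT.
rewrite /Rintegral integral_indic//.
have -> : `[c, +oo[%classic `&` `[A, B]%classic = `[c, B]%classic :> set R.
  apply/seteqP; split => x /=; rewrite !in_itv/= andbT.
    by case=> -> /andP[_ ->].
  by move=> /andP[cx ->]; rewrite cx (le_trans Ac).
by rewrite [X in fine X](_ : _ = (B - c)%:E)//; exact: lebesgue_measure_cc.
Qed.

Lemma sum_telescope_lt (n N : nat) (kap : nat -> R) : (N <= n)%N ->
  \sum_(i < n) (kap i.+1 - kap i) * (i < N)%N%:R = kap N - kap 0%N.
Proof.
move=> Nn; rewrite -(big_mkord xpredT (fun i => (kap i.+1 - kap i) * (i < N)%N%:R)).
rewrite (@big_cat_nat _ _ _ N)//= -telescope_sumr// [X in _ + X]big1_seq ?addr0.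
  by rewrite !big_nat; apply: eq_bigr => i /andP[_ iN]; rewrite iN mulr1.
move=> i /=; rewrite mem_index_iota => /andP[Ni _].
by rewrite ltnNge Ni mulr0.
Qed.

(** Summation by parts.  An order statistic in [A, B] is [B] minus the integral
    over [A, B] of the indicator that it is at most [x]; for a fixed [x] the
    increments of [kap] weighted by these indicators telescope. *)
Lemma sum_order_stat (T : Type) (Xs : nat -> T -> R) (n : nat) (w : T)
    (kap : nat -> R) (A B : R) : A <= B ->
  (forall i, (i < n)%N -> kap i.+1 - kap i != 0 ->
     A <= order_stat Xs n i w <= B) ->
  \sum_(i < n) order_stat Xs n i w * (kap i.+1 - kap i) =
  B * (kap n - kap 0%N) -
  \int[leb]_(x in `[A, B]) (kap (edf_count Xs n w x) - kap 0%N).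
Proof.
move=> AB H.
have si0 (c : R) : leb.-integrable `[A, B] (EFin \o (fun x => (c <= x)%R%:R)).
  apply: (@integrable_bounded_itv _ _ 1); last exact: leb_cc_lty.
    exact: measurable_indic_le.
  by move=> x; case: (c <= x); rewrite ?normr1 ?normr0.
have si (c : R) (k : R) : leb.-integrable `[A, B] (EFin \o (fun x => k * (c <= x)%R%:R)).
  exact: (integrableZl _ k (si0 c)).
transitivity (\sum_(i < n) (B * (kap i.+1 - kap i) -
   \int[leb]_(x in `[A, B]) ((kap i.+1 - kap i) * (order_stat Xs n i w <= x)%R%:R))).
  apply: eq_bigr => i _.
  have [k0|k0] := eqVneq (kap i.+1 - kap i) 0.
    rewrite k0 !mulr0 Rintegral_eq0 ?subr0// => x _; exact: mul0r.
  have /andP[h1 h2] := H i (ltn_ord i) k0.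
  rewrite RintegralZl//.
  by rewrite Rintegral_step//; ring.
rewrite sumrB -big_distrr/= -Rintegral_sum//.
congr (_ * _ - _).
  by rewrite -(big_mkord xpredT (fun i => kap i.+1 - kap i)) telescope_sumr.
apply: eq_Rintegral => x _.
rewrite -(sum_telescope_lt kap (edf_count_le Xs n w x)).
by apply: eq_bigr => i _; rewrite order_stat_le.
Qed.

End Lstat_representation.

(** * Distribution and quantile functions *)

Section measure_on_rays.
Context {R : realType}.

(** The closed ([b = true]) and the open ([b = false]) half-lines that are
    unbounded above are stable under intersection and generate the Borel sets. *)
Lemma measure_eq_rays (b : bool) (m1 m2 : {measure set (measurableTypeR R) -> \bar R}) :
  (forall x : R, m1 [set` Interval (BSide b x) +oo%O] =
                 m2 [set` Interval (BSide b x) +oo%O]) ->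
  (forall x : R, (m1 [set` Interval (BSide b x) +oo%O] < +oo)%E) ->
  forall A : set (measurableTypeR R), measurable A -> m1 A = m2 A.
Proof.
move=> m12 m1oo A mA.
apply: (@measure_unique _ R (measurableTypeR R)
  [set A | exists x : R, A = [set` Interval (BSide b x) +oo%O]]
  (fun k => [set` Interval (BSide b (- k%:R)) +oo%O])) => //.
- by case: b {m12 m1oo}; [exact: RGenCInfty.measurableE|exact: RGenOInfty.measurableE].
- move=> _ _ [x ->] [y ->]; exists (Num.max x y).
  apply/seteqP; split => z; case: b {m12 m1oo}; rewrite /= !in_itv/= !andbT ?(ge_max, gt_max).
  + by move=> [-> ->].
  + by move=> [-> ->].
  + by move=> /andP[].
  + by move=> /andP[].
- by move=> k; exists (- k%:R).
- apply/seteqP; split => // x _.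
  have xk : - (Num.bound `|x|)%:R < x.
    by rewrite ltrNl (le_lt_trans _ (archi_boundP (normr_ge0 x)))// ler_normr lexx orbT.
  by exists (Num.bound `|x|) => //; case: b {m12 m1oo}; rewrite /= in_itv/= andbT ?ltW.
- by move=> _ [x ->].
Qed.

End measure_on_rays.

Section distribution_function.
Context d (T : measurableType d) (R : realType) (P : probability T R).
Variable X : {RV P >-> R}.
Let F := distr_fun X.
Let leb := @lebesgue_measure R.

Lemma distr_funE (x : R) : ((F x)%:E = P [set w | (X w <= x)%R])%E.
Proof.
rewrite /F /distr_fun fineK; last by rewrite ge0_fin_numE ?cdf_ge0// (le_lt_trans (cdf_le1 _ _)) ?ltry.
congr (P _); apply/seteqP; split => w /=; rewrite in_itv//=.
Qed.

Lemma distr_fun_itv (x : R) : 0 <= F x <= 1.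
Proof.
rewrite /F /distr_fun fine_ge0 ?cdf_ge0//= -lee_fin fineK ?cdf_le1//.
by rewrite ge0_fin_numE ?cdf_ge0// (le_lt_trans (cdf_le1 _ _)) ?ltry.
Qed.

Lemma distr_fun_nd : {homo F : x y / x <= y}.
Proof.
move=> x y xy; rewrite /F /distr_fun; apply: fine_le; last exact: cdf_nondecreasing.
- by rewrite ge0_fin_numE ?cdf_ge0// (le_lt_trans (cdf_le1 _ _)) ?ltry.
- by rewrite ge0_fin_numE ?cdf_ge0// (le_lt_trans (cdf_le1 _ _)) ?ltry.
Qed.

Lemma measurable_distr_fun : measurable_fun setT F.
Proof. by apply: nondecreasing_measurable => //; exact: distr_fun_nd. Qed.

Let Ffin x : cdf X x \is a fin_num.
Proof. by rewrite ge0_fin_numE ?cdf_ge0// (le_lt_trans (cdf_le1 _ _)) ?ltry. Qed.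

Lemma distr_fun_near_Ny (t : R) : 0 < t -> exists A, F A < t.
Proof.
move=> t0; have h : F @ -oo --> (0 : R) by exact/fine_cvg/cvg_cdfNy0.
have : \forall x \near -oo, F x < t by apply: cvgr_lt h _ t0.
by move=> /filter_ex.
Qed.

Lemma distr_fun_near_y (t : R) : t < 1 -> exists B, t < F B.
Proof.
move=> t0; have h : F @ +oo --> (1 : R) by exact/fine_cvg/cvg_cdfy1.
have : \forall x \near +oo, t < F x by apply: cvgr_gt h _ t0.
by move=> /filter_ex.
Qed.

Lemma distr_fun_right (x s : R) : (forall e, 0 < e -> s <= F (x + e)) -> s <= F x.
Proof.
move=> h; have rc : F @ x^'+ --> F x.
  by apply: fine_cvg; rewrite fineK//; exact: cdf_right_continuous.
rewrite -(cvg_lim _ rc)//; apply: limr_ge; first exact/cvgP/rc.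
near=> y; have xy : x < y by near: y; exact: nbhs_right_gt.
by have := h (y - x); rewrite subr_gt0 addrC subrK; apply.
Unshelve. all: by end_near. Qed.

(** Right-continuity of the distribution function puts the infimum that defines
    the quantile in the set itself, whence this Galois connection. *)
Lemma quantile_le (s x : R) : 0 < s -> s < 1 -> (quantile F s <= x) = (s <= F x).
Proof.
move=> s0 s1.
have [A FA] := distr_fun_near_Ny s0; have [B FB] := distr_fun_near_y s1.
have lbA : lbound [set x | s <= F x] A.
  move=> y /= sy; rewrite leNgt; apply/negP => /ltW /distr_fun_nd yA.
  by have := lt_le_trans FA (le_trans sy yA); rewrite ltxx.
have hinf : has_inf [set x | s <= F x].
  by split; [exists B => /=; exact: ltW|exists A].
apply/idP/idP => [qx|sx]; last by apply: ge_inf => //; exists A.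
apply: distr_fun_right => e e0.
have [y /= sy yx] : exists2 y, s <= F y & y < x + e.
  have [y sy yq] := inf_adherent e0 hinf.
  by exists y => //; rewrite (lt_le_trans yq)// lerD2r.
by rewrite (le_trans sy)// distr_fun_nd// ltW.
Qed.

Lemma quantile_nd (s t : R) : 0 < s -> s <= t -> t < 1 -> quantile F s <= quantile F t.
Proof.
move=> s0 st t1; rewrite quantile_le//; last exact: le_lt_trans t1.
by rewrite (le_trans st)// -quantile_le// (lt_le_trans s0).
Qed.

(** The Stieltjes measure of the quantile function is the image of Lebesgue
    measure under the distribution function. *)
Lemma preimage_distr_fun_co (a b : R) : 0 < a -> a <= b -> b < 1 ->
  leb (F @^-1` `[a, b[%classic) = (quantile F b - quantile F a)%:E.
Proof.
move=> a0 ab b1.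
have a1 : a < 1 by apply: le_lt_trans b1.
have b0 : 0 < b by apply: lt_le_trans ab.
have -> : F @^-1` `[a, b[%classic = `[quantile F a, quantile F b[%classic.
  apply/seteqP; split => x /=; rewrite !in_itv/= quantile_le//.
    by move=> /andP[-> Fb]; rewrite ltNge quantile_le// -ltNge.
  by move=> /andP[-> ]; rewrite ltNge quantile_le// -ltNge.
rewrite /leb lebesgue_measure_itv/= lte_fin.
have := quantile_nd a0 ab b1; rewrite le_eqVlt => /orP[/eqP->|->].
  by rewrite ltxx subrr.
by rewrite EFinB.
Qed.

(** Turns continuity almost everywhere for the measure induced by the quantile
    function into continuity at [F x] for Lebesgue almost every [x].  The measure
    [nu] of the hypothesis is known only on half-open intervals inside the open
    unit interval; it is compared with the image of Lebesgue measure on an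
    exhausting sequence [I] of such intervals. *)
Lemma stieltjes01_null_preimage (D : set R) : D `<=` `]0, 1[%classic ->
  stieltjes01_null (quantile F) D ->
  exists N : set R, [/\ measurable N, D `<=` N & leb (F @^-1` (N `&` `]0, 1[%classic)) = 0%E].
Proof.
move=> D01 [nu nuE [N [mN N0 DN]]].
exists N; split => //.
pose I k := `[k.+2%:R^-1 : R, 1 - k.+2%:R^-1[%classic.
have mI k : measurable (I k : set (measurableTypeR R)) by exact: measurable_itv.
have mF : measurable_fun [set: measurableTypeR R] (F : measurableTypeR R -> measurableTypeR R).
  exact: measurable_distr_fun.
have k2 k : (0 < k.+2%:R^-1 :> R) /\ (k.+2%:R^-1 <= 1 - k.+2%:R^-1 :> R).
  split; first by rewrite invr_gt0.
  have : (k.+2%:R^-1 : R) <= 2^-1 by rewrite lef_pV2 ?posrE// ler_nat.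
  by move: (k.+2%:R^-1) => r; lra.
have eqI k (A : set (measurableTypeR R)) : measurable A ->
    nu (A `&` I k) = leb (F @^-1` (A `&` I k)).
  have [k0 k1] := k2 k.
  pose m1 : {measure set (measurableTypeR R) -> \bar R} := mrestr nu (mI k).
  pose m2 : {measure set (measurableTypeR R) -> \bar R} :=
    mrestr (measure_function_pushforward__canonical__measure_function_Measure leb mF) (mI k).
  have agree (y q : R) : 0 < y -> q < 1 ->
      nu `[y, q[%classic = leb (F @^-1` `[y, q[%classic) /\ (nu `[y, q[%classic < +oo)%E.
    move=> y0 q1; have [yq|qy] := leP y q.
      by rewrite preimage_distr_fun_co// nuE// ltry.
    by rewrite set_itv_ge ?preimage_set0 ?measure0// -leNgt bnd_simp ltW.
  have ray (x : R) : `[x, +oo[%classic `&` I k = `[Num.max x k.+2%:R^-1, 1 - k.+2%:R^-1[%classic.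
    rewrite /I; apply/seteqP; split => z /=; rewrite !in_itv/= andbT ge_max.
      by move=> [-> /andP[-> ->]].
    by move=> /andP[/andP[-> ->] ->].
  have pos (x : R) : 0 < Num.max x k.+2%:R^-1 by rewrite lt_max k0 orbT.
  have q1 : 1 - k.+2%:R^-1 < 1 :> R by rewrite ltrBlDr ltrDl.
  apply: (measure_eq_rays (b := true) (m1 := m1) (m2 := m2)) => x.
    by rewrite /m1 /m2 /= /mrestr /pushforward/= ray; have [] := agree _ _ (pos x) q1.
  by rewrite /m1 /= /mrestr ray; have [] := agree _ _ (pos x) q1.
have mpre (A : set (measurableTypeR R)) : measurable A ->
    measurable (F @^-1` A : set (measurableTypeR R)).
  by move=> mA; rewrite -[X in measurable X]setTI; exact: mF.
have nullk k : leb (F @^-1` (N `&` I k)) = 0%E.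
  rewrite -eqI//; apply/eqP; rewrite eq_le measure_ge0 andbT.
  rewrite -N0; apply: le_measure; rewrite ?inE//; exact: measurableI.
have -> : N `&` `]0, 1[%classic = \bigcup_k (N `&` I k).
  rewrite -setI_bigcupr; congr (_ `&` _); apply/seteqP; split => y /=.
    rewrite in_itv/= => /andP[y0 y1].
    have y1' : 0 < 1 - y by rewrite subr_gt0.
    pose k := Num.bound (y^-1 + (1 - y)^-1).
    have kb : y^-1 + (1 - y)^-1 < k.+2%:R.
      have h : 0 <= y^-1 + (1 - y)^-1 by rewrite addr_ge0// invr_ge0 ltW.
      by rewrite (lt_trans (archi_boundP h))// ltr_nat.
    have yi : 0 < y^-1 by rewrite invr_gt0.
    have yi' : 0 < (1 - y)^-1 by rewrite invr_gt0.
    exists k => //=; rewrite /I /= in_itv/=.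
    have kp : 0 < k.+2%:R :> R by rewrite ltr0n.
    apply/andP; split.
      by rewrite -[y]invrK lef_pV2 ?posrE//; move: (k.+2%:R) kb => r; lra.
    suff : k.+2%:R^-1 < 1 - y by move: (k.+2%:R^-1) => r; lra.
    by rewrite -[1 - y]invrK ltf_pV2 ?posrE//; move: (k.+2%:R) kb => r; lra.
  move=> [k _]; rewrite /I /= !in_itv/= => /andP[ky yk].
  have [k0 k1] := k2 k; rewrite (lt_le_trans k0 ky)/=.
  by move: (k.+2%:R^-1) k0 yk => r; lra.
rewrite preimage_bigcup.
have mU : measurable (\bigcup_i F @^-1` (N `&` I i) : set (measurableTypeR R)).
  by apply: bigcupT_measurable => k; apply: mpre; exact: measurableI.
have ng : leb.-negligible (\bigcup_i F @^-1` (N `&` I i)).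
  apply: negligible_bigcup => k; apply/negligibleP => //.
  by apply: mpre; exact: measurableI.
by move/negligibleP : ng; exact.
Qed.

End distribution_function.

(** * The quantile form of the centring *)

Section swap_on.
Context d1 d2 (T1 : measurableType d1) (T2 : measurableType d2) (R : realType).
Variables (m1 : {sigma_finite_measure set T1 -> \bar R})
          (m2 : {sigma_finite_measure set T2 -> \bar R}).

Lemma Rintegral_indic_mul d (T : measurableType d) (m : {measure set T -> \bar R})
    (D : set T) (f : T -> R) :
  \int[m]_(x in D) f x = \int[m]_x (f x * \1_D x).
Proof.
rewrite Rintegral_mkcond; apply: eq_Rintegral => x _.
by rewrite patchE indicE; case: ifP; rewrite ?mulr1 ?mulr0.
Qed.

Lemma Rintegral_swap_on (D1 : set T1) (D2 : set T2) (M : R) (psi : T1 * T2 -> R) :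
  measurable D1 -> measurable D2 -> (m1 D1 < +oo)%E -> (m2 D2 < +oo)%E ->
  measurable_fun setT psi -> (forall z, `|psi z| <= M) ->
  \int[m1]_(x in D1) \int[m2]_(y in D2) psi (x, y) =
  \int[m2]_(y in D2) \int[m1]_(x in D1) psi (x, y).
Proof.
move=> mD1 mD2 D1oo D2oo mpsi psiM.
pose psi' z := psi z * (\1_D1 z.1 * \1_D2 z.2).
have mi : measurable_fun setT (fun z : T1 * T2 => \1_D1 z.1 * \1_D2 z.2 : R).
  apply: measurable_funM.
    exact: (measurableT_comp (measurable_indic mD1) measurable_fst).
  exact: (measurableT_comp (measurable_indic mD2) measurable_snd).
have mpsi' : measurable_fun setT psi' by exact: measurable_funM.
have psiM' z : `|psi' z| <= M * (\1_D1 z.1 * \1_D2 z.2).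
  rewrite /psi' normrM [X in _ * X]ger0_norm ?mulr_ge0//.
  by rewrite ler_wpM2r// mulr_ge0.
have P1 := Rintegral_prod mD1 mD2 D1oo D2oo mpsi' psiM'.
have P2 := Rintegral_prod_swap mD1 mD2 D1oo D2oo mpsi' psiM'.
transitivity (\int[m1]_x \int[m2]_y psi' (x, y)).
  rewrite Rintegral_indic_mul; apply: eq_Rintegral => x _.
  rewrite Rintegral_indic_mul /psi'/= indicE; case: (x \in D1).
    by rewrite mulr1; apply: eq_Rintegral => y _; rewrite mul1r.
  rewrite mulr0 /Rintegral integral0_eq// => y _.
  by rewrite mul0r mulr0.
rewrite -P1 P2 [RHS]Rintegral_indic_mul; apply: eq_Rintegral => y _.
rewrite [in RHS]Rintegral_indic_mul /psi'/= [in RHS]indicE; case: (boolP (y \in D2)) => yD.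
  by rewrite mulr1; apply: eq_Rintegral => x _; rewrite [\1_D2 y]indicE yD mulr1.
rewrite mulr0 /Rintegral integral0_eq// => x _.
by rewrite [\1_D2 y]indicE (negbTE yD) !mulr0.
Qed.

Lemma measurable_Rintegral_snd (D2 : set T2) (M : R) (psi : T1 * T2 -> R) :
  measurable D2 -> (m2 D2 < +oo)%E ->
  measurable_fun setT psi -> (forall z, `|psi z| <= M) ->
  measurable_fun setT (fun x => \int[m2]_(y in D2) psi (x, y)).
Proof.
move=> mD2 D2oo mpsi psiM.
(* shifted by M the integrand is nonnegative, which brings it under Tonelli's theorem *)
pose psi' z := (psi z + M) * \1_D2 z.2.
have mpsi' : measurable_fun setT psi'.
  apply: measurable_funM; first exact: measurable_funD.
  exact: (measurableT_comp (measurable_indic mD2) measurable_snd).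
have psi'0 z : 0 <= psi' z.
  rewrite mulr_ge0//; have := psiM z; rewrite ler_norml => /andP[h _].
  by rewrite -lerBlDr sub0r.
rewrite (_ : (fun x => _) = (fun x => fine (\int[m2]_y (psi' (x, y))%:E)%E - M * fine (m2 D2))).
  apply: measurable_funB => //; apply: measurableT_comp; first exact: fine_measurable.
  exact: (measurable_integral_snd m2 mpsi' psi'0).
apply/funext => x.
rewrite -/(Rintegral _ _ _) -(Rintegral_indic_mul m2 D2 (fun y => psi (x, y) + M)).
have mx : measurable_fun setT (fun y => psi (x, y)).
  by apply: (measurableT_comp mpsi); exact: pair1_measurable.
rewrite RintegralD//.
- by rewrite Rintegral_cst// addrK.
- by apply: (integrable_le_cst (M := M)) => //; exact: measurable_funTS.
- exact: (integrable_le_cst (M := `|M|)).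
Qed.

End swap_on.

Section primitive_regularity.
Context {R : realType}.
Let leb := @lebesgue_measure R.
Variables (f : R -> R) (M : R).
Hypothesis mf : measurable_fun setT f.
Hypothesis fM : forall w, `|f w| <= M.

Lemma prim_lt0 (u : R) : u <= 0 -> prim f u = 0.
Proof.
rewrite le_eqVlt => /orP[/eqP->|u0]; rewrite /prim.
  by rewrite set_itv1 Rintegral_set1.
by rewrite set_itv_ge ?Rintegral_set0// bnd_simp -ltNge.
Qed.

Lemma prim_lipschitz (u v : R) : u <= v -> `|prim f v - prim f u| <= M * (v - u).
Proof.
have M0 : 0 <= M by apply: le_trans (fM 0).
have pos (x y : R) : 0 <= x -> x <= y -> `|prim f y - prim f x| <= M * (y - x).
  move=> x0 xy; rewrite (prim_sub mf fM)//.
  have := @Rintegral_near_cst _ f M 0 M x y mf fM xy.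
  by rewrite mul0r subr0; apply => w _; rewrite subr0.
move=> uv; have [u0|u0] := leP 0 u; first exact: pos.
have [v0|v0] := leP 0 v; last first.
  rewrite (prim_lt0 (ltW u0)) (prim_lt0 (ltW v0)) subrr normr0.
  by rewrite mulr_ge0// subr_ge0.
rewrite (prim_lt0 (ltW u0)) -(prim_lt0 (lexx 0)).
by rewrite (le_trans (pos 0 v (lexx _) v0))// ler_wpM2l// lerD2l lerN2 ltW.
Qed.

Lemma prim_continuous : continuous (prim f).
Proof.
have M0 : 0 <= M by apply: le_trans (fM 0).
have lip (u v : R) : `|prim f u - prim f v| <= M * `|u - v|.
  have [uv|vu] := leP u v.
    by rewrite distrC [`|u - v|]distrC [`|v - u|]ger0_norm ?subr_ge0// prim_lipschitz.
  rewrite [`|u - v|]ger0_norm; last by rewrite subr_ge0 ltW.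
  exact: prim_lipschitz (ltW vu).
move=> u; apply/cvgrPdist_le => e e0.
have M10 : 0 < M + 1 by rewrite ltr_wpDl.
near=> v; rewrite (le_trans (lip _ _))//.
have uv : `|u - v| <= e / (M + 1).
  near: v; apply/nbhs_ballP; exists (e / (M + 1)) => /=; first by rewrite divr_gt0.
  by move=> v; rewrite /ball/=; exact: ltW.
rewrite ler_pdivlMr// in uv; have := normr_ge0 (u - v); nra.
Unshelve. all: by end_near. Qed.

Lemma measurable_prim : measurable_fun setT (prim f).
Proof. apply: continuous_measurable_fun; exact: prim_continuous. Qed.

Lemma norm_prim_le (u : R) : u <= 1 -> `|prim f u| <= M.
Proof.
have M0 : 0 <= M by apply: le_trans (fM 0).
move=> u1; have [u0|/ltW u0] := leP 0 u; last by rewrite prim_lt0// normr0.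
rewrite -[prim f u]subr0 -(prim_lt0 (lexx 0)) (le_trans (prim_lipschitz u0))//.
by rewrite subr0 ler_piMr.
Qed.

Lemma prim_indic (u : R) : u <= 1 ->
  prim f u = \int[leb]_(s in `[0, 1]) (f s * (s <= u)%R%:R).
Proof.
move=> u1; rewrite /prim.
have -> : `[0, u]%classic = `[0, 1]%classic `&` `]-oo, u]%classic :> set R.
  apply/seteqP; split => s /=; rewrite !in_itv/=.
    by move=> /andP[-> su]; rewrite su (le_trans su).
  by move=> [/andP[-> _] ->].
rewrite Rintegral_mkcondr; apply: eq_Rintegral => s _.
by rewrite patchE mem_setE in_itv/=; case: ifP; rewrite ?mulr1 ?mulr0.
Qed.

End primitive_regularity.

Section quantile_representation.
Context d (T : measurableType d) (R : realType) (P : probability T R).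
Variable X : {RV P >-> R}.
Let F := distr_fun X.
Let leb := @lebesgue_measure R.
Variables (g : R -> R) (M t1 t2 A B : R).
Hypothesis mg : measurable_fun setT g.
Hypothesis gM : forall w, `|g w| <= M.
Hypothesis g_trim : forall s, s < t1 \/ t2 < s -> g s = 0.
Hypothesis FA : F A < t1.
Hypothesis FB : t2 < F B.
Hypothesis AB : A <= B.

Let M0 : 0 <= M. Proof. by apply: le_trans (gM 0). Qed.

(** The analogue of the summation by parts over order statistics, with the
    quantile function in place of the sample: where [g] does not vanish, the
    quantile lies in [A, B]. *)
Lemma quantile_representation :
  \int[leb]_(s in `]0, 1[) (quantile F s * g s) =
  B * prim g 1 - \int[leb]_(x in `[A, B]) prim g (F x).
Proof.
pose psi (z : R * R) := g z.1 * (z.1 <= F z.2)%R%:R.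
have mpsi : measurable_fun setT psi.
  apply: measurable_funM; first exact: (measurableT_comp mg measurable_fst).
  apply: measurable_indic_le; first exact: measurable_fst.
  exact: (measurableT_comp (measurable_distr_fun X) measurable_snd).
have psiM z : `|psi z| <= M.
  by rewrite /psi; case: (z.1 <= F z.2); rewrite /= ?mulr1 ?mulr0 ?normr0.
pose G s := B * g s - \int[leb]_(x in `[A, B]) psi (s, x).
transitivity (\int[leb]_(s in `]0, 1[) G s).
  apply: eq_Rintegral => s; rewrite inE/= in_itv/= => /andP[s0 s1].
  rewrite /G; have [gs|gs] := eqVneq (g s) 0.
    rewrite gs !mulr0 Rintegral_eq0 ?subr0// => x _.
    by rewrite /psi/= gs mul0r.
  have s1' : t1 <= s by rewrite leNgt; apply/negP => h; rewrite g_trim ?eqxx// in gs; left.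
  have s2' : s <= t2 by rewrite leNgt; apply/negP => h; rewrite g_trim ?eqxx// in gs; right.
  have AQ : A <= quantile F s.
    rewrite leNgt; apply/negP => /ltW; rewrite quantile_le// => sA.
    by have := lt_le_trans FA (le_trans s1' sA); rewrite ltxx.
  have QB : quantile F s <= B by rewrite quantile_le// (le_trans s2')// ltW.
  have -> : \int[leb]_(x in `[A, B]) psi (s, x) =
      \int[leb]_(x in `[A, B]) (g s * (quantile F s <= x)%R%:R).
    by apply: eq_Rintegral => x _; rewrite /psi/= quantile_le.
  rewrite RintegralZl//; last first.
    apply: (@integrable_bounded_itv _ _ 1); last exact: leb_cc_lty.
      exact: measurable_indic_le.
    by move=> x; case: (quantile F s <= x); rewrite ?normr1 ?normr0.
  by rewrite Rintegral_step//; ring.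
have gi (i : interval R) : (leb [set` i] < +oo)%E -> leb.-integrable [set` i] (EFin \o g).
  exact: (integrable_bounded_itv mg gM).
have mI : measurable_fun setT (fun s => \int[leb]_(x in `[A, B]) psi (s, x)).
  apply: (@measurable_Rintegral_snd _ _ _ _ R leb `[A, B]%classic M psi) => //.
  exact: leb_cc_lty.
have IM s : `|\int[leb]_(x in `[A, B]) psi (s, x)| <= M * (B - A).
  have -> : B - A = fine (leb `[A, B]%classic) by rewrite /leb lebesgue_measure_cc.
  apply: norm_Rintegral_le => //; first exact: leb_cc_lty.
  apply: measurable_funTS; apply: (measurableT_comp mpsi); exact: pair1_measurable.
have mG : measurable_fun setT G.
  by apply: measurable_funB => //; exact: measurable_funM.
have GM s : `|G s| <= `|B| * M + M * (B - A).
  rewrite (le_trans (ler_normB _ _))// lerD// normrM.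
  by rewrite ler_wpM2l.
have Gi (i : interval R) : (leb [set` i] < +oo)%E -> leb.-integrable [set` i] (EFin \o G).
  exact: (integrable_bounded_itv mG GM).
have l01 (b c : bool) : (leb [set` Interval (BSide b 0%R) (BSide c 1%R)] < +oo)%E.
  by rewrite /leb lebesgue_measure_itv/= lte_fin ltr01 -EFinB ltry.
rewrite (Rintegral_itv_obnd_cbnd (Gi _ (l01 _ _))).
rewrite (Rintegral_itv_bndo_bndc (Gi _ (l01 _ _))).
have m01 : measurable (`[0%R, 1%R]%classic : set (measurableTypeR R)) by exact: measurable_itv.
have mAB : measurable (`[A, B]%classic : set (measurableTypeR R)) by exact: measurable_itv.
have ig := gi _ (l01 true false).
have igB := integrableZl m01 B ig.
have iI := integrable_bounded_itv mI IM (l01 true false).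
rewrite (RintegralB m01 igB iI) (RintegralZl _ m01 ig).
congr (_ - _).
rewrite (@Rintegral_swap_on _ _ _ _ _ leb leb _ _ M psi m01 mAB (l01 _ _) (leb_cc_lty _ _) mpsi psiM).
apply: eq_Rintegral => x _; rewrite prim_indic//.
by have /andP[] := distr_fun_itv X x.
Qed.

End quantile_representation.

(** * Regularization of the score *)

Section score_regularization.
Context {R : realType}.
Variables (J : R -> R) (t1 t2 : R).
Hypothesis t1_gt0 : 0 < t1.
Hypothesis t2_lt1 : t2 < 1.
Hypothesis J_trimmed : forall u : R, 0 <= u < t1 \/ t2 < u <= 1 -> J u = 0.
Hypothesis J_bounded : exists M : R, forall u : R, 0 < u < 1 -> `|J u| <= M.

(** A score is arbitrary outside the unit interval; since it is trimmed, the
    extension by 0 creates no discontinuity. *)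
Definition zero_ext (u : R) : R := if (0 <= u <= 1) then J u else 0.

Lemma zero_ext_bounded : exists M, forall u, `|zero_ext u| <= M.
Proof.
have [M JM] := J_bounded; exists `|M| => u; rewrite /zero_ext.
case: ifPn => [/andP[u0 u1]|_]; last by rewrite normr0.
have [ut1|t1u] := ltP u t1; first by rewrite J_trimmed ?normr0// u0 ut1; left.
have [t2u|ut2] := ltP t2 u; first by rewrite J_trimmed ?normr0// u1 t2u; right.
rewrite (le_trans _ (ler_norm M))// JM// (lt_le_trans t1_gt0 t1u)/=.
exact: le_lt_trans t2_lt1.
Qed.

Lemma zero_ext_trimmed u : u < t1 \/ t2 < u -> zero_ext u = 0.
Proof.
move=> H; rewrite /zero_ext; case: ifPn => // /andP[u0 u1].
by apply: J_trimmed; case: H => h; [left|right]; apply/andP.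
Qed.

Lemma zero_ext_continuous u : ~ discontinuities01 J u -> {for u, continuous zero_ext}.
Proof.
move=> uD.
have local0 : (\forall v \near u, zero_ext v = 0) -> {for u, continuous zero_ext}.
  move=> h; have u0 := nbhs_singleton h; rewrite /prop_for /continuous_at u0.
  by apply: cvg_near_cst; apply: filterS h => v ->.
have [ut1|t1u] := ltP u t1.
  apply: local0; near=> v; apply: zero_ext_trimmed; left.
  by near: v; exact: lt_nbhsl.
have [t2u|ut2] := ltP t2 u.
  apply: local0; near=> v; apply: zero_ext_trimmed; right.
  by near: v; exact: lt_nbhsr.
have u0 : 0 < u by apply: lt_le_trans t1u.
have u1 : u < 1 by apply: le_lt_trans t2_lt1.
have cJ : {for u, continuous J}.
  by apply: contrapT => nc; apply: uD; split => //; rewrite u0 u1.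
have uu : zero_ext u = J u by rewrite /zero_ext (ltW u0) (ltW u1).
rewrite /prop_for /continuous_at uu; apply: cvg_trans cJ.
apply: near_eq_cvg; near=> v; rewrite /zero_ext.
have -> : 0 <= v by apply: ltW; near: v; exact: lt_nbhsr.
by have -> : v <= 1 by apply: ltW; near: v; exact: lt_nbhsl.
Unshelve. all: by end_near. Qed.

(** A Borel function that agrees with the score wherever the latter is
    continuous. *)
Definition reg_score : R -> R := uhull zero_ext.

Lemma reg_score_trimmed u : u < t1 \/ t2 < u -> reg_score u = 0.
Proof.
move=> H; have [M JM] := zero_ext_bounded.
rewrite /reg_score (uhull_continuity JM) ?zero_ext_trimmed//.
apply: zero_ext_continuous => -[/andP[u0 u1]]; apply.
have local0 : (\forall v \near u, J v = 0) -> {for u, continuous J}.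
  move=> h; have u0' := nbhs_singleton h; rewrite /prop_for /continuous_at u0'.
  by apply: cvg_near_cst; apply: filterS h => v ->.
apply: local0; case: H => h; near=> v; apply: J_trimmed.
  left; apply/andP; split; first by apply: ltW; near: v; exact: lt_nbhsr.
  by near: v; exact: lt_nbhsl.
right; apply/andP; split; first by near: v; exact: lt_nbhsr.
by apply: ltW; near: v; exact: lt_nbhsl.
Unshelve. all: by end_near. Qed.

Lemma reg_scoreE u : 0 <= u <= 1 -> ~ discontinuities01 J u -> J u = reg_score u.
Proof.
move=> u01 uD; have [M JM] := zero_ext_bounded.
rewrite /reg_score (uhull_continuity JM); last exact: zero_ext_continuous.
by rewrite /zero_ext u01.
Qed.

End score_regularization.

(** * Deviation of the empirical distribution function *)

Section deviation.
Context d (T : measurableType d) (R : realType) (P : probability T R).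
Variables (X : {RV P >-> R}) (Xs : nat -> {RV P >-> R}).
Hypothesis X_iid : iid_copies X Xs.
Let Xf : nat -> T -> R := fun i => Xs i.
Let F := distr_fun X.
Let leb := @lebesgue_measure R.

Lemma centered_indic_le1 (x z : R) : `|(z <= x)%R%:R - F x| <= 1.
Proof.
have /andP[F0 F1] := distr_fun_itv X x; rewrite -/F in F0 F1.
by rewrite ler_norml; apply/andP; case: (z <= x); rewrite ?mulr1n ?mulr0n; split; lra.
Qed.

Lemma measurable_centered_indic (x : R) :
  measurable_fun setT (fun z : R => (z <= x)%R%:R - F x).
Proof. by apply: measurable_funB => //; exact: measurable_indic_le. Qed.

Lemma expectation_le_indic (x : R) : \int[P]_w (X w <= x)%R%:R = F x.
Proof.
apply: EFin_inj; rewrite EFin_Rintegral//; last first.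
  apply: (@prob_integrable_le _ _ _ P _ 1).
    by apply: measurable_indic_le.
  by move=> w; case: (X w <= x); rewrite ?normr1 ?normr0.
have mXx : measurable [set w | (X w <= x)%R].
  have -> : [set w | (X w <= x)%R] = setT `&` X @^-1` `]-oo, x]%classic.
    by rewrite setTI; apply/seteqP; split => w /=; rewrite in_itv.
  exact: (measurable_funPT X).
rewrite distr_funE -[in RHS](setIT [set w | _]) -integral_indic//.
by apply: eq_integral => w _; rewrite indicE mem_setE.
Qed.

Lemma centered_indic_mean (x : R) : \int[P]_w ((X w <= x)%R%:R - F x) = 0.
Proof.
have PT : (P : {measure set T -> \bar R}) setT = 1%E by exact: probability_setT.
rewrite RintegralB//.
- by rewrite expectation_le_indic Rintegral_cst// PT mulr1 subrr.
- apply: (@prob_integrable_le _ _ _ P _ 1).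
    by apply: measurable_indic_le.
  by move=> w; case: (X w <= x); rewrite ?normr1 ?normr0.
- by apply: (@prob_integrable_le _ _ _ P _ `|F x|).
Qed.

(** A function of the pair of a sample point and an abscissa, which is the form
    that the Fubini arguments need. *)
Definition edf_dev (n : nat) (z : T * R) : R :=
  n%:R^-1 * \sum_(i < n) ((Xs i z.1 <= z.2)%R%:R - F z.2).

Lemma measurable_edf_dev n : measurable_fun setT (edf_dev n).
Proof.
apply: measurable_funM => //; apply: measurable_sum => i.
apply: measurable_funB.
  apply: measurable_indic_le; last exact: measurable_snd.
  exact: (measurableT_comp (measurable_funPT (Xs i)) measurable_fst).
exact: (measurableT_comp (measurable_distr_fun X) measurable_snd).
Qed.

Lemma edf_devE n w x : (0 < n)%N ->
  edf_dev n (w, x) = n%:R^-1 * (edf_count Xf n w x)%:R - F x.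
Proof.
move=> n0; rewrite /edf_dev/= sumrB -(edf_countE Xf) mulrBr sumr_const card_ord.
by rewrite -[F x *+ n]mulr_natl mulrA mulVf ?mul1r// pnatr_eq0 -lt0n.
Qed.

Lemma edf_itv n w x : (0 < n)%N ->
  0 <= (n%:R^-1 * (edf_count Xf n w x)%:R : R) <= 1.
Proof.
move=> n0; have nR : 0 < n%:R :> R by rewrite ltr0n.
rewrite mulr_ge0 ?invr_ge0//= mulrC ler_pdivrMr// mul1r ler_nat.
exact: edf_count_le.
Qed.

Lemma norm_edf_dev_le1 n z : `|edf_dev n z| <= 1.
Proof.
case: n => [|n]; first by rewrite /edf_dev big_ord0 mulr0 normr0.
case: z => w x; rewrite edf_devE//.
have /andP[e0 e1] := edf_itv w x (ltn0Sn n).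
have /andP[F0 F1] := distr_fun_itv X x; rewrite -/F in F0 F1.
by move: (_ * _) e0 e1 => e e0 e1; rewrite ler_norml; apply/andP; split; lra.
Qed.

(** The tilts used at the moderate scale are of order [a(n) sqrt n], eventually
    below [n]. *)
Lemma edf_dev_expmoment (s : R) n x : (0 < n)%N -> 0 <= s <= n%:R ->
  (\int[P]_w (expR (s * `|edf_dev n (w, x)|))%:E <=
    (2 * expR (subg_cst R * s ^+ 2 / n%:R))%:E)%E.
Proof.
move=> n0 /andP[s0 sn]; have nR : 0 < n%:R :> R by rewrite ltr0n.
have := mgf_abs_sum_le X_iid (measurable_centered_indic x)
  (centered_indic_le1 x) (centered_indic_mean x) n (t := s / n%:R).
rewrite divr_ge0//= ler_pdivrMr// mul1r => /(_ sn).
rewrite (_ : n%:R * (subg_cst R * (s / n%:R) ^+ 2) = subg_cst R * s ^+ 2 / n%:R); last first.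
  by field; rewrite gt_eqF.
apply: le_trans; rewrite le_eqVlt; apply/orP; left; apply/eqP.
apply: eq_integral => w _; rewrite /edf_dev/= normrM ger0_norm ?invr_ge0//.
by rewrite mulrA.
Qed.

Lemma edf_dev_tail (eta : R) n x : 0 < eta -> (0 < n)%N ->
  (P [set w | (eta <= `|edf_dev n (w, x)|)%R] <=
   (2 * expR (- (n%:R * hoeffding_rate eta)))%:E)%E.
Proof.
exact: (hoeffding_tail X_iid (measurable_centered_indic x)
  (centered_indic_le1 x) (centered_indic_mean x)).
Qed.

End deviation.

(** * Linearization of the trimmed L-statistic *)

Section trimmed.
Context d (T : measurableType d) (R : realType) (P : probability T R).
Variables (X : {RV P >-> R}) (Xs : nat -> {RV P >-> R}).
Hypothesis X_iid : iid_copies X Xs.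
Let Xf : nat -> T -> R := fun i => Xs i.
Let F := distr_fun X.
Let leb := @lebesgue_measure R.
Variables (f : R -> R) (M t1 t2 A B : R).
Hypothesis fM : forall w, `|f w| <= M.
Let g := uhull f.
Hypothesis g_trim : forall s, s < t1 \/ t2 < s -> g s = 0.
Hypothesis t1_t2 : t1 < t2.
Hypothesis FA : F A < t1.
Hypothesis FB : t2 < F B.

Let mg : measurable_fun setT g. Proof. exact: (measurable_uhull fM). Qed.
Let gM w : `|g w| <= M. Proof. exact: norm_uhull_le. Qed.
Let M0 : 0 <= M. Proof. by apply: le_trans (gM 0). Qed.

Lemma trim_points_lt : A < B.
Proof.
rewrite ltNge; apply/negP => /(distr_fun_nd X) h.
by have := lt_le_trans (lt_trans FA t1_t2) (le_trans (ltW FB) h); rewrite ltxx.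
Qed.
Let AB := ltW trim_points_lt.

Variables (J : R -> R) (N : set R).
Hypothesis mN : measurable (N : set (measurableTypeR R)).
Hypothesis N0 : leb N = 0%E.
Hypothesis Jg : forall u, 0 <= u <= 1 -> ~ N u -> J u = g u.

Let edf n w x : R := n%:R^-1 * (edf_count Xf n w x)%:R.

(** The weights are increments of the primitive of [g] and vanish outside the
    trimming range; on the event of the hypotheses the order statistics with a
    nonzero weight lie in [A, B], which allows the summation by parts. *)
Lemma Lstat_representation n w : (0 < n)%N -> edf n w A < t1 -> t2 < edf n w B ->
  Lstat Xs J n w = B * prim g 1 - \int[leb]_(x in `[A, B]) prim g (edf n w x).
Proof.
move=> n0 eA eB; have nR : 0 < n%:R :> R by rewrite ltr0n.
pose kap i := prim g (i%:R / n%:R).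
have kap0 : kap 0%N = 0 by rewrite /kap mul0r prim_lt0.
have kapn : kap n = prim g 1 by rewrite /kap divff// gt_eqF.
have ile (i : nat) : i%:R / n%:R <= i.+1%:R / n%:R :> R.
  by rewrite ler_pM2r ?invr_gt0// ler_nat.
transitivity (\sum_(i < n) order_stat Xs n i w * (kap i.+1 - kap i)).
  apply: eq_bigr => i _; congr (_ * _).
  have i0 : 0 <= i%:R / n%:R :> R by rewrite divr_ge0.
  have i1 : i.+1%:R / n%:R <= 1 :> R by rewrite ler_pdivrMr// mul1r ler_nat.
  rewrite (Rintegral_eq_off_null (g := g) mN N0)//.
  - rewrite -Rintegral_itv_obnd_cbnd; last first.
      by apply: (integrable_bounded_itv mg gM); exact: leb_oc_lty.
    by rewrite /kap (prim_sub mg gM).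
  - exact: measurable_funTS.
  - move=> u; rewrite /= in_itv/= => /andP[ui iu]; apply: Jg.
    by rewrite (le_trans i0 ui) (le_trans iu i1).
rewrite (sum_order_stat (A := A) (B := B))//.
  rewrite kapn kap0 subr0; congr (_ - _); apply: eq_Rintegral => x _.
  by rewrite subr0 /kap mulrC.
move=> i ni ki.
have ik : t1 <= i.+1%:R / n%:R.
  rewrite leNgt; apply/negP => it; case/eqP: ki.
  by rewrite /kap !prim_cst0 ?subrr// => u /andP[_ ui]; apply: g_trim; left;
    rewrite (le_lt_trans ui)// (le_lt_trans _ it)//.
have ki2 : i%:R / n%:R <= t2.
  rewrite leNgt; apply/negP => it; case/eqP: ki.
  rewrite /kap (prim_cst1 mg gM _ (ile i)) ?subrr ?divr_ge0//.
  by move=> u /andP[iu _]; apply: g_trim; right; exact: lt_trans it iu.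
apply/andP; split.
  rewrite leNgt; apply/negP => /ltW; rewrite order_stat_le// => h.
  have : t1 <= edf n w A.
    by rewrite (le_trans ik)// /edf mulrC ler_pM2l ?invr_gt0// ler_nat.
  by rewrite leNgt eA.
rewrite order_stat_le// ltnNge; apply/negP => h.
have : edf n w B <= t2.
  by rewrite (le_trans _ ki2)// /edf mulrC ler_pM2r ?invr_gt0// ler_nat.
by rewrite leNgt eB.
Qed.

(** The influence function of the trimmed L-functional: its first-order response
    to a unit mass at [z]. *)
Definition influence (z : R) : R :=
  - \int[leb]_(x in `[A, B]) (((z <= x)%R%:R - F x) * g (F x)).

Let mgF : measurable_fun setT (fun x => g (F x)).
Proof. exact: (measurableT_comp mg (measurable_distr_fun X)). Qed.

Let mAB : measurable (`[A, B]%classic : set (measurableTypeR R)).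
Proof. exact: measurable_itv. Qed.

Let int_AB (h : R -> R) (K : R) : measurable_fun setT h -> (forall x, `|h x| <= K) ->
  leb.-integrable `[A, B]%classic (EFin \o h).
Proof. by move=> mh hK; exact: (integrable_bounded_itv mh hK (leb_cc_lty _ _)). Qed.

Let int_infl z : leb.-integrable `[A, B]%classic
   (EFin \o (fun x => ((z <= x)%R%:R - F x) * g (F x))).
Proof.
apply: (@int_AB _ M).
  apply: measurable_funM => //; apply: measurable_funB.
    exact: measurable_indic_le.
  exact: measurable_distr_fun.
move=> x; rewrite normrM (le_trans _ (gM (F x)))// ler_piMl//.
exact: centered_indic_le1.
Qed.

Lemma influence_sum n w : (0 < n)%N ->
  n%:R^-1 * \sum_(i < n) influence (Xs i w) =
  - \int[leb]_(x in `[A, B]) (edf_dev X Xs n (w, x) * g (F x)).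
Proof.
move=> n0; rewrite /influence sumrN mulrN; congr (- _).
rewrite -(Rintegral_sum _ mAB (fun i : 'I_n => int_infl (Xs i w))).
have iS : leb.-integrable `[A, B]%classic (EFin \o (fun x =>
    \sum_(i < n) (((Xs i w <= x)%R%:R - F x) * g (F x)))).
  apply: (@int_AB _ (n%:R * M)).
    apply: measurable_sum => i; apply: measurable_funM => //.
    apply: measurable_funB; first exact: measurable_indic_le.
    exact: measurable_distr_fun.
  move=> x; rewrite (le_trans (ler_norm_sum _ _ _))//.
  apply: (@le_trans _ _ (\sum_(i < n) M)); last by rewrite sumr_const card_ord mulr_natl.
  apply: ler_sum => i _; rewrite normrM (le_trans _ (gM (F x)))// ler_piMl//.
  exact: centered_indic_le1.
rewrite -(RintegralZl _ mAB iS); apply: eq_Rintegral => x _.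
by rewrite /edf_dev/= -mulrA -mulr_suml.
Qed.

(** The functional of [Lstat_representation] evaluated at [F] instead of the
    empirical distribution function. *)
Definition Lcenter : R := B * prim g 1 - \int[leb]_(x in `[A, B]) prim g (F x).

(** The weight of the deviation [|F_n - F|] in the linearization error.  The number
    [eta] is the threshold below which a squared deviation is treated as a small
    multiple of the deviation. *)
Definition env_weight (k : nat) (eta : R) (x : R) : R :=
  (osc_env f k (F x) + k.+1%:R * eta) * \1_(`[A, B]%classic : set R) x.

(** Below [eta] a squared deviation is at most [eta] times the deviation; above
    [eta] it is only bounded by 1, but this is rare. *)
Let pointwise_remainder (k : nat) (eta : R) n w x : (0 < n)%N -> 0 <= eta ->
  `|prim g (edf n w x) - prim g (F x) - g (F x) * edf_dev X Xs n (w, x)| <=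
  `|edf_dev X Xs n (w, x)| * (osc_env f k (F x) + k.+1%:R * eta)
   + k.+1%:R * (eta <= `|edf_dev X Xs n (w, x)|)%R%:R.
Proof.
move=> n0 eta0.
have /andP[e0 e1] := edf_itv Xs w x n0.
have /andP[F0 F1] := distr_fun_itv X x.
have := prim_remainder k fM F0 e0.
rewrite -(edf_devE X Xs w x n0) => /le_trans; apply.
have D1 := norm_edf_dev_le1 X Xs n (w, x).
move: (`|edf_dev X Xs n (w, x)|) (normr_ge0 (edf_dev X Xs n (w, x))) D1 => D D0 D1.
rewrite -/F; move: (osc_env f k (F x)) => o.
rewrite mulrDr -addrA lerD2l.
have kk : k%:R <= k.+1%:R :> R by rewrite ler_nat.
have k0 : 0 <= k%:R :> R by [].
have [De|De] := leP eta D.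
  rewrite mulr1n mulr1.
  have : D ^+ 2 <= 1 by rewrite exprn_ile1.
  have : 0 <= D * (k.+1%:R * eta) by rewrite !mulr_ge0.
  have := sqr_ge0 D; nra.
rewrite mulr0n mulr0 addr0.
have : D ^+ 2 <= D * eta by rewrite expr2 ler_wpM2l// ltW.
have := mulr_ge0 D0 eta0; nra.
Qed.

(** Both terms involve the deviation only through its law at each abscissa; the
    first carries a weight of small mass, the second lives on rare events. *)
Lemma Lstat_linearization (k : nat) (eta : R) n w : (0 < n)%N -> 0 <= eta ->
  edf n w A < t1 -> t2 < edf n w B ->
  `|Lstat Xs J n w - Lcenter - n%:R^-1 * \sum_(i < n) influence (Xs i w)| <=
  \int[leb]_x (`|edf_dev X Xs n (w, x)| * env_weight k eta x) +
  k.+1%:R * \int[leb]_x ((eta <= `|edf_dev X Xs n (w, x)|)%R%:R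
     * \1_(`[A, B]%classic : set R) x).
Proof.
move=> n0 eta0 eA eB.
rewrite Lstat_representation// influence_sum// /Lcenter.
have mdev : measurable_fun setT (fun x => edf_dev X Xs n (w, x)).
  apply: (measurableT_comp (measurable_edf_dev X Xs n)); exact: pair1_measurable.
have Dn1 x := norm_edf_dev_le1 X Xs n (w, x).
have mF := measurable_distr_fun X.
have edfE x : edf n w x = edf_dev X Xs n (w, x) + F x.
  by rewrite (edf_devE X Xs w x n0) subrK.
have medf : measurable_fun setT (edf n w).
  rewrite (_ : edf n w = (fun x => edf_dev X Xs n (w, x) + F x)).
    exact: measurable_funD.
  exact/funext.
have i1 : leb.-integrable `[A, B]%classic (EFin \o (fun x => prim g (edf n w x))).
  apply: (@int_AB _ M); first exact: (measurableT_comp (measurable_prim mg gM) medf).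
  by move=> x; apply: norm_prim_le => //; have /andP[] := edf_itv Xs w x n0.
have i2 : leb.-integrable `[A, B]%classic (EFin \o (fun x => prim g (F x))).
  apply: (@int_AB _ M); first exact: (measurableT_comp (measurable_prim mg gM) mF).
  by move=> x; apply: norm_prim_le => //; have /andP[] := distr_fun_itv X x.
have i3 : leb.-integrable `[A, B]%classic (EFin \o (fun x => edf_dev X Xs n (w, x) * g (F x))).
  apply: (@int_AB _ M); first exact: measurable_funM.
  by move=> x; rewrite normrM (le_trans _ (gM (F x)))// ler_piMl.
have i12 := integrableB mAB i1 i2.
have i123 := integrableB mAB i12 i3.
rewrite [X in `|X|](_ : _ = - \int[leb]_(x in `[A, B])
   (prim g (edf n w x) - prim g (F x) - edf_dev X Xs n (w, x) * g (F x))); last first.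
  rewrite (RintegralB mAB i12 i3) (RintegralB mAB i1 i2).
  move: (Rintegral _ _ _) (Rintegral _ _ _) (Rintegral _ _ _) (prim g 1) => I1 I2 I3 p.
  by rewrite opprK opprB addrC; ring.
rewrite normrN (le_trans (le_normr_Rintegral mAB i123))//.
pose u x := `|edf_dev X Xs n (w, x)| * (osc_env f k (F x) + k.+1%:R * eta).
pose v x := (eta <= `|edf_dev X Xs n (w, x)|)%R%:R : R.
have iu : leb.-integrable `[A, B]%classic (EFin \o u).
  apply: (@int_AB _ (2 * M + k.+1%:R * eta)).
    apply: measurable_funM; first exact: measurableT_comp.
    apply: measurable_funD => //.
    exact: (measurableT_comp (measurable_osc_env fM k) mF).
  move=> x; rewrite /u normrM normr_id.
  have o0 : 0 <= osc_env f k (F x) + k.+1%:R * eta.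
    by rewrite addr_ge0 ?mulr_ge0// (osc_env_ge0 fM).
  rewrite [X in _ * X]ger0_norm// (@le_trans _ _ (osc_env f k (F x) + k.+1%:R * eta))//.
    by rewrite ler_piMl.
  by rewrite lerD2r (osc_env_le fM).
have iv : leb.-integrable `[A, B]%classic (EFin \o v).
  apply: (@int_AB _ 1).
    by apply: measurable_indic_le => //; exact: measurableT_comp.
  by move=> x; rewrite /v; case: (eta <= _); rewrite ?mulr1n ?mulr0n ?normr1 ?normr0.
have ikv := integrableZl mAB k.+1%:R iv.
rewrite (@le_trans _ _ (\int[leb]_(x in `[A, B]) (u x + k.+1%:R * v x)))//.
  apply: (le_Rintegral mAB).
  - rewrite (_ : EFin \o _ = abse \o (EFin \o (fun x =>
       prim g (edf n w x) - prim g (F x) - edf_dev X Xs n (w, x) * g (F x)))).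
      exact: integrable_abse.
    by apply/funext.
  - exact: (integrableD mAB iu ikv).
  by move=> x _; rewrite [edf_dev _ _ _ _ * g _]mulrC; exact: pointwise_remainder.
rewrite (RintegralD mAB iu ikv) (RintegralZl _ mAB iv).
rewrite le_eqVlt; apply/orP; left; apply/eqP.
by congr (_ + _ * _); rewrite Rintegral_indic_mul; apply: eq_Rintegral => x _;
  rewrite /u /env_weight ?mulrA.
Qed.

End trimmed.

(** * The moderate deviation scale *)

Section moderate_speed.
Variables (R : realType) (a : nat -> R).
Hypothesis a_gt0 : forall n, (0 < n)%N -> 0 < a n.
Hypothesis a_cvgy : a n @[n --> \oo] --> +oo.
Hypothesis a_small : a n / Num.sqrt (n%:R : R) @[n --> \oo] --> (0 : R).

Lemma speed_cvgy : a n ^+ 2 @[n --> \oo] --> +oo.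
Proof.
apply/cvgryPge => K; near=> n.
have a1 : 1 <= a n by near: n; move/cvgryPge : a_cvgy => /(_ 1).
have aK : K <= a n by near: n; move/cvgryPge : a_cvgy => /(_ K).
by rewrite (le_trans aK)// expr2 ler_peMl// (le_trans _ a1).
Unshelve. all: by end_near. Qed.

Lemma speed_small (k : R) : \forall n \near \oo, k * a n ^+ 2 <= n%:R.
Proof.
have k0 : 0 < `|k| + 1 by rewrite ltr_wpDl.
near=> n.
have n0 : (0 < n)%N by near: n; exists 1%N.
have nR : 0 < n%:R :> R by rewrite ltr0n.
have sn : 0 < Num.sqrt (n%:R : R) by rewrite sqrtr_gt0.
have : `|0 - a n / Num.sqrt (n%:R : R)| <= (`|k| + 1)^-1.
  near: n; move/cvgrPdist_le : a_small; apply.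
  by rewrite invr_gt0.
rewrite sub0r normrN ger0_norm; last by rewrite divr_ge0 ?ltW ?a_gt0.
rewrite ler_pdivrMr// => h.
have e1 : (`|k| + 1)^-1 <= 1 by rewrite invf_le1// lerDr.
have an0 := a_gt0 n0.
have h2 : a n ^+ 2 <= ((`|k| + 1)^-1 * Num.sqrt n%:R) ^+ 2.
  by rewrite ler_pXn2r// nnegrE ltW// mulr_gt0// invr_gt0.
move: h2; rewrite exprMn (sqr_sqrtr (ltW nR)) => h2.
have h3 : (`|k| + 1) * a n ^+ 2 <= n%:R.
  rewrite mulrC -ler_pdivlMr// mulrC (le_trans h2)// ler_pM2r//.
  by rewrite expr2 ler_piMl// ltW// invr_gt0.
apply: (le_trans _ h3); rewrite ler_wpM2r ?sqr_ge0//.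
by rewrite (le_trans (ler_norm k))// lerDl.
Unshelve. all: by end_near. Qed.

Lemma speed_absorb (K e : R) : 0 < e -> \forall n \near \oo, K <= expR (a n ^+ 2 * e).
Proof.
move=> e0; near=> n.
have h : K / e <= a n ^+ 2 by near: n; move/cvgryPge : speed_cvgy => /(_ (K / e)).
rewrite (le_trans _ (expR_ge1Dx _))//.
by rewrite ler_pdivrMr// in h; lra.
Unshelve. all: by end_near. Qed.

(** Half of the exponent [n c] pays for the factor [n]; the other half exceeds any
    multiple of [a(n)^2], since [a(n)^2 = o(n)]. *)
Lemma linear_beats_speed (c K L : R) : 0 < c -> 0 <= K ->
  \forall n \near \oo, K * (n%:R * expR (- (n%:R * c))) <= expR (- (a n ^+ 2 * L)).
Proof.
move=> c0 K0; near=> n.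
have h1 : 2 / c * (L + 1) * a n ^+ 2 <= n%:R by near: n; exact: speed_small.
have h2 : K * (2 / c) <= expR (a n ^+ 2 * 1) by near: n; exact: speed_absorb.
have nc : n%:R * (c / 2) <= expR (n%:R * (c / 2)).
  by rewrite (le_trans _ (expR_ge1Dx _))// lerDr.
have e2 : expR (- (n%:R * c)) = expR (- (n%:R * (c / 2))) * expR (- (n%:R * (c / 2))).
  by rewrite -expRD; congr expR; field.
have h3 : n%:R * expR (- (n%:R * (c / 2))) <= 2 / c.
  by rewrite expRN ler_pdivrMr ?expR_gt0// mulrC -ler_pdivrMr ?divr_gt0// invf_div.
have h4 : expR (- (n%:R * (c / 2))) <= expR (- (a n ^+ 2 * (L + 1))).
  rewrite ler_expR lerN2.
  have : (c / 2) * (2 / c * (L + 1) * a n ^+ 2) <= (c / 2) * n%:R.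
    by rewrite ler_pM2l// divr_gt0.
  rewrite [X in X <= _](_ : _ = a n ^+ 2 * (L + 1)); last by field; rewrite gt_eqF.
  by rewrite [c / 2 * _]mulrC.
rewrite e2 mulrA mulrA.
apply: (@le_trans _ _ (K * (2 / c) * expR (- (a n ^+ 2 * (L + 1))))).
  apply: ler_pM => //; rewrite ?mulr_ge0 ?expR_ge0//.
  by rewrite -mulrA ler_wpM2l.
rewrite (_ : - (a n ^+ 2 * L) = a n ^+ 2 * 1 + - (a n ^+ 2 * (L + 1))); last by ring.
by rewrite expRD ler_wpM2r ?expR_ge0.
Unshelve. all: by end_near. Qed.

End moderate_speed.

(** * Measurability of the L-statistic *)

Section order_stat_measurable.
Context d (T : measurableType d) (R : realType) (P : probability T R).
Variables (Xs : nat -> {RV P >-> R}).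
Let Xf : nat -> T -> R := fun i => Xs i.

Lemma measurable_edf_count n x :
  measurable_fun setT (fun w => (edf_count Xf n w x)%:R : R).
Proof.
rewrite (_ : (fun w => _) = (fun w => \sum_(i < n) (Xs i w <= x)%R%:R)); last first.
  by apply/funext => w; rewrite edf_countE.
apply: measurable_sum => i.
exact: measurable_indic_le.
Qed.

Lemma measurable_order_stat n i : (i < n)%N -> measurable_fun setT (order_stat Xf n i).
Proof.
move=> ni; apply: (measurability _ (RGenOInfty.measurableE R)) => //.
move=> _ [_ [x ->] <-]; rewrite setTI.
rewrite (_ : _ @^-1` _ = ~` [set w | ((edf_count Xf n w x)%:R > i%:R :> R)%R]).
  apply: measurableC; rewrite -[X in measurable X]setTI -preimage_itvoy.
  exact: (measurable_edf_count n x).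
apply/seteqP; split => w /=; rewrite in_itv/= andbT ltr_nat -(order_stat_le Xf w x ni) ltNge => /negP.
  by [].
by [].
Qed.

Lemma measurable_Lstat J n : measurable_fun setT (Lstat Xs J n).
Proof.
apply: measurable_sum => i; apply: measurable_funM => //.
exact: measurable_order_stat.
Qed.

End order_stat_measurable.

(** * Superexponential smallness of the remainder *)

Lemma fine_lt_cst (R : realType) (x : \bar R) (r : R) :
  (0 <= x)%E -> (x < r%:E)%E -> fine x < r.
Proof. by case: x => [x| |]//=; rewrite lte_fin. Qed.

(** Proving each bound with the rate [|L| + 2] instead of [L] gains a factor
    [exp u], which pays for the number of events in the union bound. *)
Lemma absorb_five (R : realType) (u L : R) : 0 <= u -> 5 <= expR (u * 1) ->
  2 * expR (- (u * (`|L| + 1 + 1))) + expR (- (u * (`|L| + 1 + 1))) +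
  expR (- (u * (`|L| + 1 + 1))) + expR (- (u * (`|L| + 1 + 1))) <= expR (- (u * L)).
Proof.
move=> u0 u5; set v := `|L| + 1 + 1.
have : expR (- (u * v)) * expR (u * 1) <= expR (- (u * L)).
  rewrite -expRD ler_expR.
  have : u * L <= u * (`|L| + 1) by rewrite ler_wpM2l// (le_trans (ler_norm L))// lerDl.
  rewrite /v; lra.
have := expR_ge0 (- (u * v)).
by move: (expR _) (expR _) (expR _) u5 => x y z; nra.
Qed.

Section remainder.
Context d (T : measurableType d) (R : realType) (P : probability T R).
Variables (X : {RV P >-> R}) (Xs : nat -> {RV P >-> R}).
Hypothesis X_iid : iid_copies X Xs.
Let F := distr_fun X.
Let leb := @lebesgue_measure R.
Variables (f : R -> R) (M t1 t2 A B : R).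
Hypothesis fM : forall w, `|f w| <= M.
Let g := uhull f.
Hypothesis g_trim : forall s, s < t1 \/ t2 < s -> g s = 0.
Hypothesis t1_t2 : t1 < t2.
Hypothesis FA : F A < t1.
Hypothesis FB : t2 < F B.
Let AltB := trim_points_lt t1_t2 FA FB.
Variables (J : R -> R) (N NF : set R).
Hypothesis mN : measurable (N : set (measurableTypeR R)).
Hypothesis N0 : leb N = 0%E.
Hypothesis Jg : forall u, 0 <= u <= 1 -> ~ N u -> J u = g u.
Hypothesis mNF : measurable (NF : set (measurableTypeR R)).
Hypothesis NF0 : leb NF = 0%E.
Hypothesis osc_NF : forall x, ~ NF x -> osc_env f k (F x) @[k --> \oo] --> (0 : R).

Let mAB : measurable (`[A, B]%classic : set (measurableTypeR R)).
Proof. exact: measurable_itv. Qed.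

Let leb_AB : leb `[A, B]%classic = (B - A)%:E.
Proof. by rewrite /leb lebesgue_measure_cc// ltW. Qed.

Let integral_cst_AB (c : R) : (\int[leb]_(x in `[A, B]) c%:E = (c * (B - A))%:E)%E.
Proof. by rewrite integral_cst// EFinM; congr (_ * _)%E; exact: leb_AB. Qed.

Let mosc k : measurable_fun setT (fun x => osc_env f k (F x)).
Proof. exact: (measurableT_comp (measurable_osc_env fM k) (measurable_distr_fun X)). Qed.

Lemma osc_env_integral_cvg :
  (\int[leb]_(x in `[A, B]) (osc_env f k (F x))%:E @[k --> \oo] --> 0)%E.
Proof.
have [] := @dominated_convergence _ _ _ leb _ mAB
  (fun k x => (osc_env f k (F x))%:E) (cst 0%E) (cst (2 * M)%:E).
- by move=> k; apply/measurable_EFinP; exact: (measurable_funTS (mosc k)).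
- exact: measurable_cst.
- exists NF; split => // x /= h; apply: contrapT => /osc_NF xN; apply: h => _.
  by apply/fine_cvgP; split; [exact: nearW|exact: xN].
- apply: (integrable_bounded_itv (M := `|2 * M|)) => //; exact: leb_cc_lty.
- apply: aeW => x k _ /=; rewrite lee_fin ger0_norm ?(osc_env_ge0 fM)//.
  exact: osc_env_le.
by move=> _ _; rewrite integral0.
Qed.

Lemma measurable_env_weight k eta : measurable_fun setT (env_weight X f A B k eta).
Proof.
apply: measurable_funM; last exact: measurable_indic.
exact: measurable_funD.
Qed.

Lemma env_weight_ge0 k eta x : 0 <= eta -> 0 <= env_weight X f A B k eta x.
Proof.
by move=> eta0; rewrite mulr_ge0// addr_ge0 ?mulr_ge0// (osc_env_ge0 fM).
Qed.

(** The oscillation part fixes [k], by dominated convergence; [eta] is chosen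
    afterwards, depending on [k]. *)
Lemma env_weight_small (gam : R) : 0 < gam ->
  exists k eta G, [/\ 0 < eta, 0 < G, G <= gam &
    (\int[leb]_x (env_weight X f A B k eta x)%:E = G%:E)%E].
Proof.
move=> gam0; have g2 : 0 < gam / 2 by rewrite divr_gt0.
have BA0 : 0 < B - A by rewrite subr_gt0.
have : \forall k \near \oo,
    (\int[leb]_(x in `[A, B]) (osc_env f k (F x))%:E < (gam / 2)%:E)%E.
  have hO : nbhs (0%E : \bar R) [set y | (y < (gam / 2)%:E)%E].
    by apply: open_nbhs_nbhs; split; [exact: open_ereal_lt_ereal|rewrite /= lte_fin].
  exact: (osc_env_integral_cvg hO).
case=> k0 _ /(_ k0 (leqnn k0)) hk.
pose eta := gam / 2 / (k0.+1%:R * (B - A)).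
have eta0 : 0 < eta by rewrite divr_gt0// mulr_gt0.
have o0 : (0 <= \int[leb]_(x in `[A, B]) (osc_env f k0 (F x))%:E)%E.
  by apply: integral_ge0 => x _; rewrite lee_fin (osc_env_ge0 fM).
have wE : (\int[leb]_x (env_weight X f A B k0 eta x)%:E =
   \int[leb]_(x in `[A, B]) (osc_env f k0 (F x))%:E + (gam / 2)%:E)%E.
  transitivity (\int[leb]_(x in `[A, B]) ((osc_env f k0 (F x))%:E + (k0.+1%:R * eta)%:E))%E.
    rewrite [in RHS]integral_mkcond; apply: eq_integral => x _.
    rewrite /env_weight patchE indicE; case: ifPn => _.
      by rewrite mulr1 EFinD.
    by rewrite mulr0.
  rewrite ge0_integralD//.
  - rewrite integral_cst_AB; congr (_ + _%:E)%E.
    by rewrite /eta; field; rewrite gt_eqF//= gt_eqF.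
  - by move=> x _; rewrite lee_fin (osc_env_ge0 fM).
  - by apply/measurable_EFinP; exact: (measurable_funTS (mosc k0)).
  - by move=> x _; rewrite lee_fin mulr_ge0// ltW.
move: hk o0 wE; case: (integral _ _ _) => [r| |]//=; rewrite lte_fin lee_fin => hk o0 wE.
exists k0, eta, (r + gam / 2); split => //.
- by rewrite ltr_wpDl.
- by rewrite [leRHS](splitr gam) lerD2r ltW.
Qed.

Variable a : nat -> R.
Hypothesis a_gt0 : forall n, (0 < n)%N -> 0 < a n.
Hypothesis a_cvgy : a n @[n --> \oo] --> +oo.
Hypothesis a_small : a n / Num.sqrt (n%:R : R) @[n --> \oo] --> (0 : R).

(** Two errors of size [thr del n] add up to [del] after the multiplication by
    [sqrt n / a(n)]. *)
Let thr (del : R) n := a n * del / (2 * Num.sqrt n%:R).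

(** The tilt [s = theta a(n) sqrt n] puts all exponents at the order [a(n)^2]:
    Chernoff's gain is [2 C theta^2 a(n)^2] and its cost [C theta^2 a(n)^2].  The
    factor [theta] is large when the mass [G] of the weight is small. *)
Lemma main_event_tail (del L : R) k eta G : 0 < del -> 0 <= L -> 0 <= eta -> 0 < G ->
  G <= del / (4 * subg_cst R * (L + 1)) ->
  (\int[leb]_x (env_weight X f A B k eta x)%:E = G%:E)%E ->
  \forall n \near \oo,
    (P [set w | ((thr del n)%:E <=
       \int[leb]_x (`|edf_dev X Xs n (w, x)| * env_weight X f A B k eta x)%:E)%E] <=
     (2 * expR (- (a n ^+ 2 * (L + 1))))%:E)%E.
Proof.
move=> del0 L0 eta0 G0 Gle hG.
have C1 : 1 <= subg_cst R by rewrite lerDr expR_ge0.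
have C0 : 0 < subg_cst R by exact: subg_cst_gt0.
move: C0 C1 Gle; move CE : (subg_cst R) => C C0 C1 Gle.
pose theta := del / (4 * C * G).
have th0 : 0 < theta by rewrite divr_gt0// !mulr_gt0.
near=> n.
have n0 : (0 < n)%N by near: n; exists 1%N.
have nR : 0 < n%:R :> R by rewrite ltr0n.
have sn : 0 < Num.sqrt (n%:R : R) by rewrite sqrtr_gt0.
have ss : Num.sqrt (n%:R : R) ^+ 2 = n%:R by rewrite sqr_sqrtr// ltW.
have an0 := a_gt0 n0.
have sp : theta ^+ 2 * a n ^+ 2 <= n%:R by near: n; exact: speed_small.
have san : theta * a n <= Num.sqrt n%:R.
  have : (theta * a n) ^+ 2 <= Num.sqrt n%:R ^+ 2 by rewrite exprMn ss.
  rewrite ler_pXn2r// nnegrE; last exact: ltW.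
  by rewrite mulr_ge0// ltW.
set s := theta * a n * Num.sqrt n%:R.
have s0 : 0 <= s by apply: mulr_ge0; [apply: mulr_ge0|]; apply: ltW.
have sle : s <= n%:R by rewrite -ss expr2 ler_pM2r.
set m := thr del n / G.
have m0 : 0 <= m by rewrite !mulr_ge0// ?invr_ge0 ?mulr_ge0// ltW.
have mG : m * G = thr del n by rewrite divfK// gt_eqF.
have := @jensen_tail _ _ _ P (edf_dev X Xs n) (env_weight X f A B k eta) s m
  (2 * expR (C * s ^+ 2 / n%:R)) G (measurable_edf_dev X Xs n)
  (measurable_env_weight k eta) (fun x => env_weight_ge0 k x eta0) hG G0 s0 m0.
rewrite mG => H; apply: (le_trans (H _ _)).
- by rewrite mulr_ge0// expR_ge0.
- by move=> x; rewrite -CE; apply: edf_dev_expmoment => //; rewrite s0.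
rewrite lee_fin mulrCA ler_pM2l// -expRD ler_expR.
have -> : C * s ^+ 2 / n%:R = C * theta ^+ 2 * a n ^+ 2.
  by rewrite /s !exprMn ss -!mulrA divff ?mulr1// gt_eqF.
have -> : s * m = 2 * C * theta ^+ 2 * a n ^+ 2.
  rewrite /s /m /thr /theta; field.
  by rewrite !gt_eqF.
(* the bound on G gives theta >= L + 1, and C >= 1 *)
have key : L + 1 <= C * theta ^+ 2.
  have Lp : 0 < L + 1 by rewrite ltr_wpDl.
  have tL : L + 1 <= theta.
    rewrite /theta ler_pdivlMr ?mulr_gt0//.
    move: Gle; rewrite ler_pdivlMr ?mulr_gt0// => h.
    by apply: le_trans h; rewrite le_eqVlt; apply/orP; left; apply/eqP; ring.
  have : (L + 1) ^+ 2 <= theta ^+ 2 by rewrite ler_pXn2r// nnegrE ltW.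
  nra.
have := sqr_ge0 (a n); move: (a n ^+ 2) => a2 a20; nra.
Unshelve. all: by end_near. Qed.

Lemma measurable_ge_dev (eta x : R) n :
  measurable [set w | (eta <= `|edf_dev X Xs n (w, x)|)%R].
Proof.
apply: measurable_set_le => //; apply: measurableT_comp => //.
apply: (measurableT_comp (measurable_edf_dev X Xs n)); exact: measurable_pair2.
Qed.

(** The expected length of the set of abscissas with a deviation above [eta]
    decays exponentially in [n], and the threshold in Markov's inequality costs,
    up to a constant, at most a factor [n]. *)
Lemma exceedance_tail (del L : R) (k : nat) eta : 0 < del -> 0 < eta ->
  \forall n \near \oo,
    (P [set w | ((thr del n / k.+1%:R)%:E <=
       \int[leb]_x ((eta <= `|edf_dev X Xs n (w, x)|)%R%:R
          * \1_(`[A, B]%classic : set R) x)%:E)%E] <=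
     (expR (- (a n ^+ 2 * L)))%:E)%E.
Proof.
move=> del0 eta0.
set c := hoeffding_rate eta.
have c0 : 0 < c by exact: hoeffding_rate_gt0.
have BA0 : 0 < B - A by rewrite subr_gt0.
pose K := 2 * (B - A) * (2 * k.+1%:R / del).
have K0 : 0 <= K by rewrite !mulr_ge0 ?invr_ge0 ?ltW//.
near=> n.
have n0 : (0 < n)%N by near: n; exists 1%N.
have nR : 0 < n%:R :> R by rewrite ltr0n.
have sn : 0 < Num.sqrt (n%:R : R) by rewrite sqrtr_gt0.
have an1 : 1 <= a n by near: n; move/cvgryPge : a_cvgy => /(_ 1).
have an0 := a_gt0 n0.
have t0 : 0 < thr del n / k.+1%:R by rewrite !divr_gt0// !mulr_gt0.
pose phi (z : T * R) : R := (eta <= `|edf_dev X Xs n z|)%R%:R * \1_(`[A, B]%classic : set R) z.2.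
have mE : measurable_fun setT (fun z => (eta <= `|edf_dev X Xs n z|)%R%:R : R).
  apply: measurable_indic_le => //; apply: measurableT_comp => //.
  exact: measurable_edf_dev.
have mphi : measurable_fun setT phi.
  apply: measurable_funM => //.
  have mi : measurable_fun setT (\1_(`[A, B]%classic : set R) : R -> R).
    exact: measurable_indic.
  exact: (measurableT_comp mi measurable_snd).
have phi0 z : 0 <= phi z by rewrite mulr_ge0.
have := fubini_markov P mphi phi0 (ltW t0).
rewrite -lee_pdivlMl// => /le_trans; apply.
apply: (@le_trans _ _ (((thr del n / k.+1%:R)^-1)%:E *
   \int[leb]_(x in `[A, B]) (2 * expR (- (n%:R * c)))%:E)%E).
  apply: lee_wpmul2l; first by rewrite lee_fin invr_ge0 ltW.
  rewrite [leRHS]integral_mkcond; apply: ge0_le_integral => //.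
  - by move=> x _; apply: integral_ge0 => w _; rewrite lee_fin.
  - exact: (measurable_integral_fst P mphi phi0).
  - by apply/(measurable_restrictT _ mAB).
  move=> x _; rewrite patchE /phi/= indicE.
  case: ifPn => xAB; last first.
    by rewrite (eq_integral (cst 0%E)) ?integral0// => w _; rewrite mulr0.
  have /= := edf_dev_tail X_iid x eta0 n0.
  apply: le_trans; rewrite -[in leRHS](setIT [set w | _]) -integral_indic//; last first.
    exact: measurable_ge_dev.
  rewrite le_eqVlt; apply/orP; left; apply/eqP.
  by apply: eq_integral => w _; rewrite mulr1 indicE mem_setE.
rewrite integral_cst_AB -!EFinM lee_fin.
apply: (@le_trans _ _ (K * (n%:R * expR (- (n%:R * c))))); last first.
  by near: n; exact: linear_beats_speed.
have sqn : Num.sqrt n%:R / a n <= n%:R :> R.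
  rewrite ler_pdivrMr//.
  have s1 : 1 <= Num.sqrt n%:R :> R.
    have n1 : 1 <= n%:R :> R by rewrite ler1n.
    have ss : Num.sqrt (n%:R : R) ^+ 2 = n%:R by rewrite sqr_sqrtr// ltW.
    rewrite leNgt; apply/negP => s1; move: (Num.sqrt _) ss sn s1 => s ss sn s1.
    nra.
  apply: (@le_trans _ _ n%:R); last by rewrite ler_peMr.
  rewrite -[leRHS](sqr_sqrtr (ltW nR)) expr2 ler_peMl// ltW.
have E0 := expR_ge0 (- (n%:R * c)).
move: (expR _) E0 => e E0.
have -> : (thr del n / k.+1%:R)^-1 * (2 * e * (B - A)) = K * (Num.sqrt n%:R / a n) * e.
  rewrite /K /thr; field.
  by rewrite !gt_eqF.
by rewrite -mulrA ler_wpM2l// ler_wpM2r.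
Unshelve. all: by end_near. Qed.

Lemma edge_tail (eta L x : R) : 0 < eta -> \forall n \near \oo,
  (P [set w | (eta <= `|edf_dev X Xs n (w, x)|)%R] <= (expR (- (a n ^+ 2 * L)))%:E)%E.
Proof.
move=> eta0; near=> n.
have n0 : (0 < n)%N by near: n; exists 1%N.
apply: (le_trans (edf_dev_tail X_iid x eta0 n0)); rewrite lee_fin.
apply: (@le_trans _ _ (2 * (n%:R * expR (- (n%:R * hoeffding_rate eta))))).
  by rewrite ler_pM2l// ler_peMl ?expR_ge0// ler1n.
by near: n; apply: linear_beats_speed => //; exact: hoeffding_rate_gt0.
Unshelve. all: by end_near. Qed.

Lemma measurable_integral_ge (phi : T * R -> R) (c : R) :
  measurable_fun setT phi -> (forall z, 0 <= phi z) ->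
  measurable [set w | (c%:E <= \int[leb]_x (phi (w, x))%:E)%E].
Proof.
move=> mphi phi0; rewrite -[X in measurable X]setTI.
apply: emeasurable_fun_c_infty => //.
exact: (measurable_integral_snd leb mphi phi0).
Qed.

Hypothesis minfluence : measurable_fun setT (influence X f A B).

(** The rate [L] is given first and determines the mass allowed for the weight,
    hence [k] and [eta].  Outside four rare events the linearization is valid and
    each of its two errors is below the threshold. *)
Lemma remainder_superexponential (del L : R) : 0 < del ->
  \forall n \near \oo,
    (P [set w | (del < `|Num.sqrt n%:R / a n *
          (Lstat Xs J n w - Lcenter X f A B -
           n%:R^-1 * \sum_(i < n) influence X f A B (Xs i w))|)%R] <=
     (expR (- (a n ^+ 2 * L)))%:E)%E.
Proof.
move=> del0.
pose L' := `|L| + 1.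
have L'0 : 0 <= L' by rewrite addr_ge0.
have gam0 : 0 < del / (4 * subg_cst R * (L' + 1)).
  by rewrite divr_gt0// !mulr_gt0 ?subg_cst_gt0// ltr_wpDl.
have [k [eta [G [eta0 G0 Gle hG]]]] := env_weight_small gam0.
pose etaA := t1 - F A; pose etaB := F B - t2.
have etaA0 : 0 < etaA by rewrite subr_gt0.
have etaB0 : 0 < etaB by rewrite subr_gt0.
have ev1 := main_event_tail del0 L'0 (ltW eta0) G0 Gle hG.
have ev2 := exceedance_tail (L' + 1) k del0 eta0.
have evA := edge_tail (L' + 1) A etaA0.
have evB := edge_tail (L' + 1) B etaB0.
near=> n.
have n0 : (0 < n)%N by near: n; exists 1%N.
have nR : 0 < n%:R :> R by rewrite ltr0n.
have sn : 0 < Num.sqrt (n%:R : R) by rewrite sqrtr_gt0.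
have an0 := a_gt0 n0.
have P1 := near ev1 n; have P2 := near ev2 n; have PA := near evA n.
have PB := near evB n.
set E := [set w | _].
pose phi1 (z : T * R) : R := `|edf_dev X Xs n z| * env_weight X f A B k eta z.2.
pose phi2 (z : T * R) : R := (eta <= `|edf_dev X Xs n z|)%R%:R
          * \1_(`[A, B]%classic : set R) z.2.
set E1 := [set w | ((thr del n)%:E <= \int[leb]_x (phi1 (w, x))%:E)%E].
set E2 := [set w | ((thr del n / k.+1%:R)%:E <= \int[leb]_x (phi2 (w, x))%:E)%E].
set EA := [set w | (etaA <= `|edf_dev X Xs n (w, A)|)%R].
set EB := [set w | (etaB <= `|edf_dev X Xs n (w, B)|)%R].
have mphi1 : measurable_fun setT phi1.
  apply: measurable_funM.
    by apply: measurableT_comp => //; exact: measurable_edf_dev.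
  exact: (measurableT_comp (measurable_env_weight k eta) measurable_snd).
have phi10 z : 0 <= phi1 z by rewrite mulr_ge0// env_weight_ge0// ltW.
have mphi2 : measurable_fun setT phi2.
  apply: measurable_funM.
    apply: measurable_indic_le => //; apply: measurableT_comp => //.
    exact: measurable_edf_dev.
  have mi : measurable_fun setT (\1_(`[A, B]%classic : set R) : R -> R).
    exact: measurable_indic.
  exact: (measurableT_comp mi measurable_snd).
have phi20 z : 0 <= phi2 z by rewrite mulr_ge0.
have mE1 : measurable E1 by exact: measurable_integral_ge.
have mE2 : measurable E2 by exact: measurable_integral_ge.
have mEA : measurable EA by exact: measurable_ge_dev.
have mEB : measurable EB by exact: measurable_ge_dev.
have mE : measurable E.
  apply: measurable_set_lt => //.
  apply: measurableT_comp => //; apply: measurable_funM => //.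
  apply: measurable_funB.
    by apply: measurable_funB => //; exact: measurable_Lstat.
  apply: measurable_funM => //; apply: measurable_sum => i.
  exact: (measurableT_comp minfluence (measurable_funPT (Xs i))).
have sub : E `<=` E1 `|` E2 `|` EA `|` EB.
  move=> w Ew; apply: contrapT => nE.
  have dA : `|edf_dev X Xs n (w, A)| < etaA.
    by rewrite ltNge; apply/negP => h; apply: nE; left; right.
  have dB : `|edf_dev X Xs n (w, B)| < etaB.
    by rewrite ltNge; apply/negP => h; apply: nE; right.
  have i1 : \int[leb]_x phi1 (w, x) < thr del n.
    apply: fine_lt_cst; first by apply: integral_ge0 => x _; rewrite lee_fin.
    by rewrite ltNge; apply/negP => h; apply: nE; left; left; left.
  have i2 : \int[leb]_x phi2 (w, x) < thr del n / k.+1%:R.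
    apply: fine_lt_cst; first by apply: integral_ge0 => x _; rewrite lee_fin.
    by rewrite ltNge; apply/negP => h; apply: nE; left; left; right.
  have eA : n%:R^-1 * (edf_count (fun i => Xs i : T -> R) n w A)%:R < t1.
    move: dA; rewrite (edf_devE X Xs w A n0) /etaA ltr_norml => /andP[_].
    by rewrite ltrD2r.
  have eB : t2 < n%:R^-1 * (edf_count (fun i => Xs i : T -> R) n w B)%:R.
    move: dB; rewrite (edf_devE X Xs w B n0) /etaB ltr_norml => /andP[+ _].
    by rewrite opprB ltrD2r.
  have := Lstat_linearization fM g_trim t1_t2 FA FB mN N0 Jg k n0
    (ltW eta0) eA eB.
  have i2' : k.+1%:R * \int[leb]_x phi2 (w, x) < thr del n.
    by rewrite mulrC -ltr_pdivlMr.
  move/le_lt_trans/(_ (ltrD i1 i2')) => h.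
  have := Ew; rewrite /E/= normrM gtr0_norm ?divr_gt0// => hE.
  have : Num.sqrt n%:R / a n * (thr del n + thr del n) = del.
    by rewrite /thr; field; rewrite !gt_eqF.
  move=> thrE; move: hE; rewrite -{1}thrE ltr_pM2l ?divr_gt0//.
  by move=> /(lt_trans h); rewrite ltxx.
have PE : (P E <= P E1 + P E2 + P EA + P EB)%E.
  apply: (@le_trans _ _ (P (E1 `|` E2 `|` EA `|` EB))).
    by rewrite le_measure ?inE//; do 3 apply: measurableU => //.
  apply: (le_trans (prob_setU_le P (measurableU _ _ (measurableU _ _ mE1 mE2) mEA) mEB)).
  rewrite leeD2r//.
  apply: (le_trans (prob_setU_le P (measurableU _ _ mE1 mE2) mEA)).
  by rewrite leeD2r//; exact: prob_setU_le.
apply: (le_trans PE); apply: (le_trans (leeD (leeD (leeD (P1 _) (P2 _)) (PA _)) (PB _))) => //.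
rewrite -!EFinD lee_fin.
apply: absorb_five; first exact: sqr_ge0.
by near: n; exact: speed_absorb.
Unshelve. all: by end_near. Qed.

End remainder.

(** * Mean and variance of the influence function *)

Section product_null.
Context d1 d2 (T1 : measurableType d1) (T2 : measurableType d2) (R : realType).
Variables (m1 : {measure set T1 -> \bar R}) (m2 : {sigma_finite_measure set T2 -> \bar R}).

Lemma product_null_fst (A : set T1) : measurable A -> m1 A = 0%E ->
  (m1 \x m2)%E (A `*` setT) = 0%E.
Proof. by move=> mA A0; rewrite product_measure1E// A0 mul0e. Qed.

Lemma product_null_snd (A : set T2) : measurable A -> m2 A = 0%E ->
  (m1 \x m2)%E (setT `*` A) = 0%E.
Proof. by move=> mA A0; rewrite product_measure1E// A0 mule0. Qed.

End product_null.

Section influence.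
Context d (T : measurableType d) (R : realType) (P : probability T R).
Variable X : {RV P >-> R}.
Let F := distr_fun X.
Let leb := @lebesgue_measure R.

Let ind (x : R) (w : T) : R := (X w <= x)%R%:R.

Let integrable_ind x : P.-integrable setT (EFin \o ind x).
Proof.
apply: (@prob_integrable_le _ _ _ P _ 1).
  by apply: measurable_indic_le.
by move=> w; rewrite /ind; case: (X w <= x); rewrite ?normr1 ?normr0.
Qed.

Let integrable_centered x : P.-integrable setT (EFin \o (fun w => ind x w - F x)).
Proof.
apply: (@prob_integrable_le _ _ _ P _ 1).
  exact: (measurableT_comp (measurable_centered_indic X x)).
by move=> w; exact: centered_indic_le1.
Qed.

Lemma covariance_indic (x y : R) :
  \int[P]_w (((X w <= x)%R%:R - F x) * ((X w <= y)%R%:R - F y)) =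
  F (Num.min x y) - F x * F y.
Proof.
have PT : (P : {measure set T -> \bar R}) setT = 1%E by exact: probability_setT.
have ic (c : R) : P.-integrable setT (EFin \o (fun _ : T => c)).
  by apply: (@prob_integrable_le _ _ _ P _ `|c|).
have ix := integrableZl measurableT (F y) (integrable_centered x).
have iy := integrableZl measurableT (F x) (integrable_centered y).
have im := integrable_ind (Num.min x y).
have i1 := integrableB measurableT im ix.
have i2 := integrableB measurableT i1 iy.
transitivity (\int[P]_w (ind (Num.min x y) w - F y * (ind x w - F x)
    - F x * (ind y w - F y) - F x * F y)).
  apply: eq_Rintegral => w _; rewrite /ind le_min.
  by case: (X w <= x); case: (X w <= y) => /=; ring.
rewrite (RintegralB measurableT i2 (ic (F x * F y))).
rewrite (RintegralB measurableT i1 iy) (RintegralB measurableT im ix).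
rewrite (RintegralZl _ measurableT (integrable_centered x)).
rewrite (RintegralZl _ measurableT (integrable_centered y)).
rewrite (centered_indic_mean X x) (centered_indic_mean X y).
rewrite (expectation_le_indic X) (Rintegral_cst _ measurableT) PT /=.
by rewrite !mulr0 !subr0 mulr1.
Qed.

Variables (f : R -> R) (M t1 t2 A B : R).
Hypothesis fM : forall w, `|f w| <= M.
Let g := uhull f.
Hypothesis g_trim : forall s, s < t1 \/ t2 < s -> g s = 0.
Hypothesis AB : A <= B.
Hypothesis FA : F A < t1.
Hypothesis FB : t2 < F B.

Let mg : measurable_fun setT g. Proof. exact: (measurable_uhull fM). Qed.
Let gM w : `|g w| <= M. Proof. exact: norm_uhull_le. Qed.
Let M0 : 0 <= M. Proof. by apply: le_trans (gM 0). Qed.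
Let mF : measurable_fun setT F. Proof. exact: measurable_distr_fun. Qed.
Let mgF : measurable_fun setT (fun x => g (F x)).
Proof. exact: (measurableT_comp mg mF). Qed.
Let mAB : measurable (`[A, B]%classic : set (measurableTypeR R)).
Proof. exact: measurable_itv. Qed.

Lemma uhull_distr_fun_trim x : ~ (A <= x <= B) -> g (F x) = 0.
Proof.
move=> nx; apply: g_trim; have [Ax|xA] := leP A x.
  right; rewrite (lt_le_trans FB)// distr_fun_nd// ltW// ltNge; apply/negP => xB.
  by apply: nx; rewrite Ax.
by left; rewrite (le_lt_trans _ FA)// distr_fun_nd// ltW.
Qed.

Let phi (z : R * R) : R := ((z.1 <= z.2)%R%:R - F z.2) * g (F z.2).

Let mphi : measurable_fun setT phi.
Proof.
apply: measurable_funM; last exact: (measurableT_comp mgF measurable_snd).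
apply: measurable_funB; last exact: (measurableT_comp mF measurable_snd).
by apply: measurable_indic_le; [exact: measurable_fst|exact: measurable_snd].
Qed.

Let phiM z : `|phi z| <= M.
Proof.
rewrite normrM (le_trans _ (gM (F z.2)))// ler_piMl//.
exact: centered_indic_le1.
Qed.

Lemma measurable_influence : measurable_fun setT (influence X f A B).
Proof.
apply: measurable_funN.
exact: (measurable_Rintegral_snd (m2 := leb) mAB (leb_cc_lty _ _) mphi phiM).
Qed.

Lemma norm_influence_le z : `|influence X f A B z| <= M * (B - A).
Proof.
rewrite /influence normrN.
have := @norm_Rintegral_le _ _ _ leb _ (fun x => phi (z, x)) M mAB (leb_cc_lty _ _).
rewrite [X in fine X](_ : _ = (B - A)%:E); last exact: lebesgue_measure_cc.
apply; last by move=> x _; exact: phiM.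
by apply: measurable_funTS; apply: (measurableT_comp mphi); exact: pair1_measurable.
Qed.

Let mphiX : measurable_fun setT (fun z : T * R => phi (X z.1, z.2)).
Proof.
apply: (measurableT_comp mphi); apply: measurable_fun_pair.
  exact: (measurableT_comp (measurable_funPT X) measurable_fst).
exact: measurable_snd.
Qed.

Lemma influence_mean : \int[P]_w influence X f A B (X w) = 0.
Proof.
have PT : (P : {measure set T -> \bar R}) setT = 1%E by exact: probability_setT.
have mi : measurable_fun setT (fun w => \int[leb]_(x in `[A, B]) phi (X w, x)).
  exact: (measurable_Rintegral_snd (m2 := leb) mAB (leb_cc_lty _ _) mphiX (fun z => phiM _)).
have ii : P.-integrable setT (EFin \o (fun w => \int[leb]_(x in `[A, B]) phi (X w, x))).
  apply: (@prob_integrable_le _ _ _ P _ (M * (B - A))) => // w.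
  by rewrite -normrN; exact: norm_influence_le.
transitivity (\int[P]_w (-1 * \int[leb]_(x in `[A, B]) phi (X w, x))).
  by apply: eq_Rintegral => w _; rewrite mulN1r.
rewrite (RintegralZl _ measurableT ii).
rewrite (Rintegral_swap_on (m1 := P) (m2 := leb) (psi := fun z => phi (X z.1, z.2))
  measurableT mAB _ (leb_cc_lty _ _) mphiX (fun z => phiM _)); last first.
  by rewrite PT ltry.
rewrite Rintegral_eq0 ?mulr0// => x _.
transitivity (\int[P]_w (g (F x) * ((X w <= x)%R%:R - F x))).
  by apply: eq_Rintegral => w _; rewrite mulrC.
by rewrite (RintegralZl _ measurableT (integrable_centered x)) centered_indic_mean mulr0.
Qed.

Let lebAB_lty : (leb `[A, B]%classic < +oo)%E.
Proof. exact: leb_cc_lty. Qed.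

Let infl (u : R) : R := \int[leb]_(x in `[A, B]) phi (u, x).

Let norm_infl_le u : `|infl u| <= M * (B - A).
Proof. by rewrite -normrN; exact: norm_influence_le. Qed.

Let minfl : measurable_fun setT infl.
Proof. exact: (measurable_Rintegral_snd (m2 := leb) mAB (leb_cc_lty _ _) mphi phiM). Qed.

Let integrable_phi u : leb.-integrable `[A, B]%classic (EFin \o (fun x => phi (u, x))).
Proof.
apply: (integrable_bounded_itv (M := M)) => //.
by apply: (measurableT_comp mphi); exact: pair1_measurable.
Qed.

Let K (z : R * R) : R := g (F z.1) * g (F z.2) * (F (Num.min z.1 z.2) - F z.1 * F z.2).

Let mK : measurable_fun setT K.
Proof.
have mF1 := measurableT_comp mF (measurable_fst : measurable_fun setT (fst : R * R -> R)).
have mF2 := measurableT_comp mF (measurable_snd : measurable_fun setT (snd : R * R -> R)).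
apply: measurable_funM.
  by apply: measurable_funM; apply: measurableT_comp.
apply: measurable_funB; last exact: measurable_funM.
by apply: (measurableT_comp mF); apply: measurable_minr.
Qed.

Let uhull_supp x : `|g (F x)| <= M * \1_(`[A, B]%classic : set R) x.
Proof.
rewrite indicE; case: (boolP (x \in _)) => [_|/negP]; first by rewrite mulr1.
by rewrite inE/= in_itv/= => h; rewrite uhull_distr_fun_trim// normr0 mulr0.
Qed.

Let norm_K_le z : `|K z| <=
  M * M * (\1_(`[A, B]%classic : set R) z.1 * \1_(`[A, B]%classic : set R) z.2).
Proof.
have /andP[a0 a1] := distr_fun_itv X (Num.min z.1 z.2).
have /andP[b0 b1] := distr_fun_itv X z.1.
have /andP[c0 c1] := distr_fun_itv X z.2.
have h : `|F (Num.min z.1 z.2) - F z.1 * F z.2| <= 1.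
  rewrite -/F in a0 a1 b0 b1 c0 c1; have : F z.1 * F z.2 <= 1 by rewrite mulr_ile1.
  have : 0 <= F z.1 * F z.2 by rewrite mulr_ge0.
  move: (F z.1 * F z.2) (F (Num.min _ _)) a0 a1 => x y y0 y1 x0 x1.
  by rewrite ler_norml; apply/andP; split; lra.
rewrite normrM -[leRHS]mulr1 ler_pM// normrM mulrACA ler_pM//; exact: uhull_supp.
Qed.

Let expectation_phi2 x y : \int[P]_w (phi (X w, x) * phi (X w, y)) = K (x, y).
Proof.
transitivity (\int[P]_w (g (F x) * g (F y) *
    (((X w <= x)%R%:R - F x) * ((X w <= y)%R%:R - F y)))).
  by apply: eq_Rintegral => w _; rewrite /phi/= mulrACA mulrC.
rewrite (RintegralZl _ measurableT) ?covariance_indic//.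
apply: (@prob_integrable_le _ _ _ P _ 1).
  apply: measurable_funM.
    exact: (measurableT_comp (measurable_centered_indic X x)).
  exact: (measurableT_comp (measurable_centered_indic X y)).
move=> w; rewrite normrM -[leRHS]mulr1; apply: ler_pM => //; exact: centered_indic_le1.
Qed.

Variables (J : R -> R) (NF : set R).
Hypothesis mNF : measurable (NF : set (measurableTypeR R)).
Hypothesis NF0 : leb NF = 0%E.
Hypothesis JgF : forall x, ~ NF x -> J (F x) = g (F x).

(** The square of the integral is a double integral; the expectation taken inside
    yields the covariance of two indicators, which is the kernel of [sigma2]. *)
Lemma influence_variance : \int[P]_w (influence X f A B (X w) ^+ 2) = sigma2 J F.
Proof.
have PT : (P : {measure set T -> \bar R}) setT = 1%E by exact: probability_setT.
have PToo : (P setT < +oo)%E by rewrite PT ltry.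
transitivity (\int[P]_w \int[leb]_(x in `[A, B]) (infl (X w) * phi (X w, x))).
  apply: eq_Rintegral => w _; rewrite (RintegralZl _ mAB (integrable_phi _)).
  by rewrite /influence sqrrN expr2.
have mX2 : measurable_fun setT (fun z : T * R => infl (X z.1)).
  apply: (measurableT_comp minfl); exact: (measurableT_comp (measurable_funPT X) measurable_fst).
rewrite (Rintegral_swap_on (m1 := P) (m2 := leb) (M := M * (B - A) * M)
   (psi := fun z => infl (X z.1) * phi (X z.1, z.2)) measurableT mAB PToo lebAB_lty)//; last 2 first.
- by apply: measurable_funM.
- by move=> z; rewrite normrM ler_pM.
transitivity (\int[leb]_(x in `[A, B]) \int[leb]_(y in `[A, B]) K (x, y)).
  apply: eq_Rintegral => x _.
  transitivity (\int[P]_w \int[leb]_(y in `[A, B]) (phi (X w, x) * phi (X w, y))).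
    apply: eq_Rintegral => w _; rewrite (RintegralZl _ mAB (integrable_phi _)).
    by rewrite mulrC.
  rewrite (Rintegral_swap_on (m1 := P) (m2 := leb) (M := M * M)
    (psi := fun z => phi (X z.1, x) * phi (X z.1, z.2)) measurableT mAB PToo lebAB_lty)//; last 2 first.
  - apply: measurable_funM; last exact: mphiX.
    have mp : measurable_fun setT (fun u => phi (u, x)).
      by apply: (measurableT_comp mphi); exact: pair2_measurable.
    apply: (measurableT_comp mp).
    exact: (measurableT_comp (measurable_funPT X) measurable_fst).
  - by move=> z; rewrite normrM ler_pM.
  by apply: eq_Rintegral => y _; exact: expectation_phi2.
transitivity (\int[leb]_x \int[leb]_y K (x, y)).
  have Kout x y : ~ (A <= x <= B) \/ ~ (A <= y <= B) -> K (x, y) = 0.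
    by rewrite /K/= => -[h|h]; rewrite (uhull_distr_fun_trim h) ?(mulr0, mul0r).
  rewrite Rintegral_mkcond; apply: eq_Rintegral => x _.
  rewrite patchE; case: ifPn => [xAB|/negP]; last first.
    by rewrite inE/= in_itv/= => h; rewrite Rintegral_eq0// => y _; rewrite Kout//; left.
  rewrite Rintegral_mkcond; apply: eq_Rintegral => y _.
  rewrite patchE; case: ifPn => // /negP.
  by rewrite inE/= in_itv/= => h; rewrite Kout//; right.
rewrite -(Rintegral_prod (m1 := leb) (m2 := leb) mAB mAB lebAB_lty lebAB_lty mK norm_K_le).
pose N2 : set (measurableTypeR R * measurableTypeR R) := (NF `*` setT) `|` (setT `*` NF).
have mN2 : measurable N2 by apply: measurableU; apply: measurableX.
have N20 : (leb \x leb)%E N2 = 0%E.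
  rewrite /N2 null_set_setU//; try exact: measurableX.
    exact: (product_null_fst (m1 := leb) leb mNF NF0).
  exact: (product_null_snd leb (m2 := leb) mNF NF0).
rewrite /sigma2; apply: esym; apply: (Rintegral_eq_off_null mN2 N20 measurableT mK).
by move=> [x y] _ /= nN; rewrite !JgF// => h; apply: nN; [right|left].
Qed.

End influence.

(** * The two centrings *)

Section restricted_measure.
Context d (T : measurableType d) (R : realType) (mu : {measure set T -> \bar R}).

Lemma integral_mrestr (D : set T) (mD : measurable D) (h : T -> \bar R) :
  measurable_fun setT h ->
  (\int[mrestr mu mD]_x h x = \int[mu]_(x in D) h x)%E.
Proof.
move=> mh; have mDC := measurableC mD.
have N0 : mrestr mu mD (~` D) = 0%E by rewrite /mrestr setICl measure0.
have mhD : measurable_fun setT (h \_ D).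
  by apply/(measurable_restrictT _ mD); exact: measurable_funTS.
rewrite (integral_eq_off_null mDC N0 measurableT mhD); last first.
  by move=> x _ /contrapT Dx; rewrite patchE mem_set.
rewrite -integral_mkcond; apply: eq_measure_integral => A mA AD.
by rewrite [LHS](_ : _ = mu (A `&` D))// (setIidl AD).
Qed.

End restricted_measure.

Section centrings.
Context d (T : measurableType d) (R : realType) (P : probability T R).
Variable X : {RV P >-> R}.
Let F := distr_fun X.
Let Q := quantile F.
Let leb := @lebesgue_measure R.

Let m01 : measurable (`]0, 1[%classic : set (measurableTypeR R)).
Proof. exact: measurable_itv. Qed.

(** The quantile function, made measurable on the whole line. *)
Let Q01 (s : R) : R := if 0 < s < 1 then Q s else 0.

Let preimage_Q01 (x : R) : `]0, 1[%classic `&` Q01 @^-1` `]x, +oo[%classic = `]F x, 1[%classic.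
Proof.
have /andP[F0 F1] := distr_fun_itv X x.
apply/seteqP; split => s /=; rewrite !in_itv/= andbT /Q01.
  move=> [/andP[s0 s1]]; rewrite s0 s1/= => xQ; rewrite andbT.
  by move: xQ; rewrite ltNge (quantile_le X)// -ltNge.
move=> /andP[Fs s1]; have s0 := le_lt_trans F0 Fs.
by rewrite s0 s1/= ltNge (quantile_le X)// -ltNge.
Qed.

Lemma measurable_quantile : measurable_fun (`]0, 1[%classic : set R) Q.
Proof.
move=> _; apply: (measurability _ (RGenOInfty.measurableE R)) => //.
move=> _ [_ [x ->] <-].
rewrite (_ : _ `&` _ = `]F x, 1[%classic); first exact: measurable_itv.
rewrite -preimage_Q01; apply/seteqP; split => s /=; rewrite !in_itv/= /Q01.
  by move=> [/[dup] s01 -> h].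
by move=> [/[dup] s01 -> h].
Qed.

Let mQ01 : measurable_fun [set: measurableTypeR R] (Q01 : measurableTypeR R -> measurableTypeR R).
Proof.
have -> : Q01 = Q \_ `]0, 1[%classic.
  by apply/funext => s; rewrite patchE mem_setE in_itv.
by apply/(measurable_restrictT _ m01); exact: measurable_quantile.
Qed.

(** Inverse transform sampling; by [quantile_le] the two measures agree on open
    half-lines. *)
Lemma law_quantile (A : set (measurableTypeR R)) : measurable A ->
  distribution P X A = leb (`]0, 1[%classic `&` Q01 @^-1` A).
Proof.
move=> mA.
have mX : measurable_fun [set: T] (X : T -> measurableTypeR R). exact (measurable_funPT X).
pose m1 : {measure set (measurableTypeR R) -> \bar R} :=
  measure_function_pushforward__canonical__measure_function_Measure P mX.
pose m0 : {measure set (measurableTypeR R) -> \bar R} := mrestr leb m01.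
pose m2 : {measure set (measurableTypeR R) -> \bar R} :=
  measure_function_pushforward__canonical__measure_function_Measure m0 mQ01.
have ray (x : R) : m1 `]x, +oo[%classic = (1 - F x)%:E.
  have FE : cdf X x = (F x)%:E.
    by rewrite /F /distr_fun fineK// ge0_fin_numE ?cdf_ge0// (le_lt_trans (cdf_le1 _ _)) ?ltry.
  have := cdf_ccdf_1 X x; rewrite FE; rewrite [ccdf X x](_ : _ = m1 `]x, +oo[%classic)//.
  have : (0 <= m1 `]x, +oo[%classic)%E by exact: measure_ge0.
  case: (m1 _) => [r| |]//= _; rewrite -EFinD => -[<-].
  by rewrite addrAC subrr add0r.
have m12 (x : R) : m1 `]x, +oo[%classic = m2 `]x, +oo[%classic.
  rewrite ray /m2 /m0 /= /pushforward /mrestr setIC preimage_Q01.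
  rewrite /leb lebesgue_measure_itv/= lte_fin.
  have /andP[_] := distr_fun_itv X x; rewrite -/F le_eqVlt => /orP[/eqP->|->].
    by rewrite ltxx subrr.
  by rewrite EFinB.
have m1oo (x : R) : (m1 `]x, +oo[%classic < +oo)%E by rewrite ray ltry.
have := measure_eq_rays (b := false) m12 m1oo mA.
by rewrite /m1 /m2 /m0 /= /pushforward /mrestr setIC.
Qed.

Lemma distr_fun_quantile (s : R) : continuous F -> 0 < s -> s < 1 -> F (Q s) = s.
Proof.
move=> cF s0 s1; apply/eqP; rewrite eq_le -(quantile_le X)// lexx andbT.
rewrite leNgt; apply/negP => sF.
have /nbhs_ballP[e /= e0 he] : \forall y \near Q s, s < F y.
  by have := cF (Q s); move/cvgr_gt; apply.
have : Q s <= Q s - e / 2.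
  rewrite (quantile_le X)// ltW//; apply: he.
  rewrite /ball/= opprB addrC subrK ger0_norm ?divr_ge0 ?ltW//.
  by rewrite ltr_pdivrMr// ltr_pMr// ltr1n.
by rewrite lerDl oppr_ge0 leNgt divr_gt0.
Qed.

Variables (f : R -> R) (M t1 t2 A B : R).
Hypothesis fM : forall w, `|f w| <= M.
Let g := uhull f.
Hypothesis g_trim : forall s, s < t1 \/ t2 < s -> g s = 0.
Hypothesis FA : F A < t1.
Hypothesis FB : t2 < F B.
Hypothesis AB : A <= B.
Variables (J : R -> R) (N : set R).
Hypothesis mN : measurable (N : set (measurableTypeR R)).
Hypothesis N0 : leb N = 0%E.
Hypothesis Jg : forall u, 0 <= u <= 1 -> ~ N u -> J u = g u.

Let mg : measurable_fun setT g. Proof. exact: (measurable_uhull fM). Qed.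
Let gM w : `|g w| <= M. Proof. exact: norm_uhull_le. Qed.

Let mQg : measurable_fun (`]0, 1[%classic : set R) (fun s => Q s * g s).
Proof.
by apply: measurable_funM; [exact: measurable_quantile|exact: measurable_funTS].
Qed.

Let qcenter_uhull : qcenter J F = \int[leb]_(s in `]0, 1[) (Q s * g s).
Proof.
apply: (Rintegral_eq_off_null mN N0 m01 mQg) => s; rewrite /= in_itv/= => /andP[s0 s1] nN.
by rewrite Jg// !ltW.
Qed.

Lemma qcenter_Lcenter : qcenter J F = Lcenter X f A B.
Proof.
rewrite qcenter_uhull.
exact: (quantile_representation mg gM g_trim FA FB AB).
Qed.

(** The change of variables [x = Q s], under which [F x] is [s] by continuity of
    [F].  The same identity makes the preimage of a Lebesgue null set of levels
    null for the law of [X], so that [J] may be regularized under both integrals. *)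
Lemma mcenter_qcenter : continuous F -> mcenter X J = qcenter J F.
Proof.
move=> cF; rewrite qcenter_uhull.
pose h x := x * g (F x).
have mF : measurable_fun [set: measurableTypeR R] (F : measurableTypeR R -> measurableTypeR R).
  exact: measurable_distr_fun.
have mh : measurable_fun setT h.
  by apply: measurable_funM => //; exact: (measurableT_comp mg mF).
have mNF : measurable (F @^-1` N : set R).
  by rewrite -[X in measurable X]setTI; exact: mF.
have Q01E s : `]0, 1[%classic s -> F (Q01 s) = s.
  by rewrite /= in_itv/= /Q01 => /[dup] /andP[s0 s1] ->; rewrite distr_fun_quantile.
have NF0 : distribution P X (F @^-1` N) = 0%E.
  rewrite law_quantile//; apply/eqP; rewrite eq_le measure_ge0 andbT -N0.
  apply: le_measure; rewrite ?inE//; last by move=> s [s01]; rewrite /= Q01E.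
  apply: measurableI => //; rewrite -[X in measurable X]setTI; exact: mQ01.
transitivity (\int[distribution P X]_x h x).
  apply: (Rintegral_eq_off_null mNF NF0 measurableT mh) => x _ nN.
  by rewrite /h -Jg//; exact: distr_fun_itv.
have hM x : `|h x| <= (`|A| + `|B|) * M.
  rewrite /h; have [xAB|/negP xAB] := boolP (A <= x <= B); last first.
    have -> : g (F x) = 0 by exact: (uhull_distr_fun_trim g_trim FA FB).
    rewrite mulr0 normr0 mulr_ge0 ?addr_ge0//.
    exact: le_trans (gM 0).
  rewrite normrM ler_pM//; case/andP: xAB => Ax xB; rewrite ler_norml.
  have := ler_norm B; have := ler_norm (- A); rewrite normrN => nA nB.
  have := normr_ge0 A; have := normr_ge0 B.
  by move: nA nB; move: (`|A|) (`|B|) => p q *; apply/andP; split; lra.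
pose m0 : {measure set (measurableTypeR R) -> \bar R} := mrestr leb m01.
have mhQ : measurable_fun [set: measurableTypeR R] (h \o Q01).
  exact: (measurableT_comp mh mQ01).
have m0oo : (m0 setT < +oo)%E.
  rewrite /m0 /= /mrestr setTI /leb lebesgue_measure_itv/=.
  by case: ifP => _; rewrite ?ltry// -EFinB ltry.
have ihQ : m0.-integrable setT ((EFin \o h) \o Q01).
  exact: (integrable_le_cst measurableT m0oo mhQ (fun x _ => hM _)).
rewrite /Rintegral; congr fine.
have mQ01' : measurable_fun [set: measurableTypeR R] (Q01 : measurableTypeR R -> R).
  exact: mQ01.
pose m2 : {measure set R -> \bar R} :=
  measure_function_pushforward__canonical__measure_function_Measure m0 mQ01'.
transitivity (\int[m2]_x (EFin \o h) x)%E.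
  apply: eq_measure_integral => E mE _.
  apply: (eq_trans (law_quantile mE)).
  by rewrite /m2 /m0 /= /pushforward /mrestr setIC.
have mhE : measurable_fun [set: R] (EFin \o h) by exact/measurable_EFinP.
apply: (eq_trans (integral_pushforward mQ01' mhE ihQ measurableT)).
have mhQE : measurable_fun [set: measurableTypeR R] (EFin \o (h \o Q01)).
  exact/measurable_EFinP.
have e := integral_mrestr leb m01 mhQE.
rewrite preimage_setT; apply: (eq_trans e).
apply: eq_integral => s; rewrite inE => s01 /=; rewrite /h Q01E//.
by move: s01; rewrite /= in_itv/= /Q01 => ->.
Qed.

End centrings.

(** * The large deviation principle *)

Theorem theorem4p8 (R : realType) (d : measure_display) (T : measurableType d)
    (P : probability T R) (X : {RV P >-> R}) (Xs : nat -> {RV P >-> R})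
    (a : nat -> R) (J : R -> R) (t1 t2 : R)
    (a_gt0 : forall n, (0 < n)%N -> 0 < a n)
    (a_cvgy : a n @[n --> \oo] --> +oo)
    (a_small : a n / Num.sqrt (n%:R : R) @[n --> \oo] --> (0 : R))
    (X_iid : iid_copies X Xs)
    (X_L2 : ('E_P[(fun w => X w ^+ 2)%R] < +oo)%E)
    (t1_gt0 : 0 < t1) (t1_lt_t2 : t1 < t2) (t2_lt1 : t2 < 1)
    (J_trimmed : forall u : R, 0 <= u < t1 \/ t2 < u <= 1 -> J u = 0)
    (J_bounded : exists M : R, forall u : R, 0 < u < 1 -> `|J u| <= M)
    (J_ae_lebesgue :
      (@lebesgue_measure R).-negligible (discontinuities01 J))
    (J_ae_quantile :
      stieltjes01_null (quantile (distr_fun X)) (discontinuities01 J))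
    (sigma2_gt0 : 0 < sigma2 J (distr_fun X)) :
  let W (c : R) (n : nat) (w : T) : R :=
    Num.sqrt (n%:R : R) / a n * (Lstat Xs J n w - c) in
  let IL (x : R) : \bar R := (x ^+ 2 / (2 * sigma2 J (distr_fun X)))%:E in
  LDP P (W (qcenter J (distr_fun X))) (fun n => a n ^+ 2) IL /\
  (continuous (distr_fun X) ->
   LDP P (W (mcenter X J)) (fun n => a n ^+ 2) IL).
Proof.
move=> W IL.
have [M fM] := zero_ext_bounded t1_gt0 t2_lt1 J_trimmed J_bounded.
have g_trim := reg_score_trimmed t1_gt0 t2_lt1 J_trimmed J_bounded.
have Dsub : discontinuities01 J `<=` `]0, 1[%classic.
  by move=> u [u01 _]; rewrite /= in_itv.
(* a null set of levels u, and a null set of abscissas x for the discontinuities at F x *)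
have [N [mN N0 DN]] := J_ae_lebesgue.
have [NQ [mNQ DNQ NQ0]] := stieltjes01_null_preimage Dsub J_ae_quantile.
pose F := distr_fun X.
pose NF : set (measurableTypeR R) := F @^-1` (NQ `&` `]0, 1[%classic).
have mNF : measurable NF.
  rewrite -[X in measurable X]setTI; apply: (measurable_distr_fun X) => //.
  exact: measurableI.
have DF x : ~ NF x -> ~ discontinuities01 J (F x).
  by move=> nN DFx; apply: nN; split; [exact: DNQ|exact: Dsub].
have Jg u : 0 <= u <= 1 -> ~ N u -> J u = reg_score J u.
  move=> u01 nN; apply: (reg_scoreE t1_gt0 t2_lt1 J_trimmed J_bounded u01).
  by move/DN.
have JgF x : ~ NF x -> J (F x) = reg_score J (F x).
  move=> /DF; apply: (reg_scoreE t1_gt0 t2_lt1 J_trimmed J_bounded).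
  exact: distr_fun_itv.
have osc_NF x : ~ NF x -> osc_env (zero_ext J) k (F x) @[k --> \oo] --> (0 : R).
  by move=> /DF h; apply: (osc_env_cvg fM); exact: (zero_ext_continuous t1_gt0 t2_lt1 J_trimmed).
have [A FA] := distr_fun_near_Ny X t1_gt0.
have [B FB] := distr_fun_near_y X t2_lt1.
have AB := ltW (trim_points_lt t1_lt_t2 FA FB).
set y := influence X (zero_ext J) A B.
have my : measurable_fun setT y by exact: (measurable_influence X A B fM).
have yM z : `|y z| <= M * (B - A) by exact: norm_influence_le.
have y0 : \int[P]_w y (X w) = 0 by exact: influence_mean.
have y2 : \int[P]_w (y (X w) ^+ 2) = sigma2 J F.
  exact: (influence_variance fM g_trim AB FA FB mNF NQ0 JgF).
pose V n w := Num.sqrt (n%:R : R) / a n * (n%:R^-1 * \sum_(i < n) y (Xs i w)).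
have ldp (c : R) : c = Lcenter X (zero_ext J) A B -> LDP P (W c) (fun n => a n ^+ 2) IL.
  move=> ->; apply: (LDP_quadratic_of_mgf (V := V)) => //.
  - by move=> n /a_gt0 an0; rewrite exprn_gt0.
  - exact: speed_cvgy.
  - move=> n; apply: measurable_funM => //; apply: measurable_funB => //.
    exact: measurable_Lstat.
  - move=> n; apply: measurable_funM => //; apply: measurable_funM => //.
    by apply: measurable_sum => i; exact: (measurableT_comp my (measurable_funPT (Xs i))).
  - move=> th e e0.
    exact: (mgf_normalized_sum X_iid my yM sigma2_gt0 y0 y2 a_gt0 a_small th e0).
  - move=> del L del0.
    have := remainder_superexponential X_iid fM g_trim t1_lt_t2 FA FB mN N0 Jg mNF NQ0
      osc_NF a_gt0 a_cvgy a_small my L del0.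
    apply: filterS => n; congr (P _ <= _)%E; apply/funext => w /=.
    by rewrite /W /V -mulrBr.
split; first by apply: ldp; exact: (qcenter_Lcenter fM g_trim FA FB AB mN N0 Jg).
move=> cF; apply: ldp.
rewrite (mcenter_qcenter fM g_trim FA FB mN N0 Jg cF).
exact: (qcenter_Lcenter fM g_trim FA FB AB mN N0 Jg).
Qed.
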